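(* Let $j$ be an even integer, let $a,b$ be integers with $b>1$, $0\le a<b$, and let $\alpha(n)$ denote either $\overline{p}_j(2n)$ or $\overline{p}_j(a,b;2n)$. Then there exist sequences of positive real numbers $\{A(n)\}$ and $\{\delta(n)\}$ with $\delta(n)\to0$ such that for every $d\ge1$, $$\lim_{n\to\infty}\widehat{J}^{d,n}_{\alpha}(X)=H_d(X)$$ uniformly for $X$ in compact subsets of $\mathbb{R}$, where $\widehat{J}^{d,n}_{\alpha}(X):=\frac{\delta(n)^{-d}}{\alpha(n)}J^{d,n}_{\alpha}\!\left(\frac{\delta(n)X-1}{\exp(A(n))}\right)$. Consequently, for each $d$ the Jensen polynomials $J^{d,n}_\alpha$ are hyperbolic for all but finitely many $n$, i.e. the sequence $\alpha(n)$ asymptotically satisfies all higher-order Turán inequalities.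
   Context: For a partition $\lambda=(\lambda_1,\dots,\lambda_\nu)$ (parts non-increasing, $\nu$ the number of parts), its BG-rank is $\sum_{i=1}^{\nu}(-1)^{i+1}\operatorname{par}(\lambda_i)$, where $\operatorname{par}(x)\in\{0,1\}$ is $x\bmod 2$. Via Littlewood's bijection, $\lambda$ corresponds to its $2$-core together with its $2$-quotient $(\hat\lambda_0,\hat\lambda_1)$; the $2$-quotient rank of $\lambda$ is $\nu(\hat\lambda_0)-\nu(\hat\lambda_1)$. Equivalently, if $\overline{p}_j(m,n)$ counts partitions of $n$ with BG-rank $j$ and $2$-quotient rank $m$, then $\sum_{n,m}\overline{p}_j(m,n)\zeta^mq^n=\frac{q^{(2j-1)j}}{(\zeta q^2;q^2)_\infty(\zeta^{-1}q^2;q^2)_\infty}$ with $(x;q)_\infty=\prod_{k\ge0}(1-xq^k)$. $\overline{p}_j(n)$ is the number of partitions of $n$ with BG-rank $j$; $\overline{p}_j(a,b;n)$ is the number with BG-rank $j$ and $2$-quotient rank $\equiv a \pmod b$. The Jensen polynomial of degree $d$ and shift $n$ of a sequence $\alpha$ is $J^{d,n}_\alpha(X)=\sum_{k=0}^{d}\binom{d}{k}\alpha(n+k)X^k$; it is hyperbolic if all its roots are real. $H_d(X)$ are the Hermite polynomials, defined by $\sum_{d\ge0}H_d(X)\frac{t^d}{d!}=e^{-t^2+Xt}$. The sequences $A(n),\delta(n)$ are those for which, for each $d$, $\log\frac{\alpha(n+k)}{\alpha(n)}=A(n)k-\delta(n)^2k^2+\sum_{i=3}^d g_i(n)k^i+o(\delta(n)^d)$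 with $g_i(n)=o(\delta(n)^i)$. *)

(* Defs.v *)
From HB Require Import structures.
From mathcomp Require Import all_boot all_order all_algebra.
From mathcomp Require Import all_classical all_reals all_analysis.
From mathcomp Require Import complex.
Set Implicit Arguments. Unset Strict Implicit. Unset Printing Implicit Defensive.
Import Order.TTheory GRing.Theory Num.Theory numFieldNormedType.Exports.
Local Open Scope ring_scope.

(* A partition of n is encoded as a nonincreasing n-tuple of parts in [0,n]
   summing to n (padded with trailing zeros; zero entries are not parts). *)
Definition is_partition (n : nat) (t : n.-tuple 'I_n.+1) : bool :=
  sorted (fun x y : 'I_n.+1 => (y <= x)%N) t && (sumn (map val t) == n).

(* BG-rank: sum_{i>=1} (-1)^(i+1) par(lambda_i); 0-indexed here.
   Zero padding entries contribute par(0) = 0. *)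
Definition bg_rank (n : nat) (t : n.-tuple 'I_n.+1) : int :=
  \sum_(i < n) (-1) ^+ i * (odd (tnth t i))%:Z.

Definition pbar (j : int) (n : nat) : nat :=
  #|[set t : n.-tuple 'I_n.+1 | is_partition t && (bg_rank t == j)]|.

(* ---------- 2-quotient rank, via the generating function ----------
   sum_{n,m} pbar_j(m,n) z^m q^n = q^{(2j-1)j} / ((z q^2;q^2)_oo (z^-1 q^2;q^2)_oo).
   Expanding each factor 1/(x q^2;q^2)_oo = prod_{i>=1} 1/(1 - x q^(2i))
   = sum over multiplicity functions (m_i)_{i>=1} of x^(sum m_i) q^(2 sum i m_i),
   the coefficient of z^m q^n counts pairs (f,g) of multiplicity functions
   (= pairs of partitions, the 2-quotient) with
   (2j-1)j + 2(|f|+|g|) = n and (#parts f) - (#parts g) = m.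
   For such pairs all parts and multiplicities are <= n, so functions
   'I_n.+1 -> 'I_n.+1 (with value 0 at part size 0) suffice. *)
Definition mfun (n : nat) := {ffun 'I_n.+1 -> 'I_n.+1}.
Definition mvalid n (f : mfun n) : bool := (val (f ord0) == 0)%N.
Definition msize n (f : mfun n) : nat := \sum_(i < n.+1) (i * f i)%N.
Definition mparts n (f : mfun n) : nat := \sum_(i < n.+1) val (f i).

Definition quot_pairs (j : int) (n : nat) : {set mfun n * mfun n} :=
  [set fg : mfun n * mfun n | mvalid fg.1 && mvalid fg.2 &&
     ((2 * j - 1) * j + (2 * (msize fg.1 + msize fg.2))%N%:Z == n%:Z)].

Definition qrank n (fg : mfun n * mfun n) : int :=
  (mparts fg.1)%:Z - (mparts fg.2)%:Z.

Definition pbar2 (j m : int) (n : nat) : nat :=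
  #|[set fg in quot_pairs j n | qrank fg == m]|.

Definition pbar_ab (j : int) (a b : nat) (n : nat) : nat :=
  #|[set fg in quot_pairs j n | (b%:Z %| qrank fg - a%:Z)%Z]|.

Definition jensen (R : realType) (alpha : nat -> R) (d n : nat) : {poly R} :=
  \poly_(k < d.+1) ('C(d, k)%:R * alpha (n + k)%N).

(* H_d with sum_d H_d(X) t^d/d! = exp(-t^2 + X t), i.e.
   H_d(X) = sum_{k <= d/2} (-1)^k d!/(k!(d-2k)!) X^(d-2k). *)
Definition hermite (R : realType) (d : nat) (X : R) : R :=
  \sum_(k < (d./2).+1)
     (-1) ^+ k * (d`! %/ (k`! * (d - k.*2)`!))%:R * X ^+ (d - k.*2).

Definition hyperbolic (R : realType) (p : {poly R}) : Prop :=
  forall z : R[i], root (map_poly (fun x : R => Complex x 0) p) z -> complex.Im z = 0.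

Definition jensen_hat (R : realType) (alpha A delta : nat -> R) (d n : nat) (X : R) : R :=
  (delta n) ^- d / alpha n * (jensen alpha d n).[(delta n * X - 1) / expR (A n)].

(* Main.v *)
(** Write [alpha(n)] as [b^-1 sum_s zeta^(-as) [x^(n-c)] G_s(x)] with
    [G_s(x) = prod_k 1 / ((1 - zeta^s x^k) (1 - zeta^(-s) x^k))], [zeta] a primitive
    [b]-th root of unity and [2c = (2j-1)j]; for [pbar] take [b = 1], by encoding a
    partition as the set of its shifted parts, sorted by parity. Put [N = n - c] and let
    [e^(-t)] be the saddle point, where the geometric variables whose generating
    functions make up [G_0] have total mean [N] and variance [1 / (2 w^2)]. With
    [A(n) = t] and [delta(n) = w], Cauchy's formula on the circle of radius [e^(-t)]
    turns the rescaled Jensen polynomial into the normalised integral of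
    [((1 - e^(-iwu)) / w + X e^(-iwu))^d] against the characteristic function of the
    centred sum. By a Lindeberg comparison the latter tends to [e^(-u^2/4)], so the limit
    is [E (X + iU)^d = H_d(X)] with [U] Gaussian of variance 2. Only polynomial savings of
    arbitrary order are needed away from [u = 0] and for [s <> 0]; these come from
    finitely many factors of the product, so no modular transformation is involved. *)

Require Import Defs.
From HB Require Import structures.
From mathcomp Require Import all_boot all_order all_algebra.
From mathcomp Require Import all_classical all_reals all_analysis.
From mathcomp Require Import measurable_realfun polyrcf complex ring lra zify.
Set Implicit Arguments.
Unset Strict Implicit.
Unset Printing Implicit Defensive.
Import Order.TTheory GRing.Theory Num.Theory numFieldNormedType.Exports.
Local Open Scope ring_scope.
Local Open Scope classical_set_scope.

(** * Counting partitions by polynomial congruences *)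

(** Since [jensen_hat] divides by [alpha n], the prefactor in Cauchy's formula cancels and only
    ratios of integrals have to converge. Every product is truncated: for [d <= N] the Jensen
    polynomial involves coefficients of index at most [N + d <= 2N], which the factors with
    [k <= 2N] determine, and the saddle equation is the same finite sum, so the centring is exact.
    The obstacle is the size of the tail. The width [w] is of order [t^(3/2)], so the rescaled
    circle has length of order [t^(-3/2)] and [(1 - e^(-iwu)) / w] can be as large as [2 / w]. A
    bound [t^(3m+4)] on the product beats the [m]-th power of this together with the length. With
    [theta = w u] there are three ranges. For [|theta| <= t] there is a Gaussian majorant. Up to
    [sqrt t] the product is exponentially small in [t^(-1/2)]. Beyond, [e^(ik theta)] and
    [e^(i(k+1) theta)] cannot both be near 1, so each pair of neighbouring factors saves a power of
    [t]; a similar argument covers [z != 1] for all angles. As [pbar] is defined by BG-rank and not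
    by quotient pairs, its generating function is derived separately, through Gaussian binomials. *)

Definition modX (F : comNzRingType) (n : nat) (p q : {poly F}) : Prop :=
  exists r : {poly F}, p = q + 'X^n * r.

Lemma modX_refl (F : comNzRingType) n (p : {poly F}) : modX n p p.
Proof. by exists 0; rewrite mulr0 addr0. Qed.

Lemma modX_trans (F : comNzRingType) n (p q s : {poly F}) :
  modX n p q -> modX n q s -> modX n p s.
Proof. by move=> [r ->] [r' ->]; exists (r + r'); ring. Qed.

Lemma modXM (F : comNzRingType) n (p q p' q' : {poly F}) :
  modX n p q -> modX n p' q' -> modX n (p * p') (q * q').
Proof.
move=> [r ->] [r' ->]; exists (q * r' + q' * r + 'X^n * r * r'); ring.
Qed.

Lemma modX_prod (F : comNzRingType) n (I : Type) (s : seq I) (P : pred I)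
    (f : I -> {poly F}) :
  (forall i, P i -> modX n (f i) 1) -> modX n (\prod_(i <- s | P i) f i) 1.
Proof.
move=> H; elim/big_rec: _ => [|i p Pi IH]; first exact: modX_refl.
by rewrite -[X in modX _ _ X]mulr1; apply: modXM => //; exact: H.
Qed.

Lemma modX_le (F : comNzRingType) n m (p q : {poly F}) :
  (m <= n)%N -> modX n p q -> modX m p q.
Proof.
by move=> mn [r ->]; exists ('X^(n - m) * r); rewrite mulrA -exprD subnKC.
Qed.

Definition euler (F : comNzRingType) (z : F) (L : nat) : {poly F} :=
  \prod_(1 <= k < L.+1) (1 - z *: 'X^k).

(** Each factor with [k > m] is 1 modulo ['X^(m.+1)], so both truncations agree with the one at
    [m]. *)
Lemma modX_euler (F : comNzRingType) (z : F) m L L' :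
  (m <= L)%N -> (m <= L')%N -> modX m.+1 (euler z L) (euler z L').
Proof.
have up k : modX m.+1 (euler z (m + k)) (euler z m).
  elim: k => [|k IH]; first by rewrite addn0; exact: modX_refl.
  rewrite addnS /euler big_nat_recr //= -[X in modX _ _ X]mulr1.
  apply: modXM => //; exists (- (z *: 'X^k)).
  by rewrite mulrN -scalerAr -exprD addSn.
have down k : modX m.+1 (euler z m) (euler z (m + k)).
  by have [r Hr] := up k; exists (- r); rewrite Hr; ring.
move=> /subnKC <- /subnKC <-.
exact: modX_trans (up _) (down _).
Qed.

(* [c] is the coefficient of [x^m] in [1 / prod_k (1 - z x^k)(1 - w x^k)]. *)
Definition is_bicoef (F : comNzRingType) (z w : F) (m : nat) (c : F) : Prop :=
  exists2 P : {poly F}, P`_m = c &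
    forall L, (m <= L)%N -> modX m.+1 (P * (euler z L * euler w L)) 1.

(** Multiplicities are cut at [N] so that the expanded product runs over exactly the functions in
    [mfun N]. *)
Definition multsum (F : comNzRingType) (z : F) (N : nat) : {poly F} :=
  \prod_(1 <= i < N.+1) \sum_(v < N.+1) (z *: 'X^i) ^+ v.

Lemma multsum_euler (F : comNzRingType) (z : F) N :
  modX N.+1 (multsum z N * euler z N) 1.
Proof.
rewrite /multsum /euler -big_split /= big_seq_cond.
apply: modX_prod => i; rewrite mem_index_iota andbT => /andP[i0 _].
(* The geometric sum telescopes to [1 - (z X^i)^(N+1)], and [i >= 1] leaves [X^((i-1)(N+1))] after
   extracting [X^(N+1)]. *)
exists (- ('X^(i.-1 * N.+1) * (z ^+ N.+1)%:P)).
rewrite mulrC -[1 - _]opprB mulNr -subrX1 opprB exprZn -exprM.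
rewrite -mul_polyC mulrN mulrA -exprD mulrC; congr (_ - 'X^_ * _).
by case: i i0 => // i _ /=; rewrite mulSn.
Qed.

Lemma multsum_mfun (F : comNzRingType) (z : F) N :
  multsum z N = \sum_(f : Defs.mfun N | mvalid f) z ^+ mparts f *: 'X^(msize f).
Proof.
(* Index 0 is not a part size. The guard restricts it to multiplicity 0, hence to a factor 1, which
   is the condition [mvalid]. *)
pose Q (i v : 'I_N.+1) := (i == ord0) ==> (v == ord0).
have -> : multsum z N =
    \prod_(i < N.+1) \sum_(v < N.+1 | Q i v) (z *: 'X^i) ^+ v.
  rewrite /multsum -(big_mkord xpredT
    (fun i => \sum_(v < N.+1 | (i == 0%N) ==> (v == ord0)) (z *: 'X^i) ^+ v)).
  rewrite [RHS]big_nat_recl // big_add1 /= [X in _ = X * _](_ : _ = 1) ?mul1r //.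
  by rewrite (big_pred1 ord0) // expr0.
rewrite bigA_distr_big_dep /=; apply: eq_big => f.
  rewrite /mvalid; apply/familyP/idP => [/(_ ord0)|/eqP f0 i].
    by rewrite /in_mem /= /Q eqxx.
  by rewrite /in_mem /= /Q; apply/implyP => /eqP ->; rewrite -val_eqE /= f0.
move=> _; rewrite /mparts /msize.
elim/big_ind3: _ => [|p k q l s t -> ->|i _]; first by rewrite !expr0 scale1r.
  by rewrite !exprD -scalerAl -scalerAr scalerA.
by rewrite exprZn exprM.
Qed.

Lemma is_bicoef_multsum (F : comNzRingType) (z w : F) m N : (m <= N)%N ->
  is_bicoef z w m
    (\sum_(fg : Defs.mfun N * Defs.mfun N | [&& mvalid fg.1, mvalid fg.2 &
        msize fg.1 + msize fg.2 == m]%N)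
       z ^+ mparts fg.1 * w ^+ mparts fg.2).
Proof.
move=> mN; exists (multsum z N * multsum w N).
  rewrite !multsum_mfun big_distrlr pair_big /= coef_sum.
  rewrite [RHS](eq_bigl (fun fg : Defs.mfun N * Defs.mfun N =>
     (mvalid fg.1 && mvalid fg.2) && (msize fg.1 + msize fg.2 == m)%N));
    last by move=> fg; rewrite -andbA.
  rewrite [RHS]big_mkcondr /=; apply: eq_bigr => fg _.
  rewrite -scalerAl -scalerAr scalerA -exprD coefZ coefXn eq_sym.
  by case: ifP => _; rewrite ?mulr1 ?mulr0.
move=> L mL; have H (y : F) : modX m.+1 (multsum y N * euler y L) 1.
  apply: (@modX_trans _ _ _ (multsum y N * euler y N)).
    by apply: modXM; [exact: modX_refl|exact: modX_euler].
  exact: modX_le (multsum_euler _ _).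
rewrite mulrACA -[1]mulr1; exact: modXM.
Qed.

(** Removing the largest part decreases the length and makes that part the new bound; this is the
    recursion along which the generating function is computed. *)
Fixpoint nonincr_seqs (M B : nat) : seq (seq nat) :=
  if M is M'.+1 then
    flatten [seq [seq v :: s | s <- nonincr_seqs M' v] | v <- iota 0 B.+1]
  else [:: [::]].

Lemma nonincr_seqsS M B : nonincr_seqs M.+1 B =
  flatten [seq [seq v :: s | s <- nonincr_seqs M v] | v <- iota 0 B.+1].
Proof. by []. Qed.

Lemma mem_nonincr_seqs M B s : (s \in nonincr_seqs M B) =
  (size s == M) && path (fun x y => (y <= x)%N) B s.
Proof.
elim: M B s => [|M IH] B s; first by case: s.
rewrite nonincr_seqsS; case: s => [|v s].
  by apply/negP => /flattenP[_ /mapP[v _ ->] /mapP[]].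
rewrite [size _]/= eqSS [path _ _ _]/=; apply/idP/idP.
  move=> /flattenP[_ /mapP[w wB ->] /mapP[s' Hs' [-> ->]]].
  move: wB; rewrite mem_iota ltnS => /andP[_ ->].
  by move: Hs'; rewrite IH => /andP[-> ->].
move=> /andP[sM /andP[vB ps]].
apply/flattenP; exists [seq v :: s' | s' <- nonincr_seqs M v].
  by apply/mapP; exists v => //; rewrite mem_iota.
by apply/mapP; exists s => //; rewrite IH sM.
Qed.

Lemma uniq_nonincr_seqs M B : uniq (nonincr_seqs M B).
Proof.
elim: M B => [|M IH] B //.
rewrite nonincr_seqsS.
apply: allpairs_uniq_dep; first exact: iota_uniq.
  by move=> v _; exact: IH.
by move=> [v s] [v' s'] _ _ /= [-> ->].
Qed.

(** The BG-rank in recursive form: dropping the first part flips all remaining signs. *)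
Fixpoint alt_parity (s : seq nat) : int :=
  if s is v :: s' then (odd v)%:Z - alt_parity s' else 0.

Lemma alt_parityE m N (t : m.-tuple 'I_N.+1) :
  alt_parity (map val t) = \sum_(i < m) (-1) ^+ i * (odd (tnth t i))%:Z.
Proof.
elim: m t => [|m IH] t; first by rewrite tuple0 big_ord0.
rewrite big_ord_recl /= expr0 mul1r.
case/tupleP: t => x t; rewrite /= IH tnth0; congr (_ + _).
rewrite -sumrN; apply: eq_bigr => i _.
by rewrite tnthS /bump /= exprS mulN1r mulNr.
Qed.

Lemma pbarE (j : int) N : pbar j N =
  count (fun s => (sumn s == N) && (alt_parity s == j)) (nonincr_seqs N N).
Proof.
rewrite /pbar cardE -(size_map (fun t : N.-tuple 'I_N.+1 => map val t)) -size_filter.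
apply: perm_size; apply: uniq_perm.
- rewrite map_inj_uniq ?enum_uniq // => t t' /inj_map e.
  by apply: val_inj; apply: e; exact: val_inj.
- exact/filter_uniq/uniq_nonincr_seqs.
move=> s; rewrite mem_filter mem_nonincr_seqs.
apply/mapP/idP => [[t]|/andP[/andP[/eqP sN /eqP sj] /andP[/eqP sz ps]]].
  rewrite mem_enum inE /is_partition => /andP[/andP[st /eqP sN] /eqP bj] ->.
  rewrite sN alt_parityE -[X in X == j]/(bg_rank t) bj !eqxx size_map size_tuple eqxx /=.
  case: {sN bj} t st => [[|x s'] i] //= p.
  by rewrite -ltnS ltn_ord /= path_map.
have sB : all (fun x => x < N.+1)%N s.
  move: ps; rewrite path_sortedE; last by move=> a b c ab ac; exact: leq_trans ac ab.
  by move=> /andP[+ _]; apply: sub_all => x.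
pose l : seq 'I_N.+1 := [seq inord x | x <- s].
have ls : map val l = s.
  rewrite /l -map_comp -[RHS]map_id; apply/eq_in_map => x xs /=.
  by rewrite inordK //; exact: (allP sB).
have lz : size l == N by rewrite size_map sz.
exists (Tuple lz); last by rewrite /= ls.
rewrite mem_enum inE /is_partition /bg_rank -alt_parityE /= ls sN sj !eqxx !andbT.
have := path_sorted ps; rewrite -{1}ls sorted_map.
by apply: sub_sorted.
Qed.

(** * Generating function of the partitions with given BG-rank *)

Section BGRankGF.
Variable F : comNzRingType.

Definition bg_poly M B (j : int) : {poly F} :=
  \sum_(s <- nonincr_seqs M B | alt_parity s == j) 'X^(sumn s).

Lemma coef_bg_poly j N : (bg_poly N N j)`_N = (pbar j N)%:R.
Proof.
rewrite pbarE coef_sum -sum1_count natr_sum big_mkcond [RHS]big_mkcond /=.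
apply: eq_bigr => s _; rewrite coefXn [_ == sumn s]eq_sym.
by case: (alt_parity s == j); case: (sumn s == N).
Qed.

Lemma bg_polyS M B j : bg_poly M.+1 B j =
  \sum_(v <- iota 0 B.+1) 'X^v * bg_poly M v ((odd v)%:Z - j).
Proof.
rewrite /bg_poly nonincr_seqsS big_flatten big_map; apply: eq_bigr => v _.
rewrite big_map mulr_sumr; apply: eq_big => s; first by rewrite /=; lia.
by rewrite exprD.
Qed.

(* Generating function, by sum, of the [m]-subsets of the integers below [T]
   that are odd ([e = true]) or even ([e = false]). *)
Fixpoint subset_poly (e : bool) T (m : int) : {poly F} :=
  if T is T'.+1 then
    subset_poly e T' m + (if odd T' == e then 'X^T' * subset_poly e T' (m - 1) else 0)
  else (m == 0)%:R.

Lemma subset_poly_lt0 e T m : m < 0 -> subset_poly e T m = 0.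
Proof.
elim: T m => [|T IH] m m0 /=; first by case: eqP m0 => // ->.
by rewrite !IH ?mulr0 ?if_same ?addr0 //; lia.
Qed.

Lemma subset_poly_gt e T (m : int) :
  ((if e then T./2 else uphalf T)%:Z < m) -> subset_poly e T m = 0.
Proof.
elim: T m => [|T IH] m /=; first by case: e; case: eqP => // ->.
move=> mT; rewrite IH ?add0r; last by clear IH; case: e mT; lia.
by case: eqP => // oT; rewrite IH ?mulr0 //; clear IH; case: e mT oT; lia.
Qed.

(** The element [s_i + M - 1 - i] is even exactly when [s_i] and [M - 1 - i] have equal parity. For
    even [M] this counts the odd parts at even [i] and the even parts at odd [i], in total
    [M/2 + j]; for odd [M] the two roles are exchanged. *)
Definition even_size (M : nat) (j : int) : int :=
  if odd M then (uphalf M)%:Z - j else M./2%:Z + j.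

Lemma even_sizeS M B j : even_size M ((odd B)%:Z - j) =
  even_size M.+1 j - (~~ odd (M + B))%:Z.
Proof.
rewrite /even_size oddD /= uphalf_half.
have := odd_double_half M.
by case: (odd M); case: (odd B) => /=; lia.
Qed.

(* The set [{s_i + M - 1 - i}] attached to [s] has [even_size M j] even elements. *)
Lemma bg_poly_subset M B j : bg_poly M B j * 'X^('C(M, 2)) =
  subset_poly false (M + B) (even_size M j) *
  subset_poly true (M + B) (M%:Z - even_size M j).
Proof.
elim: M B j => [|M IHM] B j.
  rewrite /bg_poly /= big_cons big_nil /= eq_sym bin0n expr0 mulr1 /even_size /=.
  rewrite add0n add0r sub0r.
  have [->|j0] := eqVneq j 0.
    rewrite oppr0 /= addr0; elim: B => [|B IH]; first by rewrite mulr1.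
    by rewrite /= !(subset_poly_lt0 _ _ (m := 0 - 1)) // !mulr0 !if_same !addr0.
  have [j1|j1] := ltP j 0; first by rewrite (subset_poly_lt0 _ _ j1) mul0r.
  by rewrite [X in _ * X]subset_poly_lt0 ?mulr0 //; lia.
(* Split on whether the top element [M + B'] is taken. It is the shifted first part [B'] of a
   sequence of length [M.+1], and the rest of the set encodes the tail, whose BG-rank is
   [odd B' - j]. *)
have step B' : subset_poly false (M + B').+1 (even_size M.+1 j) *
    subset_poly true (M + B').+1 (M.+1%:Z - even_size M.+1 j) =
    subset_poly false (M + B') (even_size M.+1 j) *
    subset_poly true (M + B') (M.+1%:Z - even_size M.+1 j) +
    'X^(M + B') * (bg_poly M B' ((odd B')%:Z - j) * 'X^('C(M, 2))).
  rewrite IHM even_sizeS /=.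
  have [oT|oT] /= := boolP (odd (M + B')).
    rewrite !addr0 mulrDr mulrCA; congr (_ + _ * (subset_poly _ _ _ * subset_poly _ _ _));
    by rewrite ?subr0; lia.
  rewrite addr0 mulrDl -mulrA; congr (_ + _ * (subset_poly _ _ _ * subset_poly _ _ _));
    by rewrite ?subr0; lia.
have binS : 'C(M.+1, 2) = ('C(M, 2) + M)%N by rewrite binS bin1 addnC.
elim: B => [|B IHB].
  rewrite addSn step bg_polyS big_cons big_nil addr0 addn0 expr0 mul1r binS exprD.
  (* [M.+1] distinct elements do not fit below [M], so one parity class is overfull and the first
     summand vanishes. *)
  have [lt|ge] := ltP (uphalf M)%:Z (even_size M.+1 j).
    by rewrite (subset_poly_gt (e := false)) // mul0r add0r; ring.
  by rewrite (subset_poly_gt (e := true)) ?mulr0 ?add0r; [ring|lia].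
have bgS : bg_poly M.+1 B.+1 j =
    bg_poly M.+1 B j + 'X^(B.+1) * bg_poly M B.+1 ((odd B.+1)%:Z - j).
  rewrite !bg_polyS -[in LHS](addn1 B.+1) iotaD big_cat /= add0n; congr (_ + _).
  by rewrite big_cons big_nil addr0.
rewrite addSn step bgS mulrDl IHB addSnnS; congr (_ + _).
by rewrite binS !exprD; ring.
Qed.

Fixpoint gauss_binom T m : {poly F} :=
  match T, m with
  | _, 0 => 1
  | 0, _.+1 => 0
  | T'.+1, m'.+1 => gauss_binom T' m + 'X^(T' - m') * gauss_binom T' m'
  end.

Lemma gauss_binom0 T : gauss_binom T 0 = 1. Proof. by case: T. Qed.

Lemma gauss_binom_gt T m : (T < m)%N -> gauss_binom T m = 0.
Proof.
elim: T m => [|T IH] [|m] //= Tm; rewrite !IH ?mulr0 ?addr0 //.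
exact: ltnW.
Qed.

Lemma gauss_binom_euler T m : gauss_binom T m * euler 1 m =
  \prod_(i < m) (1 - 'X^(T - i)).
Proof.
elim: T m => [|T IH] [|m].
- by rewrite big_ord0 gauss_binom0 /euler big_geq // mulr1.
- by rewrite mul0r big_ord_recl subn0 subrr mul0r.
- by rewrite big_ord0 gauss_binom0 /euler big_geq // mulr1.
rewrite big_ord_recl subn0 /=.
under [in RHS]eq_bigr do rewrite /bump subSS.
have eS : euler (1 : F) m.+1 = euler 1 m * (1 - 'X^(m.+1)).
  by rewrite /euler big_nat_recr //= scale1r.
rewrite mulrDl IH eS big_ord_recr /= -IH.
have [Tm|mT] := ltnP T m.
  by rewrite gauss_binom_gt // !(mul0r, mulr0) addr0.
have -> : 'X^(T.+1) = 'X^(T - m) * 'X^(m.+1) :> {poly F}.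
  by rewrite -exprD addnS subnK.
by ring.
Qed.

(** In the product formula every exponent [T - i] with [i < u] exceeds [m], so the numerator is 1 to
    this order and the Gaussian binomial acts as an inverse of [euler 1 u]. *)
Lemma modX_gauss_binom T u m : (u <= T)%N -> (m <= T - u)%N ->
  modX m.+1 (gauss_binom T u * euler 1 u) 1.
Proof.
move=> uT mTu; rewrite gauss_binom_euler; apply: modX_prod => i _.
exists (- 'X^(T - i - m.+1)); rewrite mulrN -exprD subnKC //.
have := ltn_ord i; lia.
Qed.

(** The least sum of [m] distinct even numbers is [0 + 2 + ... + 2(m-1) = m(m-1)], and [m] more for
    odd ones. The excess over it is even, and half of it is counted by the Gaussian binomial. *)
Lemma subset_poly_gauss (e : bool) T (m : nat) : subset_poly e T m =
  'X^(m * m.-1 + e * m) * (gauss_binom (if e then T./2 else uphalf T) m \Po 'X^2).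
Proof.
elim: T m => [|T IH] m /=.
  by case: e; case: m => [|m] /=; rewrite ?comp_polyC ?comp_poly0 ?mulr0 ?mulr1.
case: m => [|m].
  rewrite IH (subset_poly_lt0 _ _ (m := 0 - 1)) // mulr0 if_same addr0.
  by rewrite !gauss_binom0.
have -> : m.+1%:Z - 1 = m%:Z by lia.
rewrite !IH.
have [oT|oT] := eqVneq (odd T) e; last first.
  rewrite addr0; congr (_ * (gauss_binom _ _ \Po _)).
  by case: e {IH} oT => /=; lia.
have -> : (if e then uphalf T else T./2.+1) = (if e then T./2 else uphalf T).+1.
  by case: e {IH} oT => /=; lia.
set K := (if e then T./2 else _).
rewrite /= comp_polyD comp_polyM comp_Xn_poly -exprM mulrDr; congr (_ + _).
have [Km|mK] := ltnP K m; first by rewrite gauss_binom_gt // !comp_poly0 !mulr0.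
rewrite !mulrA -!exprD; congr ('X^_ * _).
by move: mK oT; rewrite /K; case: (e); case: (m) => [|k] /=; nia.
Qed.

(** With [2n] shifted parts, [u = n + j] of them are even and [v = n - j] odd. The bound [|j| <= c]
    makes both nonnegative and at least [n - c], so to the order required the two Gaussian binomials
    are inverses of Euler products. *)
Lemma pbar_bicoef (j : int) (n c : nat) : (2 * j - 1) * j = (c.*2)%:Z ->
  (`|j|%N <= c)%N -> (c <= n)%N ->
  is_bicoef (1 : F) 1 (n - c) (pbar j n.*2)%:R.
Proof.
move=> jc jlec cn.
have [u [v [uE vE]]] : exists u v : nat, n%:Z + j = u%:Z /\ n%:Z - j = v%:Z.
  by exists (absz (n%:Z + j)), (absz (n%:Z - j)); lia.
exists (gauss_binom n.*2 u * gauss_binom n.*2 v); last first.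
  move=> L mL; rewrite mulrACA -[X in modX _ _ X]mulr1; apply: modXM.
    apply: (@modX_trans _ _ _ (gauss_binom n.*2 u * euler 1 u)).
      by apply: modXM; [exact: modX_refl|apply: modX_euler => //; lia].
    by apply: modX_gauss_binom; lia.
  apply: (@modX_trans _ _ _ (gauss_binom n.*2 v * euler 1 v)).
    by apply: modXM; [exact: modX_refl|apply: modX_euler => //; lia].
  by apply: modX_gauss_binom; lia.
have := bg_poly_subset n.*2 n.*2 j.
have -> : even_size n.*2 j = u%:Z by rewrite /even_size odd_double; lia.
have -> : n.*2%:Z - u%:Z = v%:Z by lia.
rewrite !subset_poly_gauss mul0n mul1n addn0.
have -> : (n.*2 + n.*2)./2 = n.*2 by lia.
have -> : uphalf (n.*2 + n.*2) = n.*2 by lia.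
(* The minimal sums of the two classes exceed the staircase [C(2n, 2)] by [(2j-1)j = 2c]; what
   remains is a polynomial in ['X^2]. *)
have ex : (u * u.-1 + (v * v.-1 + v) = 'C(n.*2, 2) + c.*2)%N.
  by rewrite bin2; case: (u) uE => [|u'] uE; case: (v) vE => [|v'] vE /=; nia.
rewrite mulrACA -exprD ex exprD -comp_polyM => e.
have {e} : bg_poly n.*2 n.*2 j =
    'X^(c.*2) * ((gauss_binom n.*2 u * gauss_binom n.*2 v) \Po 'X^2).
  have /lreg_lead : GRing.lreg (lead_coef ('X^'C(n.*2, 2) : {poly F})).
    by rewrite lead_coefXn; exact: lreg1.
  by apply; rewrite [LHS]mulrC e mulrA.
move/(congr1 (fun p : {poly F} => p`_n.*2)); rewrite coef_bg_poly => ->.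
rewrite coefXnM ltn_double ltnNge cn /= -doubleB coef_comp_poly_Xn //.
by rewrite dvdn2 odd_double /= divn2 doubleK.
Qed.

End BGRankGF.

(** * Complex numbers of norm one *)

Import Normc.
Local Open Scope complex_scope.

Section ComplexNorm.
Variable R : realType.
Implicit Types z w : R[i].

Lemma normc_ge0 z : 0 <= normc z.
Proof. by case: z => a b; exact: sqrtr_ge0. Qed.

Lemma normc_sqr z : normc z ^+ 2 = complex.Re z ^+ 2 + complex.Im z ^+ 2.
Proof. by case: z => a b; rewrite /= sqr_sqrtr // addr_ge0 ?sqr_ge0. Qed.

Lemma ler_normcD z w : normc (z + w) <= normc z + normc w.
Proof. exact: le_normcD. Qed.

Lemma normc_opp z : normc (- z) = normc z.
Proof. exact: normcN. Qed.

Lemma normcBC z w : normc (z - w) = normc (w - z).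
Proof. by rewrite -normc_opp opprB. Qed.

Lemma normcX z n : normc (z ^+ n) = normc z ^+ n.
Proof. by elim: n => [|n IH]; rewrite ?expr0 ?normc1 // !exprS normcM IH. Qed.

Lemma normc_prod (I : Type) (s : seq I) (P : pred I) (f : I -> R[i]) :
  normc (\prod_(i <- s | P i) f i) = \prod_(i <- s | P i) normc (f i).
Proof. by apply: big_morph => [z w|]; rewrite ?normcM ?normc1. Qed.

Lemma ler_normc_sum (I : Type) (s : seq I) (P : pred I) (f : I -> R[i]) :
  normc (\sum_(i <- s | P i) f i) <= \sum_(i <- s | P i) normc (f i).
Proof.
elim/big_ind2: _ => [|x a y b xa yb|//]; first by rewrite normc0.
by apply: le_trans (ler_normcD _ _) _; exact: lerD.
Qed.

Lemma ler_Re_normc z : `|complex.Re z| <= normc z.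
Proof.
rewrite -(@ler_pXn2r _ 2) ?nnegrE ?normc_ge0 // normc_sqr real_normK ?num_real //.
by rewrite lerDl sqr_ge0.
Qed.

Lemma ler_Im_normc z : `|complex.Im z| <= normc z.
Proof.
rewrite -(@ler_pXn2r _ 2) ?nnegrE ?normc_ge0 // normc_sqr real_normK ?num_real //.
by rewrite lerDr sqr_ge0.
Qed.

Lemma ler_normc_ReIm z : normc z <= `|complex.Re z| + `|complex.Im z|.
Proof.
rewrite -(@ler_pXn2r _ 2) ?nnegrE ?normc_ge0 ?addr_ge0 // normc_sqr sqrrD.
rewrite !real_normK ?num_real // addrAC lerDl mulrn_wge0 // mulr_ge0.
Qed.

Lemma normc_real (x : R) : normc x%:C = `|x|.
Proof. by rewrite /= expr0n addr0 sqrtr_sqr. Qed.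

Lemma normc_eq0 z : (normc z == 0) = (z == 0).
Proof. by apply/eqP/eqP => [/eq0_normc//|->]; rewrite normc0. Qed.

Lemma complex_Re_sum (I : Type) (s : seq I) (P : pred I) (f : I -> R[i]) :
  complex.Re (\sum_(i <- s | P i) f i) = \sum_(i <- s | P i) complex.Re (f i).
Proof. by apply: big_morph => // -[a b] [c d]. Qed.

Lemma complex_ReD z w : complex.Re (z + w) = complex.Re z + complex.Re w.
Proof. by case: z w => [a b] [c d]. Qed.

Lemma complex_ImD z w : complex.Im (z + w) = complex.Im z + complex.Im w.
Proof. by case: z w => [a b] [c d]. Qed.

Lemma complex_ReM z w : complex.Re (z * w) =
  complex.Re z * complex.Re w - complex.Im z * complex.Im w.
Proof. by case: z w => [a b] [c d]. Qed.

Lemma complex_ImM z w : complex.Im (z * w) =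
  complex.Re z * complex.Im w + complex.Im z * complex.Re w.
Proof. by case: z w => [a b] [c d]. Qed.

Lemma complex_ReMr (x : R) z : complex.Re (x%:C * z) = x * complex.Re z.
Proof. by rewrite complex_ReM /= mul0r subr0. Qed.

Lemma complex_ReV z : complex.Re z^-1 = complex.Re z / normc z ^+ 2.
Proof. by rewrite normc_sqr; case: z. Qed.

Lemma complex_ImV z : complex.Im z^-1 = - complex.Im z / normc z ^+ 2.
Proof. by rewrite normc_sqr; case: z => a b /=; rewrite mulNr. Qed.

End ComplexNorm.

Section Cis.
Variable R : realType.
Implicit Types x y : R.

Definition cis x : R[i] := cos x +i* sin x.

Lemma cisD x y : cis (x + y) = cis x * cis y.
Proof.
by apply/eqP; rewrite eq_complex /= cosD sinD eqxx addrC eqxx.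
Qed.

Lemma cis0 : cis 0 = 1. Proof. by rewrite /cis cos0 sin0. Qed.

Lemma cisX x n : cis x ^+ n = cis (n%:R * x).
Proof.
elim: n => [|n IH]; first by rewrite mul0r cis0.
by rewrite exprS IH -cisD -natr1 mulrDl mul1r addrC.
Qed.

Lemma normc_cis x : normc (cis x) = 1.
Proof. by rewrite /= cos2Dsin2 sqrtr1. Qed.

Lemma cis_neq0 x : cis x != 0.
Proof. by rewrite -normc_eq0 normc_cis oner_eq0. Qed.

Lemma cis_neq1 x : 0 < x < pi *+ 2 -> cis x != 1.
Proof.
move=> /andP[x0 x2]; apply: contraTneq isT => /(congr1 (@complex.Re R)) /= c1.
have s0 : 0 < sin (x / 2).
  by apply: sin_gt0_pi; rewrite divr_gt0 //= ltr_pdivrMr // mulr_natr.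
have := cos_mulr2n (x / 2); rewrite -[x / 2 *+ 2]mulr_natr mulfVK ?pnatr_eq0 // c1.
by rewrite cos2sin2 => h; have := exprn_gt0 2 s0; lra.
Qed.

Definition unity_root (b : nat) : R[i] := cis (pi *+ 2 / b%:R).

Lemma unity_root_prim b : (0 < b)%N -> b.-primitive_root (unity_root b).
Proof.
move=> b0; apply/andP; split => //; apply/forallP => i.
rewrite unity_rootE /unity_root cisX; apply/eqP.
have bR : (0 : R) < b%:R by rewrite ltr0n.
have [->|ib] := eqVneq i.+1 b.
  have -> : b%:R * (pi *+ 2 / b%:R) = pi *+ 2 :> R by field; rewrite gt_eqF.
  by rewrite /cis cos2pi sin2pi; exact: eqxx.
apply/negbTE/cis_neq1.
have p2 : (0 : R) < pi *+ 2 by rewrite mulrn_wgt0 // pi_gt0.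
have q0 : (0 : R) < i.+1%:R / b%:R by rewrite divr_gt0 ?ltr0n.
have q1 : (i.+1%:R / b%:R : R) < 1.
  by rewrite ltr_pdivrMr // mul1r ltr_nat ltn_neqAle ib ltn_ord.
have -> : i.+1%:R * (pi *+ 2 / b%:R) = (i.+1%:R / b%:R) * (pi *+ 2) :> R.
  by field; rewrite gt_eqF.
by rewrite mulr_gt0 //= gtr_pMl.
Qed.

Lemma unity_root_filter b (x y : nat) : (0 < b)%N ->
  \sum_(s < b) (unity_root b ^+ s) ^+ x * ((unity_root b ^+ s)^-1) ^+ y =
  (b * (x == y %[mod b]))%:R.
Proof.
move=> b0; have zp := unity_root_prim b0; set z := unity_root b in zp *.
have z0 : z != 0 by exact: cis_neq0.
rewrite -(eq_prim_root_expr zp).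
have -> : \sum_(s < b) (z ^+ s) ^+ x * ((z ^+ s)^-1) ^+ y =
    \sum_(s < b) (z ^+ x / z ^+ y) ^+ s.
  by apply: eq_bigr => s _; rewrite exprMn !exprVn -!exprM mulnC [(s * y)%N]mulnC.
have [->|xy] := eqVneq (z ^+ x) (z ^+ y).
  rewrite divff ?expf_neq0 // muln1 (eq_bigr (fun=> 1)) => [|s _]; last exact: expr1n.
  by rewrite sumr_const card_ord.
rewrite muln0; have := subrX1 (z ^+ x / z ^+ y) b.
rewrite exprMn exprVn -!exprM mulnC exprM (prim_expr_order zp) expr1n.
rewrite mulnC exprM (prim_expr_order zp) expr1n invr1 mulr1 subrr => /esym/eqP.
by rewrite mulf_eq0 subr_eq0 (can2_eq (mulfVK _) (mulfK _)) ?expf_neq0 // mul1r (negbTE xy) => /eqP.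
Qed.

End Cis.

(** The rank condition, rewritten as [mparts f = mparts g + a] modulo [b] to stay in [nat], is
    detected by orthogonality of the powers of a primitive root. The factor [b] on the left avoids a
    division. *)
Lemma pbar_ab_bicoef (R : realType) (j : int) (a b n c : nat) : (0 < b)%N ->
  (2 * j - 1) * j = (c.*2)%:Z -> (c <= n)%N ->
  exists2 C : nat -> R[i],
    (forall s, is_bicoef (unity_root R b ^+ s) (unity_root R b ^+ s)^-1 (n - c) (C s)) &
    (b * pbar_ab j a b n.*2)%:R = \sum_(s < b) ((unity_root R b ^+ s)^-1) ^+ a * C s.
Proof.
move=> b0 jc cn; set z := unity_root R b.
exists (fun s => \sum_(fg : Defs.mfun n.*2 * Defs.mfun n.*2 |
    [&& mvalid fg.1, mvalid fg.2 & msize fg.1 + msize fg.2 == n - c]%N)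
      (z ^+ s) ^+ mparts fg.1 * (z ^+ s)^-1 ^+ mparts fg.2).
  by move=> s; apply: is_bicoef_multsum; lia.
under eq_bigr do rewrite mulr_sumr.
rewrite exchange_big /= /pbar_ab -sum1_card big_distrr natr_sum /=.
rewrite (eq_bigl (fun fg : Defs.mfun n.*2 * Defs.mfun n.*2 =>
   [&& mvalid fg.1, mvalid fg.2 & msize fg.1 + msize fg.2 == n - c]%N &&
   (mparts fg.1 == mparts fg.2 + a %[mod b]))) => [|[f g]]; last first.
  rewrite !inE /= -!andbA; congr [&& _, _ & _]; congr (_ && _); first lia.
  by rewrite /qrank -addrA -opprD -PoszD -eqz_mod_dvd !modz_nat eqz_nat.
rewrite big_mkcondr; apply: eq_bigr => fg _.
have := unity_root_filter R (mparts fg.1) (mparts fg.2 + a) b0.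
under [X in X = _ -> _]eq_bigr do rewrite exprD mulrA mulrC.
by move=> ->; case: (_ == _ %[mod b]); rewrite ?muln1 ?muln0.
Qed.

(** * Complex-valued integrals *)

Section CIntegral.
Variable R : realType.
Implicit Types (F G : R -> R[i]) (B x u : R).
Notation mu := (@lebesgue_measure R).

Lemma Rintegral_FTC (F f : R -> R) B : 0 < B -> continuous f ->
  (forall x : R, is_derive x (1 : R) F (f x)) ->
  \int[mu]_(x in `[(- B), B]) f x = F B - F (- B).
Proof.
move=> B0 cf dF; rewrite /Rintegral (@continuous_FTC2 R f F) //; first by lra.
- exact: continuous_subspaceT.
- have cF : continuous F.
    by move=> x; apply: differentiable_continuous; apply/derivable1_diffP; case: (dF x).
  split; first by move=> x _; case: (dF x).
    by apply: cvg_at_right_filter; exact: cF.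
  by apply: cvg_at_left_filter; exact: cF.
- by move=> x _; rewrite derive1E; case: (dF x).
Qed.

Lemma integrable_itv (f : R -> R) B : continuous f ->
  mu.-integrable `[(- B), B] (EFin \o f).
Proof.
move=> cf; apply: continuous_compact_integrable; first exact: segment_compact.
exact: continuous_subspaceT.
Qed.

Definition ccont F :=
  continuous (fun u => complex.Re (F u)) /\ continuous (fun u => complex.Im (F u)).

Lemma ccont_cst (z : R[i]) : ccont (fun=> z).
Proof. by split => u; exact: cvg_cst. Qed.

Lemma ccontD F G : ccont F -> ccont G -> ccont (fun u => F u + G u).
Proof.
move=> [rF iF] [rG iG]; split => u.
  by under eq_fun do rewrite complex_ReD; apply: cvgD; [exact: rF|exact: rG].
by under eq_fun do rewrite complex_ImD; apply: cvgD; [exact: iF|exact: iG].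
Qed.

Lemma ccontM F G : ccont F -> ccont G -> ccont (fun u => F u * G u).
Proof.
move=> [rF iF] [rG iG]; split => u.
  under eq_fun do rewrite complex_ReM.
  by apply: cvgB; apply: cvgM; [exact: rF|exact: rG|exact: iF|exact: iG].
under eq_fun do rewrite complex_ImM.
by apply: cvgD; apply: cvgM; [exact: rF|exact: iG|exact: iF|exact: rG].
Qed.

Lemma ccontV F : (forall u, F u != 0) -> ccont F -> ccont (fun u => (F u)^-1).
Proof.
move=> F0 [rF iF].
have cn : continuous (fun u => normc (F u) ^+ 2).
  move=> u; under eq_fun do rewrite normc_sqr.
  by apply: cvgD; apply: cvgM; (exact: rF || exact: iF).
have n0 u : normc (F u) ^+ 2 != 0 by rewrite expf_neq0 // normc_eq0.
split => u.
  under eq_fun do rewrite complex_ReV.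
  by apply: cvgM; [exact: rF|apply: cvgV; [exact: n0|exact: cn]].
under eq_fun do rewrite complex_ImV.
by apply: cvgM; [apply: cvgN; exact: iF|apply: cvgV; [exact: n0|exact: cn]].
Qed.

Lemma ccontX F n : ccont F -> ccont (fun u => F u ^+ n).
Proof.
move=> cF; elim: n => [|n IH]; first by under eq_fun do rewrite expr0; exact: ccont_cst.
by under eq_fun do rewrite exprS; exact: ccontM.
Qed.

Lemma ccont_sum (I : Type) (s : seq I) (f : I -> R -> R[i]) :
  (forall i, ccont (f i)) -> ccont (fun u => \sum_(i <- s) f i u).
Proof.
move=> cf; elim: s => [|i s IH].
  by under eq_fun do rewrite big_nil; exact: ccont_cst.
by under eq_fun do rewrite big_cons; exact: ccontD.
Qed.

Lemma ccont_prod (I : Type) (s : seq I) (f : I -> R -> R[i]) :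
  (forall i, ccont (f i)) -> ccont (fun u => \prod_(i <- s) f i u).
Proof.
move=> cf; elim: s => [|i s IH].
  by under eq_fun do rewrite big_nil; exact: ccont_cst.
by under eq_fun do rewrite big_cons; exact: ccontM.
Qed.

Lemma ccont_cis (x : R) : ccont (fun u => cis (x * u)).
Proof.
have cx : continuous (fun u : R => x * u) by exact: mulrl_continuous.
split => u.
  exact: (@continuous_comp _ _ _ (fun u => x * u) cos u (cx u) (@continuous_cos R _)).
exact: (@continuous_comp _ _ _ (fun u => x * u) sin u (cx u) (@continuous_sin R _)).
Qed.

Definition cint B F : R[i] :=
  (\int[mu]_(u in `[(- B), B]) complex.Re (F u)) +i*
  (\int[mu]_(u in `[(- B), B]) complex.Im (F u)).

Lemma eq_cint B F G : F =1 G -> cint B F = cint B G.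
Proof.
by move=> FG; rewrite /cint; congr (_ +i* _); apply: eq_Rintegral => u _; rewrite FG.
Qed.

Lemma cintD B F G : ccont F -> ccont G ->
  cint B (fun u => F u + G u) = cint B F + cint B G.
Proof.
move=> [rF iF] [rG iG]; apply/eqP; rewrite eq_complex; apply/andP; split; apply/eqP;
  rewrite /= -RintegralD //; try exact: integrable_itv.
  by apply: eq_Rintegral => u _; exact: complex_ReD.
by apply: eq_Rintegral => u _; exact: complex_ImD.
Qed.

Lemma cintZ B (z : R[i]) F : ccont F -> cint B (fun u => z * F u) = z * cint B F.
Proof.
move=> [rF iF]; rewrite /cint; case: z => a b.
have cZ (c : R) (f : R -> R) : continuous f -> continuous (fun u => c * f u).
  by move=> cf u; apply: cvgM; [exact: cvg_cst|exact: cf].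
apply/eqP; rewrite eq_complex; apply/andP; split; apply/eqP => /=.
  rewrite -!RintegralZl -?RintegralB //; try by apply: integrable_itv; try exact: cZ.
  by apply: eq_Rintegral => u _; exact: complex_ReM.
rewrite -!RintegralZl -?RintegralD //; try by apply: integrable_itv; try exact: cZ.
by apply: eq_Rintegral => u _; exact: complex_ImM.
Qed.

Lemma cint_sum B (I : Type) (s : seq I) (f : I -> R -> R[i]) :
  (forall i, ccont (f i)) ->
  cint B (fun u => \sum_(i <- s) f i u) = \sum_(i <- s) cint B (f i).
Proof.
move=> cf; elim: s => [|i s IH].
  rewrite big_nil (@eq_cint B _ (fun=> 0 * 1)) => [|u]; last by rewrite big_nil mul0r.
  by rewrite cintZ ?mul0r //; exact: ccont_cst.
rewrite big_cons -IH -cintD //; last exact: ccont_sum.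
by apply: eq_cint => u; rewrite big_cons.
Qed.

Lemma Rintegral_bound B (f : R -> R) (M : R) : 0 <= B -> continuous f ->
  (forall u, `|u| <= B -> `|f u| <= M) ->
  `|\int[mu]_(u in `[(- B), B]) f u| <= M * (2 * B).
Proof.
move=> B0 cf fM.
apply: (@le_trans _ _ (\int[mu]_(u in `[(- B), B]) `|f u|)).
  by apply: le_normr_Rintegral => //; exact: integrable_itv.
have -> : M * (2 * B) = \int[mu]_(u in `[(- B), B]) M.
  rewrite Rintegral_cst //= lebesgue_measure_itv /= lte_fin.
  case: ltP => h /=; first by congr (M * _); ring.
  by have -> : B = 0 by [lra]; ring.
apply: le_Rintegral => //.
- by apply: integrable_itv => u; apply: cvg_norm; exact: cf.
- by apply: integrable_itv => u; exact: cvg_cst.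
- by move=> u /=; rewrite in_itv /= => uB; apply: fM; rewrite ler_norml.
Qed.

(** The constant is [4 B] rather than the length [2 B] because real and imaginary parts are bounded
    separately. *)
Lemma normc_cint_le B F (M : R) : 0 <= B -> ccont F ->
  (forall u, `|u| <= B -> normc (F u) <= M) ->
  normc (cint B F) <= M * (4 * B).
Proof.
move=> B0 [rF iF] FM; apply: le_trans (ler_normc_ReIm _) _ => /=.
have h1 : `|\int[mu]_(u in `[(- B), B]) complex.Re (F u)| <= M * (2 * B).
  by apply: Rintegral_bound => // u /FM; apply: le_trans; exact: ler_Re_normc.
have h2 : `|\int[mu]_(u in `[(- B), B]) complex.Im (F u)| <= M * (2 * B).
  by apply: Rintegral_bound => // u /FM; apply: le_trans; exact: ler_Im_normc.
by lra.
Qed.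

(** The hypothesis on [sin (x * B)] says that the interval is a whole number of half-turns on each
    side: the antiderivative [sin] vanishes at both ends, and the antiderivative [cos] takes equal
    values there. *)
Lemma cint_cis B x : 0 < B -> x != 0 -> sin (x * B) = 0 ->
  cint B (fun u => cis (x * u)) = 0.
Proof.
move=> B0 x0 sxB; rewrite /cint.
have [rc ic] := ccont_cis x.
have dS u : is_derive u (1 : R) (fun u => x^-1 * sin (x * u)) (cos (x * u)).
  by apply: is_derive_eq; rewrite /GRing.scale /=; field.
have dC u : is_derive u (1 : R) (fun u => - x^-1 * cos (x * u)) (sin (x * u)).
  by apply: is_derive_eq; rewrite /GRing.scale /=; field.
rewrite (Rintegral_FTC B0 rc dS) (Rintegral_FTC B0 ic dC).
by rewrite !mulrN sinN cosN sxB oppr0 mulr0 !subrr.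
Qed.

Lemma cint_1 B : 0 < B -> cint B (fun=> 1) = (2 * B)%:C.
Proof.
move=> B0; rewrite /cint /= !Rintegral_cst //= mul0r lebesgue_measure_itv /= lte_fin.
have -> : (- B < B) = true by lra.
by congr (_ +i* _); rewrite /=; ring.
Qed.

End CIntegral.

(** * Cauchy's coefficient formula on a circle *)

Section Coefficient.
Variable R : realType.
Variables (r delta : R).
Hypotheses (r0 : 0 < r) (r1 : r < 1) (delta0 : 0 < delta).
(** With this bound [x u] runs once around the circle of radius [r]. The scale [delta] is later the
    saddle width, so that the integration variable is already the Gaussian one. *)
Let B : R := pi / delta.
Let x (u : R) : R[i] := r%:C * cis (delta * u).

Let B0 : 0 < B. Proof. by rewrite divr_gt0 ?pi_gt0. Qed.

Let ccont_x : ccont x.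
Proof. by apply: ccontM; [exact: ccont_cst|exact: ccont_cis]. Qed.

Let normc_x u : normc (x u) = r.
Proof. by rewrite normcM normc_cis normc_real mulr1 gtr0_norm. Qed.

Lemma sin_natpi n : sin (n%:R * pi) = 0 :> R.
Proof.
elim: n => [|n IH]; first by rewrite mul0r sin0.
by rewrite -natr1 mulrDl mul1r sinDpi IH oppr0.
Qed.

Let cint_xX l : (0 < l)%N -> cint B (fun u => x u ^+ l) = 0.
Proof.
move=> l0; rewrite (@eq_cint _ B _ (fun u => (r ^+ l)%:C * cis ((l%:R * delta) * u))).
  rewrite cintZ ?cint_cis ?mulr0 //; last exact: ccont_cis.
    by rewrite mulf_neq0 ?pnatr_eq0 -?lt0n // gt_eqF.
  rewrite (_ : _ * B = l%:R * pi) ?sin_natpi // /B; field; by rewrite gt_eqF.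
by move=> u; rewrite exprMn cisX -mulrA rmorphXn.
Qed.

Let den (s : seq (R[i] * nat)) u : R[i] :=
  \prod_(zk <- s) (1 - zk.1 * x u ^+ zk.2).

Let ok (zk : R[i] * nat) := (normc zk.1 <= 1) && (0 < zk.2)%N.

Let factor_ge zk u : ok zk -> 1 - r <= normc (1 - zk.1 * x u ^+ zk.2).
Proof.
case: zk => z k /andP[/= z1 k0].
have : normc (z * x u ^+ k) <= r.
  rewrite normcM normcX normc_x -[leRHS]mul1r; apply: ler_pM => //.
  - exact: normc_ge0.
  - by rewrite exprn_ge0 // ltW.
  - by rewrite -[leRHS]expr1; apply: ler_wiXn2l => //; exact: ltW.
have := ler_normcD (1 - z * x u ^+ k) (z * x u ^+ k).
by rewrite subrK normc1; lra.
Qed.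

Let factor_neq0 zk u : ok zk -> 1 - zk.1 * x u ^+ zk.2 != 0.
Proof.
by move=> /(factor_ge u); rewrite -normc_eq0 => h; rewrite gt_eqF // (lt_le_trans _ h) // subr_gt0.
Qed.

Let den_neq0 s u : all ok s -> den s u != 0.
Proof.
move=> /allP os; rewrite /den prodf_seq_neq0; apply/allP => zk zks.
exact/factor_neq0/os.
Qed.

Let ccont_den s : all ok s -> ccont (fun u => (den s u)^-1).
Proof.
move=> os; apply: ccontV => [u|]; first exact: den_neq0.
apply: (@ccont_prod _ _ s (fun zk u => 1 - zk.1 * x u ^+ zk.2)) => zk.
apply: ccontD; first exact: ccont_cst.
under eq_fun do rewrite -mulNr.
by apply: ccontM; [exact: ccont_cst|exact: ccontX].
Qed.

Let normc_den s u : all ok s -> normc (den s u)^-1 <= (1 - r)^-1 ^+ size s.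
Proof.
move=> os; rewrite normcV /den normc_prod -prodfV.
have r1' : 0 < 1 - r by rewrite subr_gt0.
elim: s os => [|zk s IH] /=; first by rewrite big_nil.
move=> /andP[ozk os]; rewrite big_cons exprS; apply: ler_pM.
- by rewrite invr_ge0 normc_ge0.
- by apply: prodr_ge0 => i _; rewrite invr_ge0 normc_ge0.
- by rewrite lef_pV2 ?posrE ?(lt_le_trans r1' (factor_ge u ozk)) ?factor_ge.
- exact: IH.
Qed.

Lemma geometric_bound_eq0 (a C : R) : 0 <= a -> (forall i, a <= C * r ^+ i) -> a = 0.
Proof.
move=> a0 aC; apply/eqP; rewrite eq_le a0 andbT.
have /cvgrPdist_lt cv : (fun i => C * r ^+ i) @ \oo --> (0 : R).
  have -> : (0 : R) = C * 0 by rewrite mulr0.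
  by apply: cvgMr; apply: cvg_expr; rewrite gtr0_norm.
rewrite leNgt; apply/negP => /cv [i _ /(_ i (leqnn i))] /=.
by rewrite sub0r normrN => h; have := aC i; have := ler_norm (C * r ^+ i); lra.
Qed.

(* [x^l / (D (1 - z x^k)) = x^l / D + z x^(l+k) / (D (1 - z x^k))]: the first
   integral vanishes by induction, and iterating the second drives it to 0. *)
Let cint_pow_den s l : all ok s -> (0 < l)%N ->
  cint B (fun u => x u ^+ l * (den s u)^-1) = 0.
Proof.
elim: s l => [|[z k] s IH] l.
  move=> _ l0; rewrite -(cint_xX l0); apply: eq_cint => u.
  by rewrite /den big_nil invr1 mulr1.
move=> oks; have /andP[ozk os] := oks; have /andP[/= z1 k0] := ozk.
have cF n : ccont (fun u => x u ^+ n * (den ((z, k) :: s) u)^-1).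
  by apply: ccontM; [exact: ccontX|exact: ccont_den].
have step n : (0 < n)%N -> cint B (fun u => x u ^+ n * (den ((z, k) :: s) u)^-1) =
    z * cint B (fun u => x u ^+ (n + k) * (den ((z, k) :: s) u)^-1).
  move=> n0; rewrite -[RHS]add0r -[X in X + _](IH n os n0) -cintZ // -cintD //.
  - apply: eq_cint => u; rewrite /den big_cons /=; have := factor_neq0 u ozk.
    have := den_neq0 u os; rewrite /den /= => d0 f0; rewrite exprD.
    by field; rewrite d0.
  - by apply: ccontM; [exact: ccontX|exact: ccont_den].
  - by apply: ccontM; [exact: ccont_cst|exact: cF].
move=> l0.
have iter i : normc (cint B (fun u => x u ^+ l * (den ((z, k) :: s) u)^-1)) <=
    normc (cint B (fun u => x u ^+ (l + i * k) * (den ((z, k) :: s) u)^-1)).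
  elim: i => [|i IHi]; first by rewrite mul0n addn0.
  apply: le_trans IHi _; rewrite step ?addn_gt0 ?l0 // -addnA -mulSnr normcM.
  by rewrite ler_piMl // normc_ge0.
apply: eq0_normc.
apply: (@geometric_bound_eq0 _ ((1 - r)^-1 ^+ size ((z, k) :: s) * (4 * B))).
  exact: normc_ge0.
move=> i; apply: le_trans (iter i) _.
rewrite mulrAC; apply: normc_cint_le => //; first exact: ltW.
move=> u _; rewrite normcM normcX normc_x mulrC; apply: ler_pM.
- exact: normc_ge0.
- by rewrite exprn_ge0 // ltW.
- exact: normc_den.
- by apply: ler_wiXn2l; [exact: ltW|exact: ltW|nia].
Qed.

(** Writing the congruence as [P E = 1 + X^(m+1) Q] gives [1/E = P - X^(m+1) Q / E]. After
    multiplication by [x^(-m)] the polynomial part contributes its coefficient of index [m] by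
    orthogonality, and the rest contains only positive powers of [x] over [E], which integrate to
    0. *)
Lemma bicoef_cint (z w : R[i]) m c L : normc z <= 1 -> normc w <= 1 ->
  (m <= L)%N -> is_bicoef z w m c ->
  cint B (fun u => cis (- (m%:R * delta) * u) *
                   ((euler z L * euler w L).[r%:C * cis (delta * u)])^-1) =
  (2 * B * r ^+ m)%:C * c.
Proof.
move=> z1 w1 mL [P <- /(_ L mL)[Q PQ]].
pose s := [seq (z, k) | k <- index_iota 1 L.+1] ++ [seq (w, k) | k <- index_iota 1 L.+1].
have oks : all ok s.
  rewrite all_cat !all_map; apply/andP; split; apply/allP => k /=;
  by rewrite mem_index_iota /ok /= ?z1 ?w1 => /andP[].
have dE u : (euler z L * euler w L).[x u] = den s u.
  rewrite /den big_cat !big_map hornerM /euler !horner_prod /=.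
  by congr (_ * _); apply: eq_bigr => k _; rewrite !hornerE.
have xm u : cis (- (m%:R * delta) * u) * x u ^+ m = (r ^+ m)%:C.
  rewrite exprMn cisX mulrCA -cisD -rmorphXn /=.
  by rewrite [X in cis X](_ : _ = 0) ?cis0 ?mulr1 //; ring.
rewrite (@eq_cint _ B _ (fun u =>
    \sum_(i < size P) P`_i * (cis (- (m%:R * delta) * u) * x u ^+ i) +
    \sum_(i < size Q) (- (Q`_i * (r ^+ m)%:C)) * (x u ^+ i.+1 * (den s u)^-1))); last first.
  move=> u; rewrite -/(x u) dE.
  have := den_neq0 u oks => d0.
  have := congr1 (fun p => p.[x u]) PQ.
  rewrite hornerM dE !hornerE => e.
  have e2 : (den s u)^-1 = P.[x u] - x u ^+ m.+1 * Q.[x u] * (den s u)^-1.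
    by apply: (mulIf d0); rewrite mulrBl e -[X in _ - X]mulrA !(mulVf d0); ring.
  rewrite [in LHS]e2 mulrBr; congr (_ + _).
    by rewrite horner_coef mulr_sumr; apply: eq_bigr => i _; rewrite mulrCA.
  rewrite [LHS](_ : _ = - (r ^+ m)%:C * x u * (den s u)^-1 * Q.[x u]); last first.
    rewrite -(xm u) exprSr.
    by move: (den s u)^-1 Q.[x u] (x u ^+ m) (x u) (cis _) => *; ring.
  rewrite horner_coef mulr_sumr; apply: eq_bigr => i _; rewrite exprS.
  by move: (den s u)^-1 (Q`_i) (x u ^+ i) (x u) (r ^+ m)%:C => *; ring.
have c1 i : ccont (fun u => P`_i * (cis (- (m%:R * delta) * u) * x u ^+ i)).
  by do 2 (apply: ccontM; first by [exact: ccont_cst|exact: ccont_cis]); exact: ccontX.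
have c2 i : ccont (fun u => (- (Q`_i * (r ^+ m)%:C)) * (x u ^+ i.+1 * (den s u)^-1)).
  apply: ccontM; first exact: ccont_cst.
  by apply: ccontM; [exact: ccontX|exact: ccont_den].
rewrite cintD; [|by apply: ccont_sum..].
rewrite !cint_sum // [X in _ + X]big1 ?addr0; last first.
  move=> i _; rewrite cintZ ?cint_pow_den ?mulr0 //.
  by apply: ccontM; [exact: ccontX|exact: ccont_den].
have main i : cint B (fun u => P`_i * (cis (- (m%:R * delta) * u) * x u ^+ i)) =
    if i == m then (2 * B * r ^+ m)%:C * P`_m else 0.
  rewrite cintZ; last by apply: ccontM; [exact: ccont_cis|exact: ccontX].
  have [->|im] := eqVneq i m.
    rewrite (@eq_cint _ B _ (fun u => (r ^+ m)%:C * 1)) => [|u]; last by rewrite xm mulr1.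
    rewrite cintZ ?cint_1 //; last exact: ccont_cst.
    by rewrite [in RHS]rmorphM /=; ring.
  rewrite (@eq_cint _ B _ (fun u => (r ^+ i)%:C * cis (((i%:R - m%:R) * delta) * u))).
    have d0 : (i%:R - m%:R : R) != 0 by rewrite subr_eq0 eqr_nat.
    rewrite cintZ ?cint_cis ?mulr0 //; last exact: ccont_cis.
      by rewrite mulf_neq0 // gt_eqF.
    rewrite (_ : _ * B = i%:R * pi - m%:R * pi); last by rewrite /B; field; rewrite gt_eqF.
    by rewrite sinB !sin_natpi mulr0 mul0r subrr.
  move=> u; rewrite exprMn cisX mulrCA -cisD rmorphXn; congr (_ * cis _); ring.
under eq_bigr do rewrite main.
have [mP|Pm] := ltnP m (size P).
  rewrite (bigD1 (Ordinal mP)) //= eqxx big1 ?addr0 // => i.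
  by rewrite -val_eqE /= => /negbTE ->.
rewrite nth_default // mulr0 big1 // => i _.
by rewrite ifF //; apply/negbTE; rewrite neq_ltn (leq_trans (ltn_ord i) Pm).
Qed.

End Coefficient.

(** * Elementary inequalities *)

Section Elementary.
Variable R : realType.
Implicit Types x y s p : R.

(** From [e^(-s) >= 1 - s] and [(1 + s + 2s^2)(1 - s) = 1 + s^2 - 2s^3 >= 1], which is where
    [s <= 1/2] enters. *)
Lemma expR_le_quadratic s : 0 <= s <= 1 / 2 -> expR s <= 1 + s + 2 * s ^+ 2.
Proof.
move=> /andP[s0 s1]; have h := expR_ge1Dx (- s).
have e : expR (- s) * expR s = 1 by rewrite -expRD addNr expR0.
have p : 0 < expR s by exact: expR_gt0.
have k : 1 <= (1 + s + 2 * s ^+ 2) * expR (- s).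
  apply: le_trans (_ : (1 + s + 2 * s ^+ 2) * (1 - s) <= _); last by apply: ler_pM => //; nra.
  nra.
have := ler_wpM2r (ltW p) k; rewrite -mulrA e; lra.
Qed.

Lemma expR_le_linear x : 0 <= x <= 1 / 2 -> expR x <= 1 + 2 * x.
Proof. by move=> h; have := expR_le_quadratic h; move: h => /andP[]; nra. Qed.

Lemma expR_ge_pow x n : 0 <= x -> (1 + x / n.+1%:R) ^+ n.+1 <= expR x.
Proof.
move=> x0; have -> : expR x = expR (x / n.+1%:R) ^+ n.+1.
  by rewrite -expRM_natl; congr expR; rewrite mulrCA divff ?mulr1 // pnatr_eq0.
rewrite ler_pXn2r ?nnegrE ?expR_ge0 ?expR_ge1Dx //.
by rewrite addr_ge0 // divr_ge0.
Qed.

(** Converts exponential decay into a power saving of any prescribed order. *)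
Lemma expRN_le_pow x n : 0 < x -> expR (- x) <= (n.+1%:R / x) ^+ n.+1.
Proof.
move=> x0; rewrite expRN -[leRHS]invrK -exprVn invf_div lef_pV2 ?posrE ?expR_gt0 //.
  apply: le_trans (expR_ge_pow n (ltW x0)); rewrite lerXn2r ?nnegrE //; [|..].
  - by rewrite divr_ge0 // ltW.
  - by rewrite addr_ge0 // divr_ge0 // ltW.
  - by rewrite lerDr.
by rewrite exprn_gt0 // divr_gt0.
Qed.

(** [(1 + x)^5 <= (5 + x)^5 = 5^5 (1 + x/5)^5 <= 5^5 e^x]. Of the five powers, up to three absorb
    [x (1 + occ)] and two give a summable weight. *)
Lemma pow5_expRN x : 0 <= x -> (1 + x) ^+ 5 * expR (- x) <= 5 ^+ 5.
Proof.
move=> x0; rewrite expRN ler_pdivrMr ?expR_gt0 //.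
apply: le_trans (ler_wpM2l _ (expR_ge_pow 4 x0)); last by rewrite exprn_ge0.
rewrite -exprMn lerXn2r ?nnegrE //; lra.
Qed.

Lemma ge0_of_deriv (f df : R -> R) : (forall x : R, is_derive x (1 : R) f (df x)) ->
  f 0 = 0 -> (forall x, 0 <= x -> 0 <= df x) -> forall x, 0 <= x -> 0 <= f x.
Proof.
move=> dF f0 df0 x x0; rewrite -f0.
apply: (@ger0_derive1_ndecr _ f 0 x) => //.
- move=> y; rewrite in_itv /= => /andP[y0 _]; rewrite derive1E.
  by case: (dF y) => _ ->; apply: df0; exact: ltW.
- apply: continuous_subspaceT => y.
  by apply: differentiable_continuous; apply/derivable1_diffP; case: (dF y).
Qed.

Lemma sin_le x : 0 <= x -> sin x <= x.
Proof.
move=> x0; rewrite -subr_ge0.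
apply: (@ge0_of_deriv (fun x => x - sin x) (fun x => 1 - cos x)) => //.
by rewrite sin0 subrr.
Qed.

Lemma cos_ge_quadratic x : 0 <= x -> 1 - x ^+ 2 / 2 <= cos x.
Proof.
move=> x0; rewrite -subr_ge0.
apply: (@ge0_of_deriv (fun x => cos x - (1 - x ^+ 2 / 2)) (fun x => x - sin x)) => //.
- by move=> y; apply: is_derive_eq; rewrite /GRing.scale /=; field.
- by rewrite cos0 expr0n mul0r subr0 subrr.
- by move=> y y0; rewrite subr_ge0 sin_le.
Qed.

Lemma sin_ge_cubic x : 0 <= x -> x - x ^+ 3 / 6 <= sin x.
Proof.
move=> x0; rewrite -subr_ge0.
apply: (@ge0_of_deriv (fun x => sin x - (x - x ^+ 3 / 6))
  (fun x => cos x - (1 - x ^+ 2 / 2))) => //.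
- by move=> y; apply: is_derive_eq; rewrite /GRing.scale /=; field.
- by rewrite sin0 expr0n mul0r !subr0.
- by move=> y y0; rewrite subr_ge0 cos_ge_quadratic.
Qed.

Lemma cos_le_cubic x : 0 <= x -> cos x <= 1 - x ^+ 2 / 2 + x ^+ 3.
Proof.
move=> x0; rewrite -subr_ge0.
apply: (@ge0_of_deriv (fun x => 1 - x ^+ 2 / 2 + x ^+ 3 - cos x)
  (fun x => sin x - x + 3 * x ^+ 2)) => //.
- by move=> y; apply: is_derive_eq; rewrite /GRing.scale /=; field.
- by rewrite cos0 !expr0n mul0r subr0 addr0 subrr.
(* The cubic lower bound of [sin] serves up to 1; beyond, [3 y^2] dominates [1 + y]. *)
- move=> y y0; have [y1|y1] := leP y 1.
    by have := sin_ge_cubic y0; nra.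
  by have := sin_geN1 y; nra.
Qed.

Lemma cos_quadratic_error y : `|cos y - (1 - y ^+ 2 / 2)| <= `|y| ^+ 3.
Proof.
rewrite -cos_norm -[y ^+ 2]real_normK ?num_real //; set x := `|y|.
have x0 : 0 <= x by exact: normr_ge0.
have := cos_ge_quadratic x0; have := cos_le_cubic x0; have := exprn_ge0 3 x0.
by rewrite ler_norml => *; apply/andP; split; lra.
Qed.

Lemma sin_linear_error y : `|sin y - y| <= `|y| ^+ 3.
Proof.
wlog y0 : y / 0 <= y => [hw|].
  have [/hw//|y0] := leP 0 y; have := hw (- y).
  rewrite sinN (_ : - sin y - - y = - (sin y - y)); last by ring.
  by rewrite !normrN; apply; lra.
rewrite (ger0_norm y0) ler_norml.
have := sin_le y0; have := sin_ge_cubic y0; have := exprn_ge0 3 y0.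
by move=> *; apply/andP; split; lra.
Qed.

Lemma cos_le_small y : `|y| <= 1 / 4 -> y ^+ 2 / 4 <= 1 - cos y.
Proof.
move=> y1; have := cos_quadratic_error y; rewrite ler_norml => /andP[_].
have := normr_ge0 y; have : `|y| ^+ 2 = y ^+ 2 by rewrite real_normK ?num_real.
set x := `|y| in y1 *; move=> e x0; rewrite -e exprSr; nra.
Qed.

Lemma cis_quadratic_error y :
  normc (cis y - (1 - (y ^+ 2 / 2)%:C + 'i%C * y%:C)) <= 2 * `|y| ^+ 3.
Proof.
apply: le_trans (ler_normc_ReIm _) _ => /=.
have := cos_quadratic_error y; have := sin_linear_error y.
rewrite !(mul0r, mul1r, mulr0, addr0, subr0, add0r, sub0r, oppr0).
by move=> *; lra.
Qed.

End Elementary.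

(** * Gaussian approximation of one geometric variable *)

Section GeometricFactor.
Variable R : realType.
Implicit Types (p y t x : R) (w : R[i]).

(* With [p = q / (1 - q)] this is [(1 - q) / (1 - q w)], the characteristic
   function of a geometric variable of mean [p]. *)
Definition geom_cf p w : R[i] := (1 - p%:C * (w - 1))^-1.

(** On the unit circle [-2 Re (w - 1) = |w - 1|^2], so the linear term joins the quadratic one. The
    coefficient [p (1 + p)] is the variance of the geometric variable. *)
Lemma normc_geom_cfV p w : normc w = 1 ->
  normc (1 - p%:C * (w - 1)) ^+ 2 = 1 + p * (1 + p) * normc (w - 1) ^+ 2.
Proof.
move=> w1; have := normc_sqr w; rewrite w1 !normc_sqr.
case: w w1 => a b _ /=.
rewrite expr1n !(mul0r, subr0, add0r, addr0, oppr0, sub0r) => e.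
have -> : b ^+ 2 = 1 - a ^+ 2 by lra.
have -> : (- (p * b)) ^+ 2 = p ^+ 2 * (1 - a ^+ 2) by rewrite sqrrN exprMn; congr (_ * _); lra.
by ring.
Qed.

Lemma geom_cf_den_ge1 p w : 0 <= p -> normc w = 1 -> 1 <= normc (1 - p%:C * (w - 1)).
Proof.
move=> p0 w1; rewrite -(@ler_pXn2r _ 2) ?nnegrE ?normc_ge0 // expr1n.
by rewrite normc_geom_cfV // lerDl mulr_ge0 ?sqr_ge0 // mulr_ge0 // addr_ge0.
Qed.

Lemma geom_cf_den_neq0 p w : 0 <= p -> normc w = 1 -> 1 - p%:C * (w - 1) != 0.
Proof.
by move=> p0 w1; rewrite -normc_eq0 gt_eqF // (lt_le_trans _ (geom_cf_den_ge1 p0 w1)).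
Qed.

Lemma geom_cf_le1 p w : 0 <= p -> normc w = 1 -> normc (geom_cf p w) <= 1.
Proof.
move=> p0 w1; rewrite normcV invf_le1 ?(lt_le_trans _ (geom_cf_den_ge1 p0 w1)) //.
exact: geom_cf_den_ge1.
Qed.

Lemma geom_cf_sqr_le p w (h : R) : 0 <= h -> normc w = 1 ->
  h <= p * (1 + p) * normc (w - 1) ^+ 2 -> normc (geom_cf p w) ^+ 2 <= (1 + h)^-1.
Proof.
move=> h0 w1 hle; rewrite normcV exprVn normc_geom_cfV // lef_pV2 ?posrE; lra.
Qed.

Lemma normc_cis_sub1 y : normc (cis y - 1) ^+ 2 = 2 * (1 - cos y).
Proof. by rewrite normc_sqr /= subr0 sin2cos2; ring. Qed.

(** Third-order error of the centred variable: the mean is removed by the phase and the variance is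
    matched, so all terms below [|y|^3] cancel. *)
Lemma geom_cf_gauss p y : 0 <= p ->
  normc (cis (- (p * y)) * geom_cf p (cis y) - (expR (- (p * (1 + p) * y ^+ 2 / 2)))%:C)
  <= 20 * (p * (1 + p) ^+ 2 * `|y| ^+ 3).
Proof.
move=> p0; set Q := p * (1 + p) ^+ 2 * `|y| ^+ 3.
set s := p * (1 + p) * y ^+ 2 / 2; set D := 1 - p%:C * (cis y - 1).
have a0 : 0 <= `|y| by exact: normr_ge0.
have a2 : `|y| ^+ 2 = y ^+ 2 by rewrite real_normK ?num_real.
have s0 : 0 <= s by rewrite /s divr_ge0 // mulr_ge0 ?sqr_ge0 // mulr_ge0 // addr_ge0.
have p1 : 0 <= 1 + p by lra.
have es1 : expR (- s) <= 1 by rewrite -expR0 ler_expR; lra.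
have Q0 : 0 <= Q by rewrite /Q !mulr_ge0 ?exprn_ge0 // addr_ge0.
(* For [Q >= 1] the trivial bound 2 suffices. For [Q < 1] one gets [p |y| <= 1] and [s <= 1/2], the
   range in which the Taylor bounds are efficient. *)
have [Q1|Q1] := leP 1 Q.
  apply: le_trans (ler_normcD _ _) _; rewrite normc_opp normcM normc_cis mul1r normc_real.
  rewrite (ger0_norm (expR_ge0 _)).
  by have := geom_cf_le1 p0 (normc_cis y); lra.
have py1 : p * `|y| <= 1.
  have pQ : (p * `|y|) ^+ 3 <= Q.
    rewrite /Q exprMn ler_wpM2r ?exprn_ge0 //; nra.
  by rewrite -(@ler_pXn2r _ 3) ?nnegrE ?mulr_ge0 // expr1n; lra.
have s1 : s <= 1 / 2.
  have : (p * (1 + p) * `|y| ^+ 2) ^+ 3 <= Q ^+ 2.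
    have -> : (p * (1 + p) * `|y| ^+ 2) ^+ 3 = p ^+ 3 * ((1 + p) ^+ 3 * `|y| ^+ 6) by ring.
    have -> : Q ^+ 2 = p ^+ 2 * (1 + p) * ((1 + p) ^+ 3 * `|y| ^+ 6) by rewrite /Q; ring.
    rewrite ler_wpM2r ?mulr_ge0 ?exprn_ge0 //.
    by rewrite exprSr ler_wpM2l ?exprn_ge0 //; lra.
  have Q2 : Q ^+ 2 <= 1 by rewrite expr_le1 //; lra.
  move=> h; have : p * (1 + p) * `|y| ^+ 2 <= 1.
    have pp : 0 <= p * (1 + p) by rewrite mulr_ge0 // addr_ge0.
    by rewrite -(@ler_pXn2r _ 3) ?nnegrE ?expr1n ?(le_trans h) ?mulr_ge0 ?exprn_ge0.
  by rewrite a2 /s; lra.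
have D0 : D != 0 by apply: geom_cf_den_neq0 => //; exact: normc_cis.
have Dn : 1 <= normc D by apply: geom_cf_den_ge1 => //; exact: normc_cis.
set R3 := cis y - (1 - (y ^+ 2 / 2)%:C + 'i%C * y%:C).
have R3le : normc R3 <= 2 * `|y| ^+ 3 by exact: cis_quadratic_error.
set R3' := cis (- (p * y)) - (1 - ((- (p * y)) ^+ 2 / 2)%:C + 'i%C * (- (p * y))%:C).
have R3'le : normc R3' <= 2 * (p * `|y|) ^+ 3.
  have := cis_quadratic_error (- (p * y)).
  by rewrite normrN normrM (ger0_norm p0).
have [R2 R2e R2le] : exists2 R2, expR s = 1 + s + R2 & `|R2| <= 2 * s ^+ 2.
  exists (expR s - 1 - s); first by lra.
  have := expR_ge1Dx s; have := @expR_le_quadratic R s; rewrite s0 s1 => /(_ isT) => *.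
  by rewrite ger0_norm; lra.
(* Factoring out [e^(-s) / D], of norm at most 1, replaces a difference involving inverses by
   [e^s cis(-py) - D], which can be expanded term by term. *)
have -> : cis (- (p * y)) * geom_cf p (cis y) - (expR (- s))%:C =
    (expR (- s))%:C * D^-1 * ((expR s)%:C * cis (- (p * y)) - D).
  have e1 : (expR (- s))%:C * (expR s)%:C = 1 :> R[i].
    by rewrite -rmorphM -expRD addNr expR0.
  rewrite /geom_cf -/D mulrBr [RHS](_ : _ = ((expR (- s))%:C * (expR s)%:C) *
    (D^-1 * cis (- (p * y))) - (expR (- s))%:C * (D^-1 * D)); last by ring.
  by rewrite e1 mulVf // mulr1 mul1r [D^-1 * _]mulrC.
(* The orders 0, 1 and 2 cancel because [s = p y^2 / 2 + (p y)^2 / 2]. The four remainders are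
   bounded below by [2Q], [2Q], [4Q] and [2Q]. *)
have key : (expR s)%:C * cis (- (p * y)) - D =
    - (s%:C * ('i%C * (p * y)%:C + ((p * y) ^+ 2 / 2)%:C)) +
    (R2%:C * cis (- (p * y)) + (((1 + s)%:C * R3') + p%:C * R3)).
  have -> : cis (- (p * y)) =
      1 - ((p * y) ^+ 2 / 2)%:C - 'i%C * (p * y)%:C + R3'.
    have eN : (- (p * y))%:C = - (p * y)%:C :> R[i] by rewrite rmorphN.
    by rewrite /R3' sqrrN eN; ring.
  have -> : D = 1 - p%:C * (- (y ^+ 2 / 2)%:C + 'i%C * y%:C + R3) by rewrite /D /R3; ring.
  have c1 : (1 + s + R2)%:C = 1 + s%:C + R2%:C :> R[i] by rewrite !rmorphD rmorph1.
  have c2 : (1 + s)%:C = 1 + s%:C :> R[i] by rewrite rmorphD rmorph1.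
  have c3 : (p * y)%:C = p%:C * y%:C :> R[i] by rewrite rmorphM.
  have c4 : s%:C = (p%:C + p%:C ^+ 2) * (y ^+ 2 / 2)%:C :> R[i].
    by rewrite -rmorphXn -rmorphD -rmorphM; congr _%:C; rewrite /s; field.
  have c5 : ((p * y) ^+ 2 / 2)%:C = p%:C ^+ 2 * (y ^+ 2 / 2)%:C :> R[i].
    by rewrite -rmorphXn -rmorphM; congr _%:C; field.
  by rewrite R2e c1 c2 c3 c5 c4; ring.
have b1 : normc (s%:C * ('i%C * (p * y)%:C + ((p * y) ^+ 2 / 2)%:C)) <= 2 * Q.
  rewrite normcM normc_real (ger0_norm s0).
  have h : normc ('i%C * (p * y)%:C + ((p * y) ^+ 2 / 2)%:C) <= 2 * (p * `|y|).
    apply: le_trans (ler_normcD _ _) _; rewrite normcM !normc_real /=.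
    rewrite expr0n expr1n add0r sqrtr1 mul1r normrM (ger0_norm p0).
    have -> : `|(p * y) ^+ 2 / 2| = (p * `|y|) ^+ 2 / 2.
      by rewrite ger0_norm ?divr_ge0 ?sqr_ge0 // !exprMn a2.
    have : 0 <= p * `|y| by rewrite mulr_ge0.
    by move: py1; set q := p * `|y|; nra.
  apply: le_trans (ler_wpM2l s0 h) _.
  rewrite /s -a2 /Q; have -> : p * (1 + p) * `|y| ^+ 2 / 2 * (2 * (p * `|y|)) =
    p * (1 + p) * p * `|y| ^+ 3 by field.
  rewrite mulrA ler_wpM2r ?exprn_ge0 //.
  by have := mulr_ge0 p0 p0; nra.
have b2 : normc (R2%:C * cis (- (p * y))) <= 2 * Q.
  rewrite normcM normc_cis mulr1 normc_real; apply: le_trans R2le _.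
  have : s ^+ 2 <= Q.
    rewrite /s /Q -a2.
    have -> : (p * (1 + p) * `|y| ^+ 2 / 2) ^+ 2 =
      (p * `|y|) / 4 * (p * (1 + p) ^+ 2 * `|y| ^+ 3) by field.
    by rewrite -/Q ler_piMl //; lra.
  by lra.
have pQ : (p * `|y|) ^+ 3 <= Q.
  by rewrite /Q exprMn ler_wpM2r ?exprn_ge0 //; nra.
have b3 : normc ((1 + s)%:C * R3') <= 4 * Q.
  rewrite normcM normc_real ger0_norm; last by lra.
  have : (1 + s) * normc R3' <= 2 * (2 * (p * `|y|) ^+ 3).
    by apply: ler_pM => //; [lra|exact: normc_ge0|lra].
  by lra.
have b4 : normc (p%:C * R3) <= 2 * Q.
  rewrite normcM normc_real (ger0_norm p0).
  have h := ler_wpM2l p0 R3le.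
  apply: le_trans h _; rewrite /Q.
  have : 1 * `|y| ^+ 3 <= (1 + p) ^+ 2 * `|y| ^+ 3.
    by rewrite ler_wpM2r ?exprn_ge0 //; nra.
  by move=> /(ler_wpM2l p0); lra.
rewrite normcM normcM normcV normc_real (ger0_norm (expR_ge0 _)).
apply: (@le_trans _ _ (normc ((expR s)%:C * cis (- (p * y)) - D))).
  rewrite ler_piMl ?normc_ge0 //.
  rewrite -[leRHS]mulr1; apply: ler_pM; rewrite ?expR_ge0 ?invr_ge0 ?normc_ge0 //.
  by rewrite invf_le1 // (lt_le_trans _ Dn).
rewrite key; apply: le_trans (ler_normcD _ _) _; rewrite normc_opp.
have := ler_normcD (R2%:C * cis (- (p * y))) ((1 + s)%:C * R3' + p%:C * R3).
have := ler_normcD ((1 + s)%:C * R3') (p%:C * R3).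
by lra.
Qed.

(** Lindeberg replacement: factors are exchanged one at a time, the others having norm at most 1. *)
Lemma normc_prod_sub (I : eqType) (s : seq I) (f g : I -> R[i]) :
  (forall i, i \in s -> normc (f i) <= 1) -> (forall i, i \in s -> normc (g i) <= 1) ->
  normc (\prod_(i <- s) f i - \prod_(i <- s) g i) <= \sum_(i <- s) normc (f i - g i).
Proof.
elim: s => [|i s IH] fs gs; first by rewrite !big_nil subrr normc0.
rewrite !big_cons.
have -> : f i * \prod_(j <- s) f j - g i * \prod_(j <- s) g j =
    (f i - g i) * \prod_(j <- s) f j + g i * (\prod_(j <- s) f j - \prod_(j <- s) g j).
  by ring.
apply: le_trans (ler_normcD _ _) _; apply: lerD.
  rewrite normcM ler_piMr ?normc_ge0 // normc_prod big_seq.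
  by apply: prodr_ile1 => j js; rewrite normc_ge0 fs // inE js orbT.
rewrite normcM; apply: le_trans (_ : 1 * _ <= _).
  by apply: ler_wpM2r; rewrite ?normc_ge0 // gs // mem_head.
rewrite mul1r; apply: IH => j js; [apply: fs|apply: gs]; by rewrite inE js orbT.
Qed.

End GeometricFactor.

(** * The saddle point *)

Section Occupation.
Variable R : realType.
Implicit Types (t x : R) (k L N : nat).

(** Mean of the geometric variable of ratio [e^(-kt)], that is, the mean number of parts of size [k]
    in one component of the quotient. *)
Definition occ t k : R := (expR (k%:R * t) - 1)^-1.

Lemma occ_den_gt0 t k : 0 < t -> (0 < k)%N -> 0 < expR (k%:R * t) - 1.
Proof.
move=> t0 k0; rewrite subr_gt0 -[ltLHS]expR0 ltr_expR mulr_gt0 // ltr0n //.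
Qed.

Lemma occ_gt0 t k : 0 < t -> (0 < k)%N -> 0 < occ t k.
Proof. by move=> t0 k0; rewrite invr_gt0 occ_den_gt0. Qed.

Lemma geom_cf_occ t k w : 0 < t -> (0 < k)%N ->
  geom_cf (occ t k) w =
  (1 - expR (- t) ^+ k)%:C * (1 - (expR (- t) ^+ k)%:C * w)^-1.
Proof.
move=> t0 k0; set q := expR (- t) ^+ k.
have eq1 : expR (k%:R * t) = q^-1 by rewrite expRM_natl /q expRN exprVn invrK.
have q0 : 0 < q by rewrite exprn_gt0 // expR_gt0.
have qlt : 0 < q^-1 - 1 by rewrite -eq1 occ_den_gt0.
have q1 : 0 < 1 - q.
  have : 0 < q * (q^-1 - 1) by exact: mulr_gt0.
  by rewrite mulrBr mulfV ?gt_eqF // mulr1.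
have -> : occ t k = q / (1 - q).
  by rewrite /occ eq1; field; rewrite ?gt_eqF.
have e1 : (1 - q)%:C != 0 :> R[i] by rewrite -normc_eq0 normc_real normr_eq0 gt_eqF.
have e2 : (1 - q)%:C = 1 - q%:C :> R[i] by rewrite rmorphB rmorph1.
have e3 : (q / (1 - q))%:C = q%:C / (1 - q)%:C :> R[i] by rewrite rmorphM fmorphV.
rewrite e2 in e1 e3 *; rewrite /geom_cf e3.
have -> : 1 - q%:C / (1 - q%:C) * (w - 1) = (1 - q%:C * w) / (1 - q%:C) by field.
by rewrite invf_div.
Qed.

(** With [x = kt] the claim is [x e^x <= (1 + x)(e^x - 1)], that is [1 + x <= e^x]. *)
Lemma occ_succ_le t k : 0 < t -> (0 < k)%N ->
  (k%:R * t) * (1 + occ t k) <= 1 + k%:R * t.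
Proof.
move=> t0 k0; have d := occ_den_gt0 t0 k0; rewrite /occ; set x := k%:R * t in d *.
have -> : 1 + (expR x - 1)^-1 = expR x / (expR x - 1) by field; rewrite gt_eqF.
rewrite mulrA ler_pdivrMr //.
by have := expR_ge1Dx x; lra.
Qed.

Lemma occ_expRN t k : 0 < t -> (0 < k)%N ->
  occ t k = (1 + occ t k) * expR (- (k%:R * t)).
Proof.
move=> t0 k0; have d := occ_den_gt0 t0 k0; rewrite /occ expRN.
by field; rewrite !gt_eqF // expR_gt0.
Qed.

(** With [x = kt] and [p = occ t k], trading [p] for [(1 + p) e^(-x)] gives
    [(x (1 + p))^3 e^(-x) <= (1 + x)^3 e^(-x)], and [pow5_expRN] leaves the summable
    [(1 + x)^(-2)]. *)
Lemma occ_cubic_le t k : 0 < t -> (0 < k)%N ->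
  (k%:R * t) ^+ 3 * (occ t k * (1 + occ t k) ^+ 2) <= 5 ^+ 5 * ((1 + k%:R * t) ^+ 2)^-1.
Proof.
move=> t0 k0; have h := occ_succ_le t0 k0; have p0 := occ_gt0 t0 k0.
rewrite {1}(occ_expRN t0 k0); set p := occ t k in h p0 *; set x := k%:R * t in h *.
have x0 : 0 < x by rewrite mulr_gt0 // ltr0n.
have -> : x ^+ 3 * ((1 + p) * expR (- x) * (1 + p) ^+ 2) =
  (x * (1 + p)) ^+ 3 * expR (- x) by ring.
rewrite ler_pdivlMr; last by rewrite exprn_gt0 //; lra.
apply: le_trans (pow5_expRN (ltW x0)).
have -> : (1 + x) ^+ 5 * expR (- x) = (1 + x) ^+ 3 * expR (- x) * (1 + x) ^+ 2 by ring.
rewrite ler_wpM2r ?sqr_ge0 // ler_wpM2r ?expR_ge0 // lerXn2r ?nnegrE //; nra.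
Qed.

Lemma occ_quadratic_le t k : 0 < t -> (0 < k)%N ->
  (k%:R * t) ^+ 2 * (occ t k * (1 + occ t k)) <= 5 ^+ 5 * ((1 + k%:R * t) ^+ 2)^-1.
Proof.
move=> t0 k0; have h := occ_succ_le t0 k0; have p0 := occ_gt0 t0 k0.
rewrite {1}(occ_expRN t0 k0); set p := occ t k in h p0 *; set x := k%:R * t in h *.
have x0 : 0 < x by rewrite mulr_gt0 // ltr0n.
have -> : x ^+ 2 * ((1 + p) * expR (- x) * (1 + p)) =
  (x * (1 + p)) ^+ 2 * expR (- x) by ring.
rewrite ler_pdivlMr; last by rewrite exprn_gt0 //; lra.
apply: le_trans (pow5_expRN (ltW x0)).
have -> : (1 + x) ^+ 5 * expR (- x) = (1 + x) ^+ 3 * expR (- x) * (1 + x) ^+ 2 by ring.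
rewrite ler_wpM2r ?sqr_ge0 // ler_wpM2r ?expR_ge0 //.
apply: (@le_trans _ _ ((1 + x) ^+ 2)); first by rewrite lerXn2r ?nnegrE //; nra.
by apply: ler_weXn2l => //; lra.
Qed.

Lemma occ_ge t k : 0 < t -> (0 < k)%N -> k%:R * t <= 1 / 2 ->
  (2 * (k%:R * t))^-1 <= occ t k.
Proof.
move=> t0 k0 kt; have d := occ_den_gt0 t0 k0.
have x0 : 0 < k%:R * t by rewrite mulr_gt0 // ltr0n.
rewrite lef_pV2 ?posrE //; last by lra.
by have := @expR_le_linear R (k%:R * t); rewrite kt (ltW x0) => /(_ isT); lra.
Qed.

Lemma occ_product_ge t k : 0 < t -> (0 < k)%N -> k%:R * t <= 1 / 2 ->
  1 / 4 <= (k%:R * t) ^+ 2 * (occ t k * (1 + occ t k)).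
Proof.
move=> t0 k0 kt; have := occ_ge t0 k0 kt; have p0 := occ_gt0 t0 k0.
have x0 : 0 < k%:R * t by rewrite mulr_gt0 // ltr0n.
set x := k%:R * t in kt x0 *; set p := occ t k in p0 *.
rewrite -[X in X <= _ -> _]div1r ler_pdivrMr; last by lra.
move=> h; have e : 1 / 2 <= x * p by lra.
have : 1 / 4 <= (x * p) ^+ 2 by nra.
have : 0 <= x ^+ 2 * p by rewrite mulr_ge0 ?sqr_ge0 // ltW.
have -> : x ^+ 2 * (p * (1 + p)) = x ^+ 2 * p + (x * p) ^+ 2 by ring.
lra.
Qed.

Lemma sum_inv_sqr_le t L : 0 < t ->
  \sum_(1 <= k < L.+1) ((1 + k%:R * t) ^+ 2)^-1 <= t^-1.
Proof.
move=> t0.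
(* The stronger closed form telescopes: [t / (1 + kt)^2] is at most the decrease of [1 / (1 + kt)]
   from [k - 1] to [k]. *)
suff : \sum_(1 <= k < L.+1) ((1 + k%:R * t) ^+ 2)^-1 <= (1 - (1 + L%:R * t)^-1) / t.
  have : 0 <= (1 + L%:R * t)^-1 by rewrite invr_ge0 addr_ge0 // mulr_ge0 // ltW.
  move=> h; move/le_trans; apply; rewrite ler_pdivrMr // mulVf ?gt_eqF //; lra.
elim: L => [|L IH]; first by rewrite big_geq // mul0r addr0 invr1 subrr mul0r.
rewrite big_nat_recr //=; apply: le_trans (lerD IH (lexx _)) _.
have a0 : 0 <= L%:R * t by rewrite mulr_ge0 // ltW.
have -> : L.+1%:R * t = L%:R * t + t by rewrite -natr1 mulrDl mul1r.
set a := L%:R * t in a0 *.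
have -> : (1 - (1 + (a + t))^-1) / t =
   (1 - (1 + a)^-1) / t + ((1 + a) * (1 + (a + t)))^-1.
  by field; rewrite ?gt_eqF //; lra.
rewrite lerD2l lef_pV2 ?posrE; nra.
Qed.

(** Half the total variance, since each part size carries two independent geometric variables. *)
Definition occ_var t L : R := \sum_(1 <= k < L.+1) k%:R ^+ 2 * (occ t k * (1 + occ t k)).
Definition occ_third t L : R :=
  \sum_(1 <= k < L.+1) k%:R ^+ 3 * (occ t k * (1 + occ t k) ^+ 2).

Lemma occ_var_le t L : 0 < t -> t ^+ 3 * occ_var t L <= 5 ^+ 5.
Proof.
move=> t0.
have : t ^+ 2 * occ_var t L <= 5 ^+ 5 * t^-1.
  apply: le_trans (ler_wpM2l _ (sum_inv_sqr_le L t0)); last by rewrite exprn_ge0.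
  rewrite /occ_var !mulr_sumr big_nat_cond [leRHS]big_nat_cond; apply: ler_sum => k.
  by rewrite andbT => /andP[k0 _]; have := occ_quadratic_le t0 k0; rewrite exprMn -mulrA mulrCA.
by rewrite ler_pdivlMr // exprSr; lra.
Qed.

(** As [occ_var] has exact order [t^(-3)], this makes the Lyapunov ratio [occ_third / occ_var^(3/2)]
    at most of order [t^(1/2)]. *)
Lemma occ_third_le t L : 0 < t -> t ^+ 4 * occ_third t L <= 5 ^+ 5.
Proof.
move=> t0.
have : t ^+ 3 * occ_third t L <= 5 ^+ 5 * t^-1.
  apply: le_trans (ler_wpM2l _ (sum_inv_sqr_le L t0)); last by rewrite exprn_ge0.
  rewrite /occ_third !mulr_sumr big_nat_cond [leRHS]big_nat_cond; apply: ler_sum => k.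
  by rewrite andbT => /andP[k0 _]; have := occ_cubic_le t0 k0; rewrite exprMn -mulrA mulrCA.
by rewrite ler_pdivlMr // exprSr; lra.
Qed.

Lemma nat_below x : 1 <= x -> exists2 K : nat, K%:R <= x & x <= 2 * K%:R.
Proof.
move=> x1; have x0 : 0 <= x by lra.
have /andP[h1 h2] := truncn_itv x0.
exists (Num.truncn x) => //; move: h2; rewrite -natr1.
have : (1 : R) <= (Num.truncn x)%:R by rewrite ler1n truncn_gt0.
lra.
Qed.

(** Each [k <= 1/(4t)] contributes at least [1/4] to [t^2 occ_var], and there are at least [1/(8t)]
    such [k], all within the truncation. *)
Lemma occ_var_ge t L : 0 < t -> t <= 1 / 8 -> 1 / (4 * t) <= L%:R ->
  1 / 32 <= t ^+ 3 * occ_var t L.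
Proof.
move=> t0 t1 tL.
have [K K1 K2] : exists2 K : nat, K%:R <= 1 / (4 * t) & 1 / (4 * t) <= 2 * K%:R.
  by apply: nat_below; rewrite ler_pdivlMr; lra.
have KL : (K <= L)%N by rewrite -(ler_nat R); lra.
have p0 k : (0 < k)%N -> 0 <= k%:R ^+ 2 * (occ t k * (1 + occ t k)).
  move=> k0; have := occ_gt0 t0 k0 => p.
  by rewrite !mulr_ge0 ?sqr_ge0 //; lra.
have h : K%:R * (1 / 4) <= t ^+ 2 * occ_var t L.
  rewrite /occ_var (big_cat_nat (n := K.+1)) //= mulrDr.
  rewrite -[leLHS]addr0; apply: lerD; last first.
    rewrite mulr_ge0 ?sqr_ge0 // big_nat_cond sumr_ge0 // => k.
    by rewrite andbT => /andP[Kk _]; apply: p0; lia.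
  rewrite mulr_sumr.
  have -> : K%:R * (1 / 4) = \sum_(1 <= k < K.+1) (1 / 4) :> R.
    by rewrite big_const_nat subSS subn0 iter_addr_0 mulr_natl.
  rewrite big_nat_cond [leRHS]big_nat_cond; apply: ler_sum => k.
  rewrite andbT => /andP[k0 kK].
  have kt : k%:R * t <= 1 / 2.
    have : k%:R <= K%:R :> R by rewrite ler_nat.
    move=> kK'; have : k%:R <= 1 / (4 * t) by lra.
    by rewrite ler_pdivlMr; lra.
  by have := occ_product_ge t0 k0 kt; rewrite exprMn -mulrA mulrCA.
have : 1 / 8 <= t * K%:R by move: K2; rewrite ler_pdivrMr; lra.
by rewrite exprS -mulrA; nra.
Qed.

Lemma continuous_occ_sum L (t : R) : 0 < t ->
  {for t, continuous (fun t => \sum_(1 <= k < L.+1) 2 * k%:R * occ t k)}.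
Proof.
move=> t0; elim: L => [|L IH].
  by rewrite [X in {for _, continuous X}](_ : _ = fun=> 0) ?cst_continuous //;
    [exact: cvg_cst|apply/funext => u; rewrite big_geq].
rewrite [X in {for _, continuous X}](_ : _ = fun t =>
  \sum_(1 <= k < L.+1) 2 * k%:R * occ t k + 2 * L.+1%:R * occ t L.+1); last first.
  by apply/funext => u; rewrite big_nat_recr.
apply: continuousD => //; apply: continuousM; first exact: cvg_cst.
apply: continuousV; first by rewrite gt_eqF // occ_den_gt0.
apply: continuousB; last exact: cvg_cst.
apply: (@continuous_comp _ _ _ (fun t => L.+1%:R * t) expR); last exact: continuous_expR.
exact: mulrl_continuous.
Qed.

(** Intermediate values between [a = ln (1 + 2/N)], where the term [k = 1] alone equals [N], and 4,
    where each of the [2N] terms is at most [1/2]. The explicit lower bound is that of [a]. *)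
Lemma saddle_point N : (0 < N)%N -> exists2 t : R,
  2 / (N%:R + 2) <= t & \sum_(1 <= k < (N.*2).+1) 2 * k%:R * occ t k = N%:R.
Proof.
move=> N0; have NR : (1 : R) <= N%:R by rewrite ler1n.
pose f t : R := \sum_(1 <= k < (N.*2).+1) 2 * k%:R * occ t k.
pose a : R := ln (1 + 2 / N%:R).
have q0 : 0 < 2 / N%:R :> R by rewrite divr_gt0 // ltr0n.
have a0 : 0 < a by rewrite ln_gt0 //; lra.
have ea : expR a = 1 + 2 / N%:R by rewrite lnK // posrE; lra.
have a4 : a <= 4.
  have := expR_ge1Dx a; rewrite ea.
  have : 2 / N%:R <= 2 :> R by rewrite ler_pdivrMr; lra.
  lra.
have alow : 2 / (N%:R + 2) <= a.
  have := expR_ge1Dx (- a); rewrite expRN ea.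
  have -> : (1 + 2 / N%:R)^-1 = 1 - 2 / (N%:R + 2) :> R.
    by field; rewrite ?gt_eqF //; lra.
  lra.
have fa : N%:R <= f a.
  rewrite /f big_nat_recl ?double_gt0 // /occ mul1r ea.
  have -> : 2 * 1 * (1 + 2 / N%:R - 1)^-1 = N%:R :> R by field; lra.
  rewrite lerDl; apply: sumr_ge0 => k _.
  by rewrite mulr_ge0 // ltW // occ_gt0.
have f4 : f 4 <= N%:R.
  have -> : N%:R = \sum_(1 <= k < (N.*2).+1) (1 / 2) :> R.
    rewrite big_const_nat subSS subn0 iter_addr_0 -[RHS]mulr_natr -muln2 natrM; lra.
  rewrite /f big_nat_cond [leRHS]big_nat_cond; apply: ler_sum => k.
  rewrite andbT => /andP[k0 _]; have d := @occ_den_gt0 4 k (ltr0Sn _ _) k0.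
  have kR : (1 : R) <= k%:R by rewrite ler1n.
  by rewrite ler_pdivrMr //; have := expR_ge1Dx (k%:R * 4 : R); lra.
have [||t + ft] := @IVT R f a 4 N%:R a4.
- apply: continuous_in_subspaceT => t; rewrite inE /= in_itv /= => /andP[at_ _].
  by apply: continuous_occ_sum; lra.
- by rewrite ge_min le_max f4 fa orbT.
rewrite in_itv /= => /andP[at_ _]; exists t => //; lra.
Qed.

(** Termwise [N] is at most the full variance [2 occ_var], hence at most of order [t^(-3)]; this
    forces [t] to 0 as [N] grows. *)
Lemma saddle_var_ge N t : 0 < t -> \sum_(1 <= k < (N.*2).+1) 2 * k%:R * occ t k = N%:R ->
  N%:R * t ^+ 3 <= 2 * 5 ^+ 5.
Proof.
move=> t0 e; have h := occ_var_le (N.*2) t0.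
have : N%:R <= 2 * occ_var t N.*2.
  rewrite -e /occ_var mulr_sumr big_nat_cond [leRHS]big_nat_cond; apply: ler_sum => k.
  rewrite andbT => /andP[k0 _]; have p := occ_gt0 t0 k0.
  have kR : (1 : R) <= k%:R by rewrite ler1n.
  have : k%:R <= k%:R ^+ 2 :> R by nra.
  have : occ t k <= occ t k * (1 + occ t k) by nra.
  move=> h1 h2; rewrite -mulrA ler_pM2l //; apply: ler_pM => //; lra.
have : 0 < t ^+ 3 by rewrite exprn_gt0.
by nra.
Qed.

End Occupation.

(** * Bounds on the generating function off the real axis *)

Section ProductBounds.
Variable R : realType.
Implicit Types (t theta : R) (k L M N : nat) (z : R[i]).

(** For [z = zeta^s] this is [G_s(e^(-t + i theta)) / G_0(e^(-t))], truncated at [L]: the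
    normalisation is that of [s = 0] for every [z]. *)
Definition cf_prod t L z theta : R[i] :=
  \prod_(1 <= k < L.+1) (geom_cf (occ t k) (z * cis (k%:R * theta)) *
                         geom_cf (occ t k) (z^-1 * cis (k%:R * theta))).

Let le_of_eq (x y : R) : x = y -> x <= y. Proof. by move=> ->. Qed.

Let unit_cis z theta : normc z = 1 -> normc (z * cis theta) = 1.
Proof. by move=> z1; rewrite normcM normc_cis mulr1. Qed.

Let unitV z : normc z = 1 -> normc z^-1 = 1.
Proof. by move=> z1; rewrite normcV z1 invr1. Qed.

Lemma cf_prod_gauss t L N theta : 0 < t ->
  \sum_(1 <= k < L.+1) 2 * k%:R * occ t k = N%:R ->
  normc (cis (- (N%:R * theta)) * cf_prod t L 1 theta -
         (expR (- (occ_var t L * theta ^+ 2)))%:C) <=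
  40 * (occ_third t L * `|theta| ^+ 3).
Proof.
move=> t0 <-.
pose f k := cis (- (occ t k * (k%:R * theta))) * geom_cf (occ t k) (cis (k%:R * theta)).
pose g k : R[i] := (expR (- (occ t k * (1 + occ t k) * (k%:R * theta) ^+ 2 / 2)))%:C.
have -> : cis (- ((\sum_(1 <= k < L.+1) 2 * k%:R * occ t k) * theta)) * cf_prod t L 1 theta =
    \prod_(1 <= k < L.+1) f k ^+ 2.
  have -> : cis (- ((\sum_(1 <= k < L.+1) 2 * k%:R * occ t k) * theta)) =
      \prod_(1 <= k < L.+1) cis (- (occ t k * (k%:R * theta))) ^+ 2.
    rewrite mulr_suml -sumrN; elim/big_rec2: _ => [|k y x _ <-]; first by rewrite cis0.
    by rewrite cisD cisX; congr (cis _ * _); ring.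
  rewrite /cf_prod -big_split /=; apply: eq_bigr => k _.
  by rewrite /f invr1 !mul1r; ring.
have -> : (expR (- (occ_var t L * theta ^+ 2)))%:C = \prod_(1 <= k < L.+1) g k ^+ 2.
  rewrite /occ_var mulr_suml -sumrN; elim/big_rec2: _ => [|k y x _ <-].
    by rewrite expR0.
  rewrite expRD rmorphM; congr (_ * _).
  rewrite /g -[RHS](rmorphXn (real_complex R)) -[RHS]/((expR _ ^+ 2)%:C) -expRM_natl.
  by congr ((expR _)%:C); field.
have f1 k : (0 < k)%N -> normc (f k) <= 1.
  move=> k0; rewrite normcM normc_cis mul1r geom_cf_le1 ?normc_cis //.
  by rewrite ltW // occ_gt0.
have g1 k : (0 < k)%N -> normc (g k) <= 1.
  move=> k0; rewrite normc_real ger0_norm ?expR_ge0 // -expR0 ler_expR oppr_le0.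
  have := occ_gt0 t0 k0 => p0.
  by rewrite divr_ge0 // mulr_ge0 ?sqr_ge0 // mulr_ge0 // ltW // ltr_wpDl.
apply: (@le_trans _ _ (\sum_(1 <= k < L.+1) normc (f k ^+ 2 - g k ^+ 2))).
  apply: normc_prod_sub => k; rewrite mem_index_iota => /andP[k0 _];
  by rewrite normcX exprn_ile1 ?normc_ge0 ?f1 ?g1.
rewrite /occ_third mulr_suml mulr_sumr big_nat_cond [leRHS]big_nat_cond.
apply: ler_sum => k; rewrite andbT => /andP[k0 _].
(* Each size occurs twice, and [f^2 - g^2 = (f - g)(f + g)] with [|f + g| <= 2] turns the constant
   20 into 40. *)
rewrite subr_sqr normcM; have p0 := occ_gt0 t0 k0.
have h := geom_cf_gauss (k%:R * theta) (ltW p0).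
have h2 : normc (f k + g k) <= 2.
  by apply: le_trans (ler_normcD _ _) _; have := f1 k k0; have := g1 k k0; lra.
rewrite -/(f k) -/(g k) normrM (ger0_norm (ler0n R k)) exprMn in h.
have : normc (f k - g k) * normc (f k + g k) <= normc (f k - g k) * 2.
  by rewrite ler_wpM2l ?normc_ge0.
move=> /le_trans; apply; rewrite mulrC.
apply: le_trans (ler_wpM2l _ h) _ => //.
by apply: le_of_eq; ring.
Qed.

Lemma cf_prod_le_first t L z theta : 0 < t -> normc z = 1 ->
  normc (cf_prod t L z theta) <=
  \prod_(1 <= k < L.+1) normc (geom_cf (occ t k) (z * cis (k%:R * theta))).
Proof.
move=> t0 z1; rewrite /cf_prod normc_prod big_nat_cond [leRHS]big_nat_cond.
apply: ler_prod => k; rewrite andbT => /andP[k0 _]; rewrite normc_ge0 normcM andTb.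
rewrite ler_piMr ?normc_ge0 // geom_cf_le1 ?unit_cis ?unitV //.
by rewrite ltW // occ_gt0.
Qed.

Lemma cf_prod1E t L theta : normc (cf_prod t L 1 theta) =
  \prod_(1 <= k < L.+1) normc (geom_cf (occ t k) (cis (k%:R * theta))) ^+ 2.
Proof.
rewrite /cf_prod normc_prod; apply: eq_bigr => k _.
by rewrite invr1 !mul1r normcM expr2.
Qed.

(** For [k <= K] the variance is at least [1/(4 k^2 t^2)] and [|e^(ik theta) - 1|^2] at least
    [k^2 theta^2 / 2]. The [k] cancel, so all [K] factors obey the same bound. *)
Lemma cf_prod1_small t L K theta : 0 < t -> (K <= L)%N -> K%:R * t <= 1 / 2 ->
  K%:R * `|theta| <= 1 / 4 ->
  normc (cf_prod t L 1 theta) <= (1 + theta ^+ 2 / (8 * t ^+ 2))^-1 ^+ K.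
Proof.
move=> t0 KL Kt Kth; rewrite cf_prod1E (big_cat_nat (n := K.+1)) //.
have v0 : 0 <= theta ^+ 2 / (8 * t ^+ 2).
  by rewrite divr_ge0 ?sqr_ge0 // mulr_ge0 ?sqr_ge0.
apply: (@le_trans _ _ ((1 + theta ^+ 2 / (8 * t ^+ 2))^-1 ^+ K * 1)); last by rewrite mulr1.
apply: ler_pM.
- by apply: prodr_ge0 => k _; rewrite sqr_ge0.
- by apply: prodr_ge0 => k _; rewrite sqr_ge0.
- have -> : (1 + theta ^+ 2 / (8 * t ^+ 2))^-1 ^+ K =
      \prod_(1 <= k < K.+1) (1 + theta ^+ 2 / (8 * t ^+ 2))^-1.
    by rewrite prodr_const_nat subSS subn0.
  rewrite big_nat_cond [leRHS]big_nat_cond; apply: ler_prod => k.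
  rewrite andbT => /andP[k0 kK]; rewrite sqr_ge0 andTb.
  have kK' : k%:R <= K%:R :> R by rewrite ler_nat.
  have kt : k%:R * t <= 1 / 2 by apply: le_trans Kt; rewrite ler_wpM2r // ltW.
  have kth : `|k%:R * theta| <= 1 / 4.
    by rewrite normrM ger0_norm //; apply: le_trans Kth; rewrite ler_wpM2r.
  apply: geom_cf_sqr_le; rewrite ?normc_cis // normc_cis_sub1.
  have := cos_le_small kth; have := occ_product_ge t0 k0 kt.
  have kR : 0 < k%:R :> R by rewrite ltr0n.
  rewrite !exprMn; set P := occ t k * _ => h1 h2.
  have : (1 / 4) * (2 * (k%:R ^+ 2 * theta ^+ 2 / 4)) <=
      (k%:R ^+ 2 * t ^+ 2 * P) * (2 * (1 - cos (k%:R * theta))).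
    by apply: ler_pM => //; [rewrite mulr_ge0 // divr_ge0 // mulr_ge0 ?sqr_ge0|lra].
  have -> : k%:R ^+ 2 * t ^+ 2 * P * (2 * (1 - cos (k%:R * theta))) =
     (k%:R ^+ 2 * t ^+ 2) * (P * (2 * (1 - cos (k%:R * theta)))) by ring.
  rewrite -ler_pdivrMl ?mulr_gt0 ?exprn_gt0 //; apply: le_trans.
  by apply: le_of_eq; field; rewrite !gt_eqF.
rewrite big_nat_cond; apply: prodr_ile1 => k; rewrite andbT => /andP[Kk _].
have k0 : (0 < k)%N by lia.
by rewrite sqr_ge0 exprn_ile1 ?normc_ge0 // geom_cf_le1 ?normc_cis // ltW // occ_gt0.
Qed.

Lemma inv1D_le_expR (v : R) : 0 <= v <= 1 -> (1 + v)^-1 <= expR (- (v / 2)).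
Proof.
move=> /andP[v0 v1]; rewrite expRN lef_pV2 ?posrE ?expR_gt0 //; last by lra.
have h : 0 <= v / 2 <= 1 / 2 by lra.
by have := expR_le_linear h; lra.
Qed.

(** Here [K >= 1/(8t)] factors each give [e^(-v/2)] with [v = theta^2 / (8 t^2) <= 1]; hence
    [128 = 8 * 2 * 8]. *)
Lemma cf_prod1_major t L theta : 0 < t -> t <= 1 / 8 -> 1 / (4 * t) <= L%:R ->
  `|theta| <= t -> normc (cf_prod t L 1 theta) <= expR (- (theta ^+ 2 / (128 * t ^+ 3))).
Proof.
move=> t0 t1 tL th.
have [K K1 K2] : exists2 K : nat, K%:R <= 1 / (4 * t) & 1 / (4 * t) <= 2 * K%:R.
  by apply: nat_below; rewrite ler_pdivlMr; lra.
have KL : (K <= L)%N by rewrite -(ler_nat R); lra.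
have Kt : K%:R * t <= 1 / 4 by move: K1; rewrite ler_pdivlMr; lra.
have Kt2 : 1 / 8 <= K%:R * t by move: K2; rewrite ler_pdivrMr; lra.
have Kth : K%:R * `|theta| <= 1 / 4.
  by apply: le_trans Kt; rewrite ler_wpM2l.
apply: le_trans (cf_prod1_small t0 KL _ Kth) _; first by lra.
have th2 : theta ^+ 2 <= t ^+ 2.
  by rewrite -[theta ^+ 2]real_normK ?num_real // lerXn2r ?nnegrE // ltW.
have tt : 0 < t ^+ 2 by rewrite exprn_gt0.
set v := theta ^+ 2 / (8 * t ^+ 2).
have v01 : 0 <= v <= 1.
  apply/andP; split; first by rewrite divr_ge0 ?sqr_ge0 // mulr_ge0 // ltW.
  by rewrite /v ler_pdivrMr; lra.
apply: (@le_trans _ _ (expR (- (v / 2)) ^+ K)).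
  rewrite lerXn2r ?nnegrE ?expR_ge0 ?inv1D_le_expR //.
  by rewrite invr_ge0; case/andP: v01; lra.
rewrite -expRM_natl ler_expR mulrN lerN2.
have -> : theta ^+ 2 / (128 * t ^+ 3) = v / 2 * (1 / (8 * t)).
  by rewrite /v; field; rewrite gt_eqF.
rewrite mulrC ler_wpM2r //; first by case/andP: v01; lra.
by rewrite ler_pdivrMr; lra.
Qed.

(** For [k <= 2M] the variance is at least [1/(16 M^2 t^2)], so a factor whose [w k] stays away from
    1 saves [16 M^2 t^2 / h]. One such factor in each pair suffices, the other being at most 1. *)
Lemma prod_pairs t L M (w : nat -> R[i]) (h : R) : 0 < t -> 0 < h ->
  (M.*2 <= L)%N -> M.*2%:R * t <= 1 / 2 -> (forall k, normc (w k) = 1) ->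
  (forall m, (m < M)%N -> h <= normc (w m.*2.+1 - 1) ^+ 2 \/
                          h <= normc (w m.*2.+2 - 1) ^+ 2) ->
  \prod_(1 <= k < L.+1) normc (geom_cf (occ t k) (w k)) ^+ 2 <=
  (16 * M%:R ^+ 2 * t ^+ 2 / h) ^+ M.
Proof.
move=> t0 h0 ML Mt w1 good.
pose F k := normc (geom_cf (occ t k) (w k)) ^+ 2.
have F01 k : (0 < k)%N -> 0 <= F k <= 1.
  move=> k0; rewrite /F sqr_ge0 exprn_ile1 ?normc_ge0 // geom_cf_le1 //.
  by rewrite ltW // occ_gt0.
have Fgood k : (0 < k)%N -> (k <= M.*2)%N -> h <= normc (w k - 1) ^+ 2 ->
    F k <= 16 * M%:R ^+ 2 * t ^+ 2 / h.
  move=> k0 kM hk; have p0 := occ_gt0 t0 k0.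
  have kR : 0 < k%:R :> R by rewrite ltr0n.
  have kM' : k%:R <= M.*2%:R :> R by rewrite ler_nat.
  have kt : k%:R * t <= 1 / 2 by apply: le_trans Mt; rewrite ler_wpM2r // ltW.
  have M0 : 0 < M%:R :> R by rewrite ltr0n; lia.
  have e2 : M.*2%:R = 2 * M%:R :> R by rewrite -muln2 natrM mulrC.
  have := occ_product_ge t0 k0 kt; set P := occ t k * (1 + occ t k) => hP.
  have P0 : 0 < P by rewrite /P mulr_gt0 // addr_gt0.
  have hP2 : 1 <= 16 * M%:R ^+ 2 * t ^+ 2 * P.
    have : (k%:R * t) ^+ 2 * P <= (2 * M%:R * t) ^+ 2 * P.
      rewrite ler_wpM2r ?(ltW P0) // lerXn2r ?nnegrE ?mulr_ge0 ?(ltW t0) ?(ltW kR) ?(ltW M0) //.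
      by rewrite ler_wpM2r ?(ltW t0) // -e2.
    by rewrite !exprMn in hP *; lra.
  set Y := 16 * M%:R ^+ 2 * t ^+ 2 in hP2 *.
  have Y0 : 0 < Y by rewrite /Y !mulr_gt0 // exprn_gt0.
  apply: (@le_trans _ _ (1 + h / Y)^-1).
    apply: geom_cf_sqr_le => //; first by rewrite divr_ge0 // ltW.
    rewrite -/P ler_pdivrMr //; apply: le_trans hk _.
    rewrite mulrAC ler_peMl ?sqr_ge0 //; lra.
  have hY : 0 < h / Y by rewrite divr_gt0.
  rewrite -[leRHS]invrK invf_div lef_pV2 ?posrE //; lra.
rewrite (big_cat_nat (n := M.*2.+1)) //.
apply: (@le_trans _ _ ((16 * M%:R ^+ 2 * t ^+ 2 / h) ^+ M * 1)); last by rewrite mulr1.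
have q0 : 0 <= 16 * M%:R ^+ 2 * t ^+ 2 / h.
  rewrite divr_ge0 ?(ltW h0) //; have := sqr_ge0 (M%:R * t : R); rewrite exprMn; lra.
apply: ler_pM; try by apply: prodr_ge0 => k _; rewrite sqr_ge0.
  suff H m : (m <= M)%N -> \prod_(1 <= k < m.*2.+1) F k <= (16 * M%:R ^+ 2 * t ^+ 2 / h) ^+ m.
    exact: H.
  elim: m => [|m IH] mM; first by rewrite big_geq // expr0.
  rewrite doubleS 2?big_nat_recr //= -mulrA exprSr; apply: ler_pM.
  - by apply: prodr_ge0 => k _; rewrite sqr_ge0.
  - by apply: mulr_ge0; rewrite sqr_ge0.
  - by apply: IH; exact: ltnW.
  have /andP[a0 a1] := F01 m.*2.+1 isT; have /andP[b0 b1] := F01 m.*2.+2 isT.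
  have [hg|hg] := good m mM.
    have : F m.*2.+1 <= 16 * M%:R ^+ 2 * t ^+ 2 / h.
      by apply: Fgood => //; apply: ltnW; rewrite -doubleS leq_double.
    by apply: le_trans; rewrite ler_piMr.
  have : F m.*2.+2 <= 16 * M%:R ^+ 2 * t ^+ 2 / h.
    by apply: Fgood => //; rewrite -doubleS leq_double.
  by apply: le_trans; rewrite ler_piMl.
rewrite big_nat_cond; apply: prodr_ile1 => k; rewrite andbT => /andP[Kk _].
by apply: F01; lia.
Qed.

(** With [s = sqrt t], about [1/s] factors are each at most [e^(-1/16)], which gives
    [e^(-1/(128 s))]. The power bound is taken with exponent [2(M+1)] because [s^2 = t]. *)
Lemma cf_prod1_middle t L M theta : 0 < t -> t <= 1 / 16 -> 1 / (4 * t) <= L%:R ->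
  t <= `|theta| -> `|theta| <= Num.sqrt t ->
  normc (cf_prod t L 1 theta) <= (128 * M.+1.*2%:R) ^+ M.+1.*2 * t ^+ M.+1.
Proof.
move=> t0 t1 tL th1 th2; set s := Num.sqrt t in th2 *.
have s0 : 0 < s by rewrite sqrtr_gt0.
have s2 : s ^+ 2 = t by rewrite sqr_sqrtr // ltW.
have s1 : s <= 1 / 4.
  by rewrite -(@ler_pXn2r _ 2) ?nnegrE ?(ltW s0) // s2; lra.
have ts : t <= s by rewrite -s2 expr2 ler_piMr ?(ltW s0) //; lra.
have [K K1 K2] : exists2 K : nat, K%:R <= 1 / (4 * s) & 1 / (4 * s) <= 2 * K%:R.
  by apply: nat_below; rewrite ler_pdivlMr; lra.
have Ks : K%:R * s <= 1 / 4 by move: K1; rewrite ler_pdivlMr; lra.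
have KL : (K <= L)%N.
  rewrite -(ler_nat R); apply: le_trans K1 (le_trans _ tL).
  by rewrite !div1r lef_pV2 ?posrE; lra.
have Kt : K%:R * t <= 1 / 4 by apply: le_trans Ks; rewrite ler_wpM2l.
have Kth : K%:R * `|theta| <= 1 / 4 by apply: le_trans Ks; rewrite ler_wpM2l.
apply: le_trans (cf_prod1_small t0 KL _ Kth) _; first by lra.
have th : t ^+ 2 <= theta ^+ 2.
  by rewrite -[theta ^+ 2]real_normK ?num_real // lerXn2r ?nnegrE // ltW.
have tt : 0 < t ^+ 2 by rewrite exprn_gt0.
have v1 : 1 / 8 <= theta ^+ 2 / (8 * t ^+ 2) by rewrite ler_pdivlMr; lra.
apply: (@le_trans _ _ (expR (- (1 / 8 / 2)) ^+ K)).
  rewrite lerXn2r ?nnegrE ?expR_ge0 //; first by rewrite invr_ge0; lra.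
  apply: le_trans (inv1D_le_expR _); last by lra.
  by rewrite lef_pV2 ?posrE; lra.
rewrite -expRM_natl.
apply: (@le_trans _ _ (expR (- (128 * s)^-1))).
  rewrite ler_expR; have : 1 / (8 * s) <= K%:R by rewrite ler_pdivrMr; move: K2; rewrite ler_pdivrMr; lra.
  have -> : (128 * s)^-1 = 1 / (8 * s) / 16 by field; rewrite gt_eqF.
  by lra.
rewrite doubleS; apply: le_trans (expRN_le_pow M.*2.+1 _) _.
  by rewrite invr_gt0 mulr_gt0.
rewrite -[t in leRHS]s2 -exprM mul2n doubleS -exprMn invrK.
by apply: le_of_eq; congr (_ ^+ _); ring.
Qed.

End ProductBounds.

(** * Power savings far from the saddle *)

Section ProductTail.
Variable R : realType.
Implicit Types (t theta : R) (k L M N : nat) (z : R[i]).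

Let unit_cis z theta : normc z = 1 -> normc (z * cis theta) = 1.
Proof. by move=> z1; rewrite normcM normc_cis mulr1. Qed.

(** Neighbouring values [e^(ik theta)] are at distance [|e^(i theta) - 1|], whose square is at least
    [t/2]. By [(a + b)^2 <= 2(a^2 + b^2)] one of them is at squared distance at least [t/8] from
    1. *)
Lemma cf_prod1_far t L M theta : 0 < t -> t <= 1 / 16 ->
  (M.*2 <= L)%N -> M.*2%:R * t <= 1 / 2 ->
  Num.sqrt t <= `|theta| -> `|theta| <= pi ->
  normc (cf_prod t L 1 theta) <= (128 * M%:R ^+ 2) ^+ M * t ^+ M.
Proof.
move=> t0 t1 ML Mt th1 th2; set s := Num.sqrt t in th1 *.
have s0 : 0 < s by rewrite sqrtr_gt0.
have s2 : s ^+ 2 = t by rewrite sqr_sqrtr // ltW.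
have s1 : s <= 1 / 4.
  by rewrite -(@ler_pXn2r _ 2) ?nnegrE ?(ltW s0) // s2; lra.
have c1 : t / 2 <= normc (cis theta - 1) ^+ 2.
  rewrite normc_cis_sub1 -cos_norm.
  have : cos `|theta| <= cos s.
    have p1 := pi_ge2 R.
    have h1 : s \in `[0, pi]%R by rewrite in_itv /=; apply/andP; split; lra.
    have h2 : `|theta| \in `[0, pi]%R by rewrite in_itv /= normr_ge0.
    by rewrite leNgt (ltr_cos h2 h1) -leNgt.
  have := @cos_le_small R s; rewrite gtr0_norm // s2 => /(_ s1); lra.
rewrite cf_prod1E -exprMn.
have -> : 128 * M%:R ^+ 2 * t = 16 * M%:R ^+ 2 * t ^+ 2 / (t / 8) by field; rewrite gt_eqF.
apply: prod_pairs => //; first by rewrite divr_gt0.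
  by move=> k; exact: normc_cis.
move=> m mM; set a := normc (_ - 1); set b := normc (cis (m.*2.+2%:R * theta) - 1).
have ab : normc (cis theta - 1) <= a + b.
  have e : cis (m.*2.+2%:R * theta) - 1 - (cis (m.*2.+1%:R * theta) - 1) =
      cis (m.*2.+1%:R * theta) * (cis theta - 1).
    have -> : m.*2.+2%:R * theta = m.*2.+1%:R * theta + theta.
      by rewrite -[m.*2.+2%:R]natr1 mulrDl mul1r.
    by rewrite cisD; ring.
  rewrite -[leLHS]mul1r -(normc_cis (m.*2.+1%:R * theta)) -normcM -e.
  by apply: le_trans (ler_normcD _ _) _; rewrite normc_opp addrC.
have [h|h] := leP (t / 8) (a ^+ 2); first by left.
right; rewrite leNgt; apply/negP => h'.
have a0 : 0 <= a by exact: normc_ge0.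
have b0 : 0 <= b by exact: normc_ge0.
have n0 : 0 <= normc (cis theta - 1) by exact: normc_ge0.
move: c1; rewrite leNgt => /negP; apply.
apply: (@le_lt_trans _ _ ((a + b) ^+ 2)); first by rewrite lerXn2r ?nnegrE // addr_ge0.
have : 0 <= (a - b) ^+ 2 by exact: sqr_ge0.
by nra.
Qed.

Lemma normc_cisX_sub1 theta k : normc (cis (k%:R * theta) - 1) <= k%:R * normc (cis theta - 1).
Proof.
elim: k => [|k IH]; first by rewrite !mul0r cis0 subrr normc0.
have -> : cis (k.+1%:R * theta) - 1 =
    cis (k%:R * theta) * (cis theta - 1) + (cis (k%:R * theta) - 1).
  by rewrite mulrBr -cisD mulr1 -natr1 mulrDl mul1r subrKA.
apply: le_trans (ler_normcD _ _) _; rewrite normcM normc_cis mul1r -natr1; lra.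
Qed.

(** Uniform in [theta]: if two neighbours [z e^(ik theta)] were within [eta] of 1, then
    [|e^(i theta) - 1| <= 2 eta], and going back [k <= 2M - 1] steps would put [z] closer to 1 than
    [(4M + 1) eta]. Only the factors with [z] are kept, squared to fit [prod_pairs]. *)
Lemma cf_prod_neq1 t L M z theta : 0 < t -> normc z = 1 -> z != 1 ->
  (M.*2 <= L)%N -> M.*2%:R * t <= 1 / 2 ->
  normc (cf_prod t L z theta) ^+ 2 <=
  (16 * M%:R ^+ 2 * (4 * M%:R + 1) ^+ 2 / normc (z - 1) ^+ 2) ^+ M * (t ^+ 2) ^+ M.
Proof.
move=> t0 z1 zn1 ML Mt.
have d0 : 0 < normc (z - 1) by rewrite lt0r normc_eq0 subr_eq0 zn1 normc_ge0.
have M0 : 0 <= M%:R :> R by exact: ler0n.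
set eta := normc (z - 1) / (4 * M%:R + 1).
have eta0 : 0 < eta by rewrite divr_gt0 //; lra.
rewrite -exprMn.
have -> : 16 * M%:R ^+ 2 * (4 * M%:R + 1) ^+ 2 / normc (z - 1) ^+ 2 * t ^+ 2 =
    16 * M%:R ^+ 2 * t ^+ 2 / eta ^+ 2.
  by rewrite /eta; field; rewrite ?gt_eqF //; lra.
apply: (@le_trans _ _ ((\prod_(1 <= k < L.+1)
    normc (geom_cf (occ t k) (z * cis (k%:R * theta)))) ^+ 2)).
  rewrite lerXn2r ?nnegrE ?normc_ge0 ?cf_prod_le_first //.
  by apply: prodr_ge0 => k _; exact: normc_ge0.
rewrite -prodrXl.
apply: (@prod_pairs R t L M (fun k => z * cis (k%:R * theta))) => //.
- by rewrite exprn_gt0.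
- by move=> k; exact: unit_cis.
move=> m mM; set w := z * _; set w' := z * cis (m.*2.+2%:R * theta).
have [h|h] := leP eta (normc (w - 1)).
  by left; rewrite lerXn2r ?nnegrE ?normc_ge0 // ltW.
have [h'|h'] := leP eta (normc (w' - 1)).
  by right; rewrite lerXn2r ?nnegrE ?normc_ge0 // ltW.
exfalso.
have c1 : normc (cis theta - 1) <= 2 * eta.
  have e : w' - 1 - (w - 1) = w * (cis theta - 1).
    have e2 : m.*2.+2%:R * theta = m.*2.+1%:R * theta + theta.
      by rewrite -[m.*2.+2%:R]natr1 mulrDl mul1r.
    by rewrite /w' /w e2 cisD; ring.
  have -> : normc (cis theta - 1) = normc (w' - 1 - (w - 1)).
    by rewrite e normcM unit_cis // mul1r.
  by apply: le_trans (ler_normcD _ _) _; rewrite normc_opp; lra.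
have c2 : normc (z - 1) <= eta + m.*2.+1%:R * (2 * eta).
  have -> : z - 1 = (w - 1) - z * (cis (m.*2.+1%:R * theta) - 1) by rewrite /w; ring.
  apply: le_trans (ler_normcD _ _) _; rewrite normc_opp normcM z1 mul1r.
  have := normc_cisX_sub1 theta m.*2.+1.
  have := ler_wpM2l (ler0n R m.*2.+1) c1; lra.
have e : normc (z - 1) = eta * (4 * M%:R + 1) by rewrite /eta divfK //; lra.
have : m.*2.+1%:R + 1 <= 2 * M%:R :> R.
  by rewrite natr1 -natrM ler_nat mul2n -doubleS leq_double.
by have := h; nra.
Qed.

End ProductTail.

(** * Gaussian integrals *)

Section GaussianLimits.
Variable R : realType.
Notation mu := (@lebesgue_measure R).
Implicit Types (c u B : R) (m : nat).

Lemma integrable_expR_sqr c : 0 < c ->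
  mu.-integrable setT (fun u => (expR (- (c * u ^+ 2)))%:E).
Proof.
(* This standard deviation makes the normal density proportional to [e^(-c u^2)]. *)
move=> c0; pose s := (Num.sqrt (2 * c))^-1.
have s0 : s != 0 by rewrite invr_eq0 gt_eqF // sqrtr_gt0 mulr_gt0.
have p0 := normal_peak_gt0 s0.
have := integrable_normal_pdf (0 : R) s.
move=> /(integrableZl measurableT (normal_peak s)^-1).
apply: eq_integrable => // u _; rewrite normal_pdfE // -EFinM; congr EFin.
rewrite mulKf ?gt_eqF // /normal_fun; congr expR.
rewrite subr0 /s exprVn sqr_sqrtr; last by rewrite mulr_ge0 // ltW.
by field; rewrite gt_eqF.
Qed.

Lemma pow_expR_sqr_le c m : 0 < c ->
  exists2 C : R, 0 < C & forall u, `|u| ^+ m * expR (- (c * u ^+ 2)) <= C * expR (- (c / 2 * u ^+ 2)).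
Proof.
move=> c0; pose k : R := m.+1%:R / (c / 2).
exists (1 + k ^+ m.+1) => [|u].
  have : 0 <= k by rewrite divr_ge0 // divr_ge0 // ltW.
  by move=> /(exprn_ge0 m.+1); lra.
have -> : expR (- (c * u ^+ 2)) = expR (- (c / 2 * u ^+ 2)) * expR (- (c / 2 * u ^+ 2)).
  by rewrite -expRD; congr expR; field.
rewrite mulrA ler_wpM2r ?expR_ge0 //.
have u0 := normr_ge0 u; set x := c / 2 * u ^+ 2.
have x0 : 0 <= x by rewrite mulr_ge0 ?sqr_ge0 // divr_ge0 // ltW.
have kx : u ^+ 2 = k * (x / m.+1%:R).
  have gen (M : R) : M != 0 -> u ^+ 2 = M / (c / 2) * (x / M).
    by move=> M0; rewrite /x; field; rewrite M0 gt_eqF.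
  by rewrite /k -gen // pnatr_eq0.
have k0 : 0 <= k by rewrite divr_ge0 // divr_ge0 // ltW.
rewrite expRN ler_pdivrMr ?expR_gt0 //.
have e1 : 1 <= expR x by rewrite -expR0 ler_expR.
have [u1|u1] := leP `|u| 1.
  have : `|u| ^+ m <= 1 by rewrite exprn_ile1.
  have : 0 <= k ^+ m.+1 * expR x by rewrite mulr_ge0 ?exprn_ge0 ?expR_ge0.
  by nra.
have : `|u| ^+ m <= (u ^+ 2) ^+ m.+1.
  rewrite -[u ^+ 2]real_normK ?num_real // -exprM; apply: ler_weXn2l; [lra|lia].
rewrite kx exprMn => h.
have : (x / m.+1%:R) ^+ m.+1 <= expR x.
  apply: le_trans (expR_ge_pow m x0); rewrite lerXn2r ?nnegrE //.
  - by rewrite divr_ge0.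
  - by rewrite addr_ge0 // divr_ge0.
  - by rewrite lerDr.
move=> /(ler_wpM2l (exprn_ge0 m.+1 k0)); nra.
Qed.

(** The interval grows with [n]; extending [F_ n] by zero brings everything to dominated convergence
    on the whole line. *)
Lemma gauss_dominated (c C : R) (F_ : nat -> R -> R) (f : R -> R) (B_ : nat -> R) :
  0 < c -> (forall n, continuous (F_ n)) -> continuous f ->
  (forall u, F_ ^~ u @ \oo --> f u) -> B_ @ \oo --> +oo ->
  (forall n u, `|u| <= B_ n -> `|F_ n u| <= C * expR (- (c * u ^+ 2))) ->
  mu.-integrable setT (EFin \o f) /\
  (fun n => \int[mu]_(u in `[(- B_ n), B_ n]) F_ n u) @ \oo --> \int[mu]_u f u.
Proof.
move=> c0 cF cf Ff By dom.
pose G : nat -> R -> R := fun n => (F_ n) \_ (`[(- B_ n), B_ n]).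
have mG n : measurable_fun [set: R] (G n).
  apply/measurable_restrict => //.
  by apply: measurable_funTS; exact: continuous_measurable_fun.
have mf : measurable_fun [set: R] f by exact: continuous_measurable_fun.
have Gf u : G ^~ u @ \oo --> f u.
  apply: cvg_trans (Ff u); apply: near_eq_cvg.
  have /cvgryPge /(_ `|u|) := By; apply: filterS => n un.
  rewrite /G patchE mem_set //= in_itv /=.
  by rewrite -ler_norml.
have ig : mu.-integrable setT (fun u => (C * expR (- (c * u ^+ 2)))%:E).
  have := integrableZl measurableT C (integrable_expR_sqr c0).
  by apply: eq_integrable => // u _; rewrite EFinM.
have C0 : 0 <= C.
  have /cvgryPge /(_ 0) [n _ /(_ n (leqnn n)) /= Bn] := By.
  have := dom n 0; rewrite normr0 => /(_ Bn); rewrite expr0n mulr0 oppr0 expR0 mulr1.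
  exact: le_trans.
have [| |i1 _ i3] := @dominated_convergence _ _ R mu setT measurableT
  (fun n => EFin \o G n) (EFin \o f) (fun u => (C * expR (- (c * u ^+ 2)))%:E)
  (fun n => (measurable_EFinP _ _).2 (mG n)) ((measurable_EFinP _ _).2 mf) _ ig.
- apply: aeW => u _; apply: cvg_EFin; last exact: Gf.
  by apply: nearW.
- apply: aeW => u n _; rewrite /= lee_fin /G patchE.
  case: ifPn => [|_]; last by rewrite normr0 mulr_ge0 ?expR_ge0.
  by rewrite inE /= in_itv /= -ler_norml; exact: dom.
split => //.
rewrite [X in X @ _ --> _](_ : _ = fine \o (fun n => \int[mu]_u (EFin \o G n) u)%E).
  apply: fine_cvg; rewrite /Rintegral fineK //.
  exact: integrable_fin_num.
by apply/funext => n; rewrite Rintegral_mkcond.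
Qed.



End GaussianLimits.

Section GaussianMoments.
Variable R : realType.
Notation mu := (@lebesgue_measure R).
Implicit Types (u : R) (m : nat).

Definition gauss_pow m u : R := u ^+ m * expR (- (1 / 4 * u ^+ 2)).
Definition gauss_moment m : R := \int[mu]_u gauss_pow m u.

Lemma is_derive_gauss u : is_derive u (1 : R) (fun u => expR (- (1 / 4 * u ^+ 2)))
  (- (u / 2) * expR (- (1 / 4 * u ^+ 2))).
Proof. by apply: is_derive_eq; rewrite /GRing.scale /=; field. Qed.

Lemma is_derive_gauss_pow m u : is_derive u (1 : R) (gauss_pow m.+1)
  (m.+1%:R * gauss_pow m u - gauss_pow m.+2 u / 2).
Proof.
have h := is_derive_gauss u.
have hX : is_derive u (1 : R) (@GRing.exp R ^~ m.+1) (m.+1%:R * u ^+ m).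
  by split; [exact: exprn_derivable|rewrite exp_derive /GRing.scale /= mulr1].
have := is_deriveM hX h; congr (is_derive _ _ _ _).
by rewrite /gauss_pow /GRing.scale /= !exprS; field.
Qed.

Lemma continuous_gauss_pow m : continuous (gauss_pow m).
Proof.
case: m => [|m] u; apply: differentiable_continuous; apply/derivable1_diffP.
  rewrite (_ : gauss_pow 0 = fun u => expR (- (1 / 4 * u ^+ 2))).
    by case: (is_derive_gauss u).
  by apply/funext => x; rewrite /gauss_pow expr0 mul1r.
by case: (is_derive_gauss_pow m u).
Qed.

Lemma gauss_pow_le m : exists2 C, 0 < C &
  forall u, `|gauss_pow m u| <= C * expR (- (1 / 8 * u ^+ 2)).
Proof.
have [C C0 h] := @pow_expR_sqr_le R (1 / 4) m ltac:(lra).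
exists C => // u; rewrite normrM normrX (ger0_norm (expR_ge0 _)).
by apply: le_trans (h u) _; rewrite (_ : 1 / 4 / 2 = 1 / 8) //; lra.
Qed.

Let cvg_nat : (fun n : nat => (n.+1%:R : R)) @ \oo --> +oo.
Proof.
apply/cvgryPge => A; have /cvgryPge /(_ A) := @cvgr_idn R.
apply: filterS => n /le_trans; apply; by rewrite ler_nat.
Qed.

Let gauss_limit (f : R -> R) (C : R) : continuous f ->
  (forall u, `|f u| <= C * expR (- (1 / 8 * u ^+ 2))) ->
  mu.-integrable setT (EFin \o f) /\
  (fun n : nat => \int[mu]_(u in `[(- n.+1%:R), n.+1%:R]) f u) @ \oo --> \int[mu]_u f u.
Proof.
move=> cf fC; apply: (@gauss_dominated R (1 / 8) C (fun=> f)) => //.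
by move=> u; exact: cvg_cst.
Qed.

Lemma integrable_gauss_pow m : mu.-integrable setT (EFin \o gauss_pow m).
Proof.
have [C _ h] := gauss_pow_le m.
by have [] := gauss_limit (@continuous_gauss_pow m) h.
Qed.

Let boundary0 m : (fun n : nat => gauss_pow m n.+1%:R - gauss_pow m (- n.+1%:R)) @ \oo --> (0 : R).
Proof.
have [C C0 h] := gauss_pow_le m.
have hb (x : R) : 1 <= x -> `|gauss_pow m x - gauss_pow m (- x)| <= 16 * C / x.
  move=> x1; apply: le_trans (ler_normB _ _) _.
  have := h x; have := h (- x); rewrite sqrrN.
  have : expR (- (1 / 8 * x ^+ 2)) <= 8 / x.
    have x8 : 0 < 1 / 8 * x ^+ 2 by rewrite mulr_gt0 ?exprn_gt0 //; lra.
    have := expRN_le_pow 0 x8; rewrite !expr1 => /le_trans; apply.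
    have -> : 1%:R / (1 / 8 * x ^+ 2) = 8 / x * x^-1 by field; rewrite gt_eqF //; lra.
    by rewrite ler_piMr ?divr_ge0 ?invf_le1 //; lra.
  move=> /(ler_wpM2l (ltW C0)); lra.
apply/cvgrPdist_le => e e0; have /cvgryPge /(_ (16 * C / e)) := cvg_nat.
apply: filterS => n; rewrite ler_pdivrMr // => ne.
rewrite sub0r normrN; apply: le_trans (hb _ _) _; first by rewrite ler1n.
by rewrite ler_pdivrMr ?ltr0n //; lra.
Qed.

(** Integration of the derivative of [u^(m+1) e^(-u^2/4)], whose boundary values vanish in the
    limit. *)
Lemma gauss_momentSS m : gauss_moment m.+2 = 2 * m.+1%:R * gauss_moment m.
Proof.
pose f u := m.+1%:R * gauss_pow m u - gauss_pow m.+2 u / 2.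
have cf : continuous f.
  move=> u; apply: cvgB; apply: cvgM;
  by [exact: cvg_cst|exact: continuous_gauss_pow].
have [C1 C10 h1] := gauss_pow_le m; have [C2 C20 h2] := gauss_pow_le m.+2.
have [|_ lim] := @gauss_limit f (m.+1%:R * C1 + C2) cf.
  move=> u; apply: le_trans (ler_normB _ _) _; rewrite mulrDl; apply: lerD.
    by rewrite normrM normr_nat -[leRHS]mulrA ler_wpM2l.
  rewrite normrM [X in _ * X]ger0_norm ?invr_ge0 //; have := h2 u.
  have := normr_ge0 (gauss_pow m.+2 u); lra.
have e : \int[mu]_u f u = m.+1%:R * gauss_moment m - gauss_moment m.+2 / 2.
  rewrite /f RintegralB //; last 2 first.
  - have := integrableZl measurableT m.+1%:R (integrable_gauss_pow m).
    by apply: eq_integrable.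
  - have := integrableZl measurableT 2^-1 (integrable_gauss_pow m.+2).
    by apply: eq_integrable => // u _; rewrite /= -EFinM mulrC.
  by rewrite RintegralZl ?RintegralZr //; exact: integrable_gauss_pow.
have z : \int[mu]_u f u = 0.
  have ef : (fun n : nat => \int[mu]_(u in `[(- n.+1%:R), n.+1%:R]) f u) =
      (fun n : nat => gauss_pow m.+1 n.+1%:R - gauss_pow m.+1 (- n.+1%:R)).
    apply/funext => n; apply: Rintegral_FTC => //.
    exact: is_derive_gauss_pow.
  by rewrite ef in lim; rewrite -(cvg_lim _ lim) // (cvg_lim _ (boundary0 m.+1)).
by move: e; rewrite z; lra.
Qed.

Lemma gauss_moment1 : gauss_moment 1 = 0.
Proof.
have [C C0 h] := gauss_pow_le 1.
have [_ lim] := gauss_limit (@continuous_gauss_pow 1) h.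
have ef : (fun n : nat => \int[mu]_(u in `[(- n.+1%:R), n.+1%:R]) gauss_pow 1 u) =
    (fun=> 0).
  apply/funext => n.
  have hd (u : R) : is_derive u (1 : R) (fun u => (- 2) * expR (- (1 / 4 * u ^+ 2))) (gauss_pow 1 u).
    have := is_derive_gauss u => hd.
    by apply: is_derive_eq; rewrite /GRing.scale /= /gauss_pow expr1; field.
  by rewrite (Rintegral_FTC _ (@continuous_gauss_pow 1) hd) // sqrrN subrr.
by rewrite ef in lim; rewrite /gauss_moment -(cvg_lim _ lim) // lim_cst.
Qed.

(** Up to a positive constant this is the total mass of the normal law of variance 2. It serves as
    the denominator of the limiting ratio. *)
Lemma gauss_moment0_gt0 : 0 < gauss_moment 0.
Proof.
have s0 : Num.sqrt 2 != 0 :> R by rewrite gt_eqF // sqrtr_gt0.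
have p0 := normal_peak_gt0 s0.
have : (\int[mu]_u (normal_peak (Num.sqrt 2) * gauss_pow 0 u)%:E = 1)%E.
  rewrite -(integral_normal_pdf (0 : R) (Num.sqrt 2)); apply: eq_integral => u _.
  rewrite normal_pdfE // /normal_fun /gauss_pow expr0 mul1r subr0.
  by rewrite sqr_sqrtr //; congr (_ * expR _)%:E; field.
move/(congr1 fine); rewrite -[LHS]/(\int[mu]_u (normal_peak (Num.sqrt 2) * gauss_pow 0 u)) RintegralZl //; last exact: integrable_gauss_pow.
rewrite -/(gauss_moment 0) /= => e.
by rewrite -(pmulr_rgt0 _ p0) e.
Qed.

End GaussianMoments.

Section ComplexLimits.
Variable R : realType.
Notation mu := (@lebesgue_measure R).

Lemma Rintegral_core (P Q M : R) (f : R -> R) : 0 <= Q -> Q <= P -> 0 <= M ->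
  continuous f -> (forall u, Q <= `|u| -> `|u| <= P -> `|f u| <= M) ->
  `|\int[mu]_(u in `[(- P), P]) f u - \int[mu]_(u in `[(- Q), Q]) f u| <= M * (2 * P).
Proof.
move=> Q0 QP M0 cf fM.
have iP := integrable_itv P cf.
have sub : `[(- Q), Q] `<=` `[(- P), P].
  by move=> u /=; rewrite !in_itv /= => /andP[*]; apply/andP; split; lra.
pose g : R -> R := f \_ (`[(- Q), Q]).
have e : \int[mu]_(u in `[(- Q), Q]) f u =
    \int[mu]_(u in `[(- P), P]) g u.
  by rewrite -Rintegral_mkcondr setIC (setIidl sub).
have iQ : mu.-integrable `[(- P), P] (EFin \o g).
  rewrite /g -restrict_EFin; apply/integrable_restrict => //.
  by rewrite setIC (setIidl sub); exact: integrable_itv.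
rewrite e -RintegralB //.
have iB : mu.-integrable `[(- P), P] (EFin \o (fun u => f u - g u)).
  have : mu.-integrable `[(- P), P] ((EFin \o f) \- (EFin \o g))%E.
    exact: integrableB.
  by apply: eq_integrable.
apply: (@le_trans _ _ (\int[mu]_(u in `[(- P), P]) `|f u - g u|)).
  exact: le_normr_Rintegral.
have -> : M * (2 * P) = \int[mu]_(u in `[(- P), P]) M.
  rewrite Rintegral_cst //= lebesgue_measure_itv /= lte_fin.
  case: ltP => h /=; first by congr (M * _); ring.
  by have -> : P = 0 by [lra]; ring.
apply: le_Rintegral => //.
- have /integrable_abse := iB; apply: eq_integrable => //.
- by apply: integrable_itv => u; exact: cvg_cst.
- move=> u /=; rewrite in_itv /= /g patchE => uP.
  case: ifPn => [_|]; first by rewrite subrr normr0.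
  rewrite notin_setE /= in_itv /= => /negP; rewrite -ler_norml -ltNge => Qu.
  by rewrite subr0; apply: fM; [exact: ltW|rewrite ler_norml].
Qed.

Definition ccvg (f : nat -> R[i]) (z : R[i]) := (fun n => normc (f n - z)) @ \oo --> (0 : R).

Lemma cvg0_le (a b : nat -> R) : (\forall n \near \oo, 0 <= a n <= b n) ->
  b @ \oo --> (0 : R) -> a @ \oo --> (0 : R).
Proof.
by move=> ab b0; apply: (@squeeze_cvgr _ _ _ _ (fun=> 0) b) => //; exact: cvg_cst.
Qed.

Lemma cvg_rsum (I : Type) (s : seq I) (f : I -> nat -> R) (l : I -> R) :
  (forall i, f i @ \oo --> l i) ->
  (fun n => \sum_(i <- s) f i n) @ \oo --> \sum_(i <- s) l i.
Proof.
move=> fl; elim: s => [|i s IH].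
  by under eq_fun do rewrite big_nil; rewrite big_nil; exact: cvg_cst.
by under eq_fun do rewrite big_cons; rewrite big_cons; apply: cvgD.
Qed.

Lemma cvg0_sqr (a : nat -> R) : (fun n => a n ^+ 2) @ \oo --> (0 : R) -> a @ \oo --> (0 : R).
Proof.
move=> /cvgrPdist_lt h; apply/cvgrPdist_lt => e e0.
have := h (e ^+ 2) (exprn_gt0 2 e0); apply: filterS => n.
by rewrite !sub0r !normrN normrX ltr_pXn2r ?nnegrE // ltW.
Qed.

Lemma ccvg_le (f : nat -> R[i]) z (b : nat -> R) :
  (\forall n \near \oo, normc (f n - z) <= b n) -> b @ \oo --> (0 : R) -> ccvg f z.
Proof.
by move=> fb; apply: cvg0_le; apply: filterS fb => n ->; rewrite normc_ge0.
Qed.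

Lemma ccvg_cst z : ccvg (fun=> z) z.
Proof. by rewrite /ccvg subrr normc0; exact: cvg_cst. Qed.

Lemma ccvgM f g z w : ccvg f z -> ccvg g w -> ccvg (fun n => f n * g n) (z * w).
Proof.
move=> fz gw; apply: (@ccvg_le _ _ (fun n => normc (f n - z) * normc (g n - w) +
    normc z * normc (g n - w) + normc w * normc (f n - z))).
  apply: nearW => n.
  have -> : f n * g n - z * w = (f n - z) * (g n - w) + z * (g n - w) + w * (f n - z).
    by ring.
  apply: le_trans (ler_normcD _ _) _; rewrite normcM lerD2r.
  by apply: le_trans (ler_normcD _ _) _; rewrite !normcM.
rewrite -[X in _ --> X](_ : 0 * 0 + normc z * 0 + normc w * 0 = 0); last first.
  by rewrite !mulr0 !addr0.
by apply: cvgD; [apply: cvgD|]; apply: cvgM => //; exact: cvg_cst.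
Qed.

Lemma ccvgX f z m : ccvg f z -> ccvg (fun n => f n ^+ m) (z ^+ m).
Proof.
move=> fz; elim: m => [|m IH]; first by under eq_fun do rewrite expr0; exact: ccvg_cst.
by under eq_fun do rewrite exprS; rewrite exprS; exact: ccvgM.
Qed.

Lemma ccvg_Re f z : ccvg f z -> (fun n => complex.Re (f n)) @ \oo --> complex.Re z.
Proof.
move=> fz; apply/cvgrPdist_lt => e e0; move/cvgrPdist_lt : fz => /(_ e e0).
apply: filterS => n; rewrite sub0r normrN ger0_norm ?normc_ge0 //; apply: le_lt_trans.
rewrite distrC; apply: le_trans (ler_Re_normc _).
by case: (f n) z => [a b] [c d].
Qed.

End ComplexLimits.

(** * The rescaled integrand *)

Section SaddleIntegrand.
Variable R : realType.
Implicit Types (t u w : R) (k L M N m l : nat) (z : R[i]).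

Definition width t L : R := (2 * Num.sqrt (occ_var t L))^-1.

(** One term of the binomial expansion of the [d]-th power, with [l = d - m]: the third factor tends
    to [(iu)^m], the last one to 1. *)
Definition saddle_integrand t L N z m l u : R[i] :=
  cis (- (N%:R * (width t L * u))) * cf_prod t L z (width t L * u) *
  ((1 - cis (- (width t L * u))) * (width t L)^-1%:C) ^+ m *
  cis (- (l%:R * (width t L * u))).

Lemma occ_ge0 t k : 0 < t -> 0 <= occ t k.
Proof.
(* Continuity of products is asked for every [k]; at [k = 0] the inverse of 0 is 0. *)
move=> t0; case: k => [|k]; last by rewrite ltW // occ_gt0.
by rewrite /occ mul0r expR0 subrr invr0.
Qed.

Lemma ccont_cisN (a b : R) : ccont (fun u => cis (- (a * (b * u)))).
Proof.
rewrite [X in ccont X](_ : _ = fun u => cis (- (a * b) * u)); first exact: ccont_cis.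
by apply/funext => u; congr cis; ring.
Qed.

Lemma ccont_cf_prod t L z (w : R) : 0 < t -> normc z = 1 ->
  ccont (fun u => cf_prod t L z (w * u)).
Proof.
move=> t0 z1; have z1' : normc z^-1 = 1 by rewrite normcV z1 invr1.
have c1 k y : normc y = 1 -> ccont (fun u => geom_cf (occ t k) (y * cis (k%:R * (w * u)))).
  move=> y1; apply: ccontV => [u|].
    by apply: geom_cf_den_neq0; [exact: occ_ge0|rewrite normcM normc_cis y1 mulr1].
  rewrite [X in ccont X](_ : _ = fun u => 1 + (occ t k)%:C +
    (- (occ t k)%:C * y) * cis (k%:R * w * u)).
    apply: ccontD; first exact: ccont_cst.
    by apply: ccontM; [exact: ccont_cst|exact: ccont_cis].
  by apply/funext => u; rewrite mulrA; ring.
apply: (@ccont_prod _ _ (index_iota 1 L.+1) (fun k u =>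
  geom_cf (occ t k) (z * cis (k%:R * (w * u))) *
  geom_cf (occ t k) (z^-1 * cis (k%:R * (w * u))))) => k.
by apply: ccontM; exact: c1.
Qed.

Lemma ccont_saddle t L N z m l : 0 < t -> normc z = 1 ->
  ccont (saddle_integrand t L N z m l).
Proof.
move=> t0 z1; apply: ccontM; last exact: ccont_cisN.
apply: ccontM; first by apply: ccontM; [exact: ccont_cisN|exact: ccont_cf_prod].
apply: ccontX; apply: ccontM; last exact: ccont_cst.
rewrite [X in ccont X](_ : _ = fun u => 1 + (-1) * cis (- width t L * u)).
  apply: ccontD; first exact: ccont_cst.
  by apply: ccontM; [exact: ccont_cst|exact: ccont_cis].
by apply/funext => u; rewrite mulN1r mulNr.
Qed.

Section Width.
Variables (t : R) (L : nat).
Hypotheses (t0 : 0 < t) (t1 : t <= 1 / 8) (tL : 1 / (4 * t) <= L%:R).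

Let var_gt0 : 0 < occ_var t L.
Proof.
have := occ_var_ge t0 t1 tL; have : 0 < t ^+ 3 by rewrite exprn_gt0.
by move=> h1 h2; rewrite -(pmulr_rgt0 _ h1); lra.
Qed.

Lemma width_gt0 : 0 < width t L.
Proof. by rewrite invr_gt0 mulr_gt0 // sqrtr_gt0. Qed.

Lemma width_sqr : 4 * occ_var t L * width t L ^+ 2 = 1.
Proof.
rewrite /width exprVn exprMn sqr_sqrtr ?(ltW var_gt0) // -natrX divff //.
by rewrite gt_eqF // mulr_gt0.
Qed.

Lemma width_sqr_le : width t L ^+ 2 <= 8 * t ^+ 3.
Proof.
have h := occ_var_ge t0 t1 tL; have e := width_sqr.
have w0 : 0 <= width t L ^+ 2 by exact: sqr_ge0.
have := ler_wpM2l w0 h.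
have -> : width t L ^+ 2 * (t ^+ 3 * occ_var t L) =
  t ^+ 3 * (4 * occ_var t L * width t L ^+ 2) / 4 by field.
by rewrite e; lra.
Qed.

Lemma width_sqr_ge : t ^+ 3 <= 4 * 5 ^+ 5 * width t L ^+ 2.
Proof.
have h := occ_var_le L t0; have e := width_sqr.
have w0 : 0 <= width t L ^+ 2 by exact: sqr_ge0.
have := ler_wpM2l w0 h.
have -> : width t L ^+ 2 * (t ^+ 3 * occ_var t L) =
  t ^+ 3 * (4 * occ_var t L * width t L ^+ 2) / 4 by field.
by rewrite e; lra.
Qed.

Lemma normc_cis_sub1_le (y : R) : normc (1 - cis (- y)) <= `|y|.
Proof.
rewrite normcBC -(@ler_pXn2r _ 2) ?nnegrE ?normc_ge0 // normc_cis_sub1 cosN.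
rewrite -cos_norm; have := cos_ge_quadratic (normr_ge0 y); lra.
Qed.

Lemma normc_cis_sub1_le2 (y : R) : normc (1 - cis (- y)) <= 2.
Proof.
by apply: le_trans (ler_normcD _ _) _; rewrite normc_opp normc_cis normc1.
Qed.

Lemma normc_saddle N z m l u : normc (saddle_integrand t L N z m l u) =
  normc (cf_prod t L z (width t L * u)) *
  (normc (1 - cis (- (width t L * u))) / width t L) ^+ m.
Proof.
rewrite /saddle_integrand !normcM !normc_cis mul1r mulr1 normcX normcM normc_real.
by rewrite ger0_norm // invr_ge0 ltW // width_gt0.
Qed.

(** The rate is [w^2 / (128 t^3)], bounded below through [t^3 <= 4 * 5^5 w^2]; this majorant is
    independent of [t]. *)
Lemma saddle_major_le N m l u : `|u| <= t / width t L ->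
  normc (saddle_integrand t L N 1 m l u) <=
  `|u| ^+ m * expR (- (1 / (512 * 5 ^+ 5) * u ^+ 2)).
Proof.
move=> tu; have w0 := width_gt0.
have wu : `|width t L * u| <= t.
  by move: tu; rewrite ler_pdivlMr // normrM (gtr0_norm w0); lra.
rewrite normc_saddle mulrC; apply: ler_pM.
- by rewrite exprn_ge0 // divr_ge0 ?normc_ge0 // ltW.
- exact: normc_ge0.
- rewrite lerXn2r ?nnegrE ?divr_ge0 ?normc_ge0 ?(ltW w0) //.
  rewrite ler_pdivrMr //; apply: le_trans (normc_cis_sub1_le _) _.
  by rewrite normrM (gtr0_norm w0) mulrC.
apply: le_trans (cf_prod1_major t0 t1 tL wu) _; rewrite ler_expR lerN2.
have t3 : 0 < t ^+ 3 by rewrite exprn_gt0.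
rewrite ler_pdivlMr ?mulr_gt0 // exprMn.
have := width_sqr_ge; have := sqr_ge0 u.
set a := u ^+ 2; set b := width t L ^+ 2; set c := t ^+ 3 => a0 bc.
have -> : 1 / (512 * 5 ^+ 5) * a * (128 * c) = a * (c / (4 * 5 ^+ 5)) by field.
by rewrite mulrC ler_wpM2r // ler_pdivrMr; lra.
Qed.

(** The cost is [(1/w)^(m+1)]: [m] from the power and one from the length of the interval. As
    [t^3 / w] is bounded, [t^(3(m+1))] pays for it, and one factor [t] of [t^(3m+4)] is left to tend
    to 0. *)
Lemma saddle_tail_le N z m l u (C : R) :
  normc (cf_prod t L z (width t L * u)) <= C * t ^+ (3 * m + 4) ->
  normc (saddle_integrand t L N z m l u) * (4 * (pi / width t L)) <=
  4 * pi * 2 ^+ m * (4 * 5 ^+ 5) ^+ m.+1 * C * t.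
Proof.
move=> hC; have w0 := width_gt0; have w2 := width_sqr_ge; have w2' := width_sqr_le.
have p0 := pi_gt0 R.
have w1 : width t L <= 1.
  rewrite -(@ler_pXn2r _ 2) ?nnegrE ?(ltW w0) // expr1n; apply: le_trans w2' _.
  have : t ^+ 3 <= (1 / 8) ^+ 3 by rewrite lerXn2r ?nnegrE ?(ltW t0) //; lra.
  by lra.
have tw : t ^+ 3 / width t L <= 4 * 5 ^+ 5.
  rewrite ler_pdivrMr //; apply: le_trans w2 _.
  by rewrite ler_wpM2l // expr2 ler_piMr // ltW.
have C0 : 0 <= C.
  have : 0 <= C * t ^+ (3 * m + 4) by apply: le_trans hC; exact: normc_ge0.
  by rewrite pmulr_lge0 // exprn_gt0.
rewrite normc_saddle.
apply: (@le_trans _ _ (C * t ^+ (3 * m + 4) * (2 / width t L) ^+ m * (4 * (pi / width t L)))).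
  rewrite ler_wpM2r ?mulr_ge0 ?invr_ge0 ?(ltW w0) ?(ltW p0) //.
  apply: ler_pM => //; first exact: normc_ge0.
    by rewrite exprn_ge0 // divr_ge0 ?normc_ge0 // ltW.
  rewrite lerXn2r ?nnegrE ?divr_ge0 ?normc_ge0 ?(ltW w0) //.
  by rewrite ler_wpM2r ?invr_ge0 ?(ltW w0) // normc_cis_sub1_le2.
have -> : C * t ^+ (3 * m + 4) * (2 / width t L) ^+ m * (4 * (pi / width t L)) =
    4 * pi * 2 ^+ m * C * t * (t ^+ 3 / width t L) ^+ m.+1.
  have -> : t ^+ (3 * m + 4) = t * (t ^+ 3) ^+ m.+1.
    by rewrite -exprM -exprS mulnS addnC.
  by rewrite !expr_div_n !exprS; field; rewrite expf_neq0 ?gt_eqF.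
have -> : 4 * pi * 2 ^+ m * (4 * 5 ^+ 5) ^+ m.+1 * C * t =
    4 * pi * 2 ^+ m * C * t * (4 * 5 ^+ 5) ^+ m.+1 by ring.
rewrite ler_wpM2l //.
  by rewrite !mulr_ge0 ?exprn_ge0 ?(ltW p0) ?(ltW t0).
by rewrite lerXn2r ?nnegrE ?divr_ge0 ?exprn_ge0 ?(ltW w0) ?(ltW t0).
Qed.

End Width.

End SaddleIntegrand.

(** * Limits of the saddle integrals *)

Section SaddleLimits.
Variable R : realType.
Notation mu := (@lebesgue_measure R).
Variable tf : nat -> R.
Hypothesis tf_ge : forall N, (0 < N)%N -> 2 / (N%:R + 2) <= tf N.
Hypothesis tf_sum : forall N, (0 < N)%N ->
  \sum_(1 <= k < (N.*2).+1) 2 * k%:R * occ (tf N) k = N%:R.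
Let w N := width (tf N) N.*2.
Let F N z m l := saddle_integrand (tf N) N.*2 N z m l.

Lemma tf_gt0 N : (0 < N)%N -> 0 < tf N.
Proof. by move=> N0; apply: lt_le_trans (tf_ge N0); rewrite divr_gt0 // ltr_wpDl. Qed.

(** Smallness comes from [saddle_var_ge]. The lower bound on [tf] ensures that the truncation [2N]
    reaches [1/(4t)]. *)
Lemma tf_eventually (a : R) : 0 < a -> \forall N \near \oo,
  [/\ (0 < N)%N, 0 < tf N, tf N <= a & 1 / (4 * tf N) <= N.*2%:R].
Proof.
move=> a0; have /cvgryPgt /(_ (2 * 5 ^+ 5 / a ^+ 3)) := @cvgr_idn R.
have := nbhs_infty_gt 0; apply: filterS2 => N N0 Na.
have t0 := tf_gt0 N0; split => //.
  rewrite leNgt; apply/negP => ta.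
  have := saddle_var_ge t0 (tf_sum N0).
  have a3 : 0 < a ^+ 3 by rewrite exprn_gt0.
  have : a ^+ 3 <= tf N ^+ 3 by rewrite lerXn2r ?nnegrE // ltW.
  move: Na; rewrite ltr_pdivrMr // => Na h h2.
  have := ler_wpM2l (ler0n R N) h; lra.
have NR : (1 : R) <= N%:R by rewrite ler1n.
have e : N.*2%:R = 2 * N%:R :> R by rewrite -muln2 natrM mulrC.
have := tf_ge N0; rewrite e ler_pdivrMr ?mulr_gt0 // ler_pdivrMr; last by lra.
move=> h; have : (N%:R + 2) * tf N <= 3 * N%:R * tf N by rewrite ler_wpM2r ?(ltW t0) //; lra.
by lra.
Qed.

Lemma tf_cvg0 : tf @ \oo --> (0 : R).
Proof.
apply/cvgrPdist_le => e e0; have := tf_eventually e0; apply: filterS => N [_ t0 te _].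
by rewrite sub0r normrN gtr0_norm.
Qed.

Let cvg0_tf (C : R) : (fun N => C * tf N) @ \oo --> (0 : R).
Proof.
by rewrite -[X in _ --> X](mulr0 C); apply: cvgM; [exact: cvg_cst|exact: tf_cvg0].
Qed.

Let t8 : 0 < 1 / 8 :> R. Proof. by lra. Qed.
Let t16 : 0 < 1 / 16 :> R. Proof. by lra. Qed.

Lemma width_cvg0 : w @ \oo --> (0 : R).
Proof.
apply: cvg0_sqr; apply: (@cvg0_le _ _ (fun N => 8 * tf N)); last exact: cvg0_tf.
have := tf_eventually t8; apply: filterS => N [_ t0 t1 tL].
rewrite sqr_ge0 (le_trans (width_sqr_le t0 t1 tL)) //.
by rewrite ler_wpM2l // !exprS expr0; nra.
Qed.

Lemma saddle_cint_neq1 z m l : normc z = 1 -> z != 1 ->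
  (fun N => normc (cint (pi / w N) (F N z m l))) @ \oo --> (0 : R).
Proof.
move=> z1 zn1; pose M := (3 * m + 4)%N.
pose D : R := (16 * M%:R ^+ 2 * (4 * M%:R + 1) ^+ 2 / normc (z - 1) ^+ 2) ^+ M.
(* The available bound is on the square of the norm, and [D <= (1 + D)^2] allows a root to be
   taken. *)
pose C := 1 + D.
have D0 : 0 <= D.
  by rewrite exprn_ge0 // divr_ge0 ?sqr_ge0 // mulr_ge0 ?sqr_ge0 // mulr_ge0 ?sqr_ge0.
pose K := 4 * pi * 2 ^+ m * (4 * 5 ^+ 5) ^+ m.+1 * C : R.
apply: (@cvg0_le _ _ (fun N => K * tf N)); last exact: cvg0_tf.
have M0 : 0 < M.*2%:R :> R by rewrite ltr0n /M; lia.
have a0 : 0 < 1 / (2 * M.*2%:R) :> R by rewrite divr_gt0 // mulr_gt0.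
have := nbhs_infty_ge M; have := tf_eventually a0; have := tf_eventually t8.
apply: filterS3 => N [_ t0 t1 tL] [_ _ ta _] MN.
have Mt : M.*2%:R * tf N <= 1 / 2.
  by move: ta; rewrite ler_pdivlMr ?mulr_gt0 //; lra.
have w0 := width_gt0 t0 t1 tL.
have B0 : 0 < 4 * (pi / w N) by rewrite mulr_gt0 // divr_gt0 // pi_gt0.
rewrite normc_ge0 /=.
rewrite -[leRHS](divfK (lt0r_neq0 B0)); apply: normc_cint_le.
- by rewrite divr_ge0 ?pi_ge0 // ltW.
- exact: ccont_saddle.
move=> u _; rewrite ler_pdivlMr //; apply: saddle_tail_le => //.
rewrite -(@ler_pXn2r _ 2) ?nnegrE ?normc_ge0 //; last first.
  by rewrite mulr_ge0 ?exprn_ge0 ?(ltW t0) // addr_ge0.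
apply: (le_trans (@cf_prod_neq1 _ (tf N) N.*2 M z _ t0 z1 zn1 _ Mt)).
  by rewrite leq_double.
rewrite -/D [leRHS]exprMn [(tf N ^+ 2) ^+ M]exprAC ler_wpM2r ?sqr_ge0 //.
by rewrite /C; nra.
Qed.

Let pointwise m l u :
  ccvg (fun N => F N 1 m l u) ('i%C ^+ m * (gauss_pow m u)%:C).
Proof.
have wu0 (a : R) : (fun N => a * w N) @ \oo --> (0 : R).
  by rewrite -[X in _ --> X](mulr0 a); apply: cvgM; [exact: cvg_cst|exact: width_cvg0].
have -> : 'i%C ^+ m * (gauss_pow m u)%:C =
    (expR (- (1 / 4 * u ^+ 2)))%:C * ('i%C * u%:C) ^+ m * 1.
  by rewrite /gauss_pow exprMn rmorphM rmorphXn mulr1; ring.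
apply: ccvgM; last first.
  apply: (@ccvg_le _ _ _ (fun N => (l%:R * `|u|) * w N)); last exact: wu0.
  have := tf_eventually t8; apply: filterS => N [_ t0 t1 tL].
  rewrite normcBC; apply: le_trans (normc_cis_sub1_le _) _.
  have w0 := width_gt0 t0 t1 tL.
  by rewrite !normrM normr_nat (gtr0_norm w0) mulrCA mulrC.
apply: ccvgM.
  apply: (@ccvg_le _ _ _ (fun N => 40 * (occ_third (tf N) N.*2 * `|w N * u| ^+ 3))).
    have := tf_eventually t8; apply: filterS => N [N0 t0 t1 tL].
    have e : occ_var (tf N) N.*2 * (w N * u) ^+ 2 = 1 / 4 * u ^+ 2.
      by rewrite exprMn mulrA; have := width_sqr t0 t1 tL; rewrite -/(w N) => h; congr (_ * _); lra.
    by rewrite -e; exact: cf_prod_gauss t0 (tf_sum N0).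
  (* Squaring avoids half-integral powers: [w^6 <= 512 t^9] against [(t^4 T)^2 <= 5^10] leaves one
     factor [t]. *)
  apply: cvg0_sqr.
  apply: (@cvg0_le _ _ (fun N => (1600 * (5 ^+ 5) ^+ 2 * 512 * u ^+ 6) * tf N)); last exact: cvg0_tf.
  have := tf_eventually t8; apply: filterS => N [N0 t0 t1 tL]; rewrite sqr_ge0 andTb.
  have h3 := occ_third_le N.*2 t0; have h2 := width_sqr_le t0 t1 tL.
  set T := occ_third _ _ in h3 *; set t := tf N in t0 h3 h2 *.
  have T0 : 0 <= T.
    rewrite /T /occ_third sumr_ge0 // => k _; have := occ_ge0 k t0 => p0.
    by rewrite mulr_ge0 ?exprn_ge0 // mulr_ge0 ?sqr_ge0.
  have -> : (40 * (T * `|w N * u| ^+ 3)) ^+ 2 = 1600 * T ^+ 2 * ((w N ^+ 2) ^+ 3 * u ^+ 6).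
    have : `|w N * u| ^+ 2 = (w N * u) ^+ 2 by rewrite real_normK ?num_real.
    set a := `|_| => ea.
    have -> : (40 * (T * a ^+ 3)) ^+ 2 = 1600 * T ^+ 2 * (a ^+ 2) ^+ 3 by ring.
    by rewrite ea; ring.
  have u6 : 0 <= u ^+ 6 by rewrite -[6%N]/(2 * 3)%N exprM exprn_ge0 // sqr_ge0.
  have t3 : 0 <= t ^+ 3 by apply: exprn_ge0; exact: ltW.
  have hw : (w N ^+ 2) ^+ 3 <= (8 * t ^+ 3) ^+ 3.
    by apply: lerXn2r => //; rewrite nnegrE ?sqr_ge0 // mulr_ge0.
  move: h3; set c : R := 5 ^+ 5; move=> h3.
  have hT : (t ^+ 4 * T) ^+ 2 <= c ^+ 2.
    have tT : 0 <= t ^+ 4 * T by apply: mulr_ge0 => //; apply: exprn_ge0; exact: ltW.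
    by apply: lerXn2r; [rewrite nnegrE|rewrite nnegrE (le_trans tT)|].
  have A0 : 0 <= 1600 * T ^+ 2 by apply: mulr_ge0 (ler0n _ _) (sqr_ge0 _).
  have E0 : 0 <= 1600 * 512 * u ^+ 6 * t.
    by apply: mulr_ge0 (ltW t0); apply: mulr_ge0 u6; apply: mulr_ge0 (ler0n _ _) (ler0n _ _).
  apply: le_trans (ler_wpM2l A0 (ler_wpM2r u6 hw)) _.
  have -> : 1600 * T ^+ 2 * ((8 * t ^+ 3) ^+ 3 * u ^+ 6) =
    (1600 * 512 * u ^+ 6 * t) * (t ^+ 4 * T) ^+ 2 by ring.
  have -> : 1600 * c ^+ 2 * 512 * u ^+ 6 * t =
    (1600 * 512 * u ^+ 6 * t) * c ^+ 2 by ring.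
  exact: ler_wpM2l E0 _ _ hT.
apply: ccvgX.
apply: (@ccvg_le _ _ _ (fun N => (u ^+ 2 / 2 + 2 * `|u| ^+ 3) * w N)); last exact: wu0.
have := tf_eventually t8; apply: filterS => N [N0 t0 t1 tL].
have w0 : 0 < w N := width_gt0 t0 t1 tL.
have w1 : w N <= 1.
  rewrite -(@ler_pXn2r _ 2) ?nnegrE ?(ltW w0) // expr1n.
  apply: le_trans (width_sqr_le t0 t1 tL) _.
  have : tf N ^+ 3 <= (1 / 8) ^+ 3 by rewrite lerXn2r ?nnegrE ?(ltW t0) //; lra.
  by lra.
have := cis_quadratic_error (- (w N * u)).
rewrite -/(w N); set E := cis _ - _ => hE.
have wC : (w N)%:C != 0 :> R[i] by rewrite -normc_eq0 normc_real normr_eq0 gt_eqF.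
have -> : (1 - cis (- (w N * u))) * (w N)^-1%:C - 'i%C * u%:C =
    (w N * (u ^+ 2 / 2))%:C - E * (w N)^-1%:C.
  have eC : cis (- (w N * u)) = E + (1 - ((- (w N * u)) ^+ 2 / 2)%:C + 'i%C * (- (w N * u))%:C).
    by rewrite /E subrK.
  rewrite eC.
  have -> : ((- (w N * u)) ^+ 2 / 2)%:C = (w N)%:C * (w N * (u ^+ 2 / 2))%:C :> R[i].
    by rewrite -rmorphM /=; congr (_%:C); field.
  have -> : (- (w N * u))%:C = - ((w N)%:C * u%:C) :> R[i] by rewrite rmorphN rmorphM.
  have -> : ((w N)^-1)%:C = ((w N)%:C)^-1 :> R[i] by exact: (fmorphV (real_complex R)).
  set W := (w N)%:C in wC *; set V := (_ * (_ / _))%:C.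
  by field.
apply: le_trans (ler_normcD _ _) _; rewrite normc_opp normcM !normc_real.
have hV : `|w N * (u ^+ 2 / 2)| = w N * (u ^+ 2 / 2).
  by rewrite ger0_norm // mulr_ge0 ?(ltW w0) // divr_ge0 ?sqr_ge0.
rewrite hV ger0_norm ?invr_ge0 ?(ltW w0) // mulrDl; apply: lerD; first by rewrite mulrC.
rewrite ler_pdivrMr //; apply: le_trans hE _.
rewrite normrN normrM (gtr0_norm w0) exprMn.
have -> : 2 * `|u| ^+ 3 * w N * w N = 2 * (w N ^+ 2 * `|u| ^+ 3) by ring.
rewrite ler_wpM2l // ler_wpM2r ?exprn_ge0 // exprSr ler_piMr ?sqr_ge0 //.
Qed.

Lemma saddle_cint_eq1 m l :
  (fun N => complex.Re (cint (pi / w N) (F N 1 m l))) @ \oo -->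
  complex.Re ('i%C ^+ m : R[i]) * gauss_moment R m.
Proof.
pose f N u := complex.Re (F N 1 m l u).
(* [P] is the half-turn [theta = pi], and [Q] the end [theta = t] of the range with a Gaussian
   majorant; [Q] tends to infinity like [t^(-1/2)]. *)
pose P N := pi / w N; pose Q N := tf N / w N.
have core : (fun N => \int[mu]_(u in `[(- Q N), Q N]) f N u) @ \oo -->
    complex.Re ('i%C ^+ m : R[i]) * gauss_moment R m.
  (* The sequence is shifted because dominated convergence asks for the majorant at every index, and
     it holds from [n0] on. *)
  have [n0 _ hn0] := tf_eventually t8.
  rewrite -(cvg_shiftn n0).
  have c0 : 0 < 1 / (512 * 5 ^+ 5) :> R.
    by apply: divr_gt0 ltr01 _; apply: mulr_gt0; [|apply: exprn_gt0]; rewrite ltr0n.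
  have [C C0 hC] := pow_expR_sqr_le m c0.
  have c1 : 0 < 1 / (512 * 5 ^+ 5) / 2 :> R by apply: divr_gt0 c0 _; rewrite ltr0n.
  have -> : complex.Re ('i%C ^+ m : R[i]) * gauss_moment R m =
      \int[mu]_u (complex.Re ('i%C ^+ m : R[i]) * gauss_pow m u).
    by rewrite RintegralZl //; exact: integrable_gauss_pow.
  have ok n : [/\ (0 < n + n0)%N, 0 < tf (n + n0), tf (n + n0) <= 1 / 8 &
      1 / (4 * tf (n + n0)) <= (n + n0).*2%:R].
    by apply: hn0; rewrite /= leq_addl.
  apply: (@gauss_dominated _ _ C (fun n => f (n + n0)%N) _ (fun n => Q (n + n0)%N) c1 _ _ _ _ _).2.
  - by move=> n; have [_ t0 _ _] := ok n; have [] := ccont_saddle (n + n0).*2 (n + n0) m l t0 (normc1 R).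
  - by move=> u; apply: cvgM; [exact: cvg_cst|exact: continuous_gauss_pow].
  - move=> u; rewrite (cvg_shiftn n0 (fun N => f N u)).
    have := ccvg_Re (pointwise m l u).
    by rewrite (mulrC ('i%C ^+ m)) complex_ReMr mulrC.
  - rewrite (cvg_shiftn n0 Q); apply/cvgryPge => A.
    have [A0|A0] := leP A 0.
      have := tf_eventually t8; apply: filterS => N [_ t0 t1 tL].
      by apply: le_trans A0 _; rewrite divr_ge0 // ltW // (width_gt0 t0 t1 tL).
    have a0 : 0 < 1 / (8 * A ^+ 2) by rewrite divr_gt0 // mulr_gt0 // exprn_gt0.
    have := tf_eventually a0; have := tf_eventually t8.
    apply: filterS2 => N [_ t0 t1 tL] [_ _ ta _]; have w0 := width_gt0 t0 t1 tL.
    rewrite /Q ler_pdivlMr // -(@ler_pXn2r _ 2) ?nnegrE ?mulr_ge0 ?(ltW A0) ?(ltW w0) ?(ltW t0) //.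
    rewrite exprMn; apply: le_trans (ler_wpM2l (sqr_ge0 A) (width_sqr_le t0 t1 tL)) _.
    move: ta; rewrite ler_pdivlMr ?mulr_gt0 ?exprn_gt0 // => ta.
    have -> : A ^+ 2 * (8 * tf N ^+ 3) = tf N ^+ 2 * (tf N * (8 * A ^+ 2)) by ring.
    by rewrite ler_piMr // sqr_ge0.
  - move=> n u hu; have [_ t0 t1 tL] := ok n.
    apply: le_trans (ler_Re_normc _) _.
    by apply: le_trans (saddle_major_le t0 t1 tL _ _ _ hu) (hC u).
(* The middle range yields the exponent [M'.+1] and the far range [M]; both must be [3m + 4]. [C]
   adds the two constants. *)
pose M := (3 * m + 4)%N; pose M' := (3 * m + 3)%N.
have eM : M'.+1 = M by rewrite /M' -addnS.
pose C : R := (128 * M'.+1.*2%:R) ^+ M'.+1.*2 + (128 * M%:R ^+ 2) ^+ M.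
pose K := 4 * pi * 2 ^+ m * (4 * 5 ^+ 5) ^+ m.+1 * C : R.
have C1 : 0 <= (128 * M'.+1.*2%:R) ^+ M'.+1.*2 :> R by rewrite exprn_ge0 // mulr_ge0.
have C2 : 0 <= (128 * M%:R ^+ 2) ^+ M :> R by rewrite exprn_ge0 // mulr_ge0 // sqr_ge0.
have diff : (fun N => complex.Re (cint (pi / w N) (F N 1 m l)) -
    \int[mu]_(u in `[(- Q N), Q N]) f N u) @ \oo --> (0 : R).
  apply/norm_cvg0P; apply: (@cvg0_le _ _ (fun N => K * tf N)); last exact: cvg0_tf.
  have M0 : 0 < M.*2%:R :> R by rewrite ltr0n /M; lia.
  have a0 : 0 < 1 / (2 * M.*2%:R) :> R by rewrite divr_gt0 // mulr_gt0.
  have := nbhs_infty_ge M; have := tf_eventually a0; have := tf_eventually t16.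
  apply: filterS3 => N [_ t0 t1 tL] [_ _ ta _] MN; rewrite normr_ge0 andTb.
  have t1' : tf N <= 1 / 8 by lra.
  have Mt : M.*2%:R * tf N <= 1 / 2.
    by move: ta; rewrite ler_pdivlMr ?mulr_gt0 //; lra.
  have w0 := width_gt0 t0 t1' tL.
  have p2 := pi_ge2 R.
  have B0 : 0 < 4 * (pi / w N) by rewrite mulr_gt0 // divr_gt0 // pi_gt0.
  have K0 : 0 <= K by rewrite /K !mulr_ge0 ?exprn_ge0 ?pi_ge0 // addr_ge0.
  have Kt0 : 0 <= K * tf N by rewrite mulr_ge0 // ltW.
  apply: (@le_trans _ _ (K * tf N / (4 * (pi / w N)) * (2 * (pi / w N)))); last first.
    have half (x y c : R) : 0 < x -> 0 < y -> c / (4 * (x / y)) * (2 * (x / y)) = c / 2.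
      by move=> x0 y0; field; rewrite !gt_eqF.
    rewrite (half _ (w N) _ (pi_gt0 R) w0); lra.
  apply: Rintegral_core.
  - by rewrite divr_ge0 // ltW.
  - by rewrite ler_wpM2r ?invr_ge0 ?(ltW w0) //; lra.
  - by rewrite divr_ge0 // ltW.
  - by have [] := ccont_saddle N.*2 N m l t0 (normc1 R).
  move=> u Qu uP; apply: le_trans (ler_Re_normc _) _.
  rewrite ler_pdivlMr //; apply: saddle_tail_le => //.
  have nu : `|w N * u| = w N * `|u| by rewrite normrM gtr0_norm.
  have h1 : tf N <= `|w N * u| by move: Qu; rewrite nu ler_pdivrMr // mulrC.
  have h2 : `|w N * u| <= pi by move: uP; rewrite nu ler_pdivlMr // mulrC.
  have tM : 0 <= tf N ^+ M by rewrite exprn_ge0 // ltW.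
  have [h|h] := leP `|w N * u| (Num.sqrt (tf N)).
    apply: le_trans (cf_prod1_middle M' t0 t1 tL h1 h) _.
    have -> : tf N ^+ M'.+1 = tf N ^+ M by rewrite eM.
    by apply: (ler_wpM2r tM); rewrite /C lerDl.
  apply: le_trans (@cf_prod1_far _ (tf N) N.*2 M _ t0 t1 _ Mt (ltW h) h2) _.
    by rewrite leq_double.
  by apply: (ler_wpM2r tM); rewrite /C lerDr.
rewrite [X in X @ _ --> _](_ : _ = (fun N => (complex.Re (cint (pi / w N) (F N 1 m l)) -
    \int[mu]_(u in `[(- Q N), Q N]) f N u) + \int[mu]_(u in `[(- Q N), Q N]) f N u)).
  by rewrite -[X in _ --> X]add0r; exact: cvgD.
by apply/funext => N; rewrite subrK.
Qed.

End SaddleLimits.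

(** * Hermite polynomials *)

Section Hermite.
Variable R : realType.
Implicit Types (x y : R) (d m k : nat).

(* [hermite_moment m] is [E ((iU)^m)] for a centred Gaussian [U] of variance 2. *)
Fixpoint hermite_moment_pair m : R * R :=
  if m is m'.+1 then
    let p := hermite_moment_pair m' in (p.2, - 2 * m'.+1%:R * p.1)
  else (1, 0).
Definition hermite_moment m : R := (hermite_moment_pair m).1.

Lemma hermite_momentSS m : hermite_moment m.+2 = - 2 * m.+1%:R * hermite_moment m.
Proof. by []. Qed.

(** Both sides satisfy the same two-step recurrence, the sign coming from [i^(m+2) = - i^m]. *)
Lemma hermite_moment_gauss m :
  complex.Re ('i%C ^+ m : R[i]) * gauss_moment R m =
  hermite_moment m * gauss_moment R 0.
Proof.
have [h1 h2] : complex.Re ('i%C ^+ m : R[i]) * gauss_moment R m =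
    hermite_moment m * gauss_moment R 0 /\
  complex.Re ('i%C ^+ m.+1 : R[i]) * gauss_moment R m.+1 =
    hermite_moment m.+1 * gauss_moment R 0; last exact: h1.
elim: m => [|m [IH1 IH2]]; first by rewrite gauss_moment1 mulr0 mul0r.
split => //; rewrite hermite_momentSS gauss_momentSS.
have -> : 'i%C ^+ m.+2 = - 'i%C ^+ m :> R[i].
  by rewrite 2!exprSr -mulrA -expr2 sqr_i mulrN1.
have ReN (z : R[i]) : complex.Re (- z) = - complex.Re z by case: z.
rewrite ReN; transitivity (- (2 * m.+1%:R * (complex.Re ('i%C ^+ m : R[i]) * gauss_moment R m))).
  by ring.
by rewrite IH1; ring.
Qed.

Definition hermite_poly d : {poly R} :=
  \poly_(i < d.+1) ('C(d, i)%:R * hermite_moment (d - i)).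

Lemma hermite_polyE d x :
  (hermite_poly d).[x] = \sum_(m < d.+1) 'C(d, m)%:R * hermite_moment m * x ^+ (d - m).
Proof.
rewrite horner_poly (reindex_inj rev_ord_inj) /=; apply: eq_bigr => i _.
by have id : (i <= d)%N := ltn_ord i; rewrite subSS subKn // bin_sub.
Qed.

Lemma hermite_momentE k : hermite_moment k.*2 = (-1) ^+ k * (k.*2`! %/ k`!)%:R /\
  hermite_moment k.*2.+1 = 0.
Proof.
elim: k => [|k [IH1 IH2]]; first by rewrite divn1 mul1r.
rewrite !doubleS !hermite_momentSS IH1 IH2 mulr0; split => //.
have dv n : (n`! %| n.*2`!)%N.
  by rewrite -addnn -(bin_fact (leq_addr n n)) addnK dvdn_mull // dvdn_mull.
have -> : (k.*2.+2`! %/ k.+1`! = 2 * (k.*2.+1 * (k.*2`! %/ k`!)))%N.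
  apply/eqP; rewrite -(eqn_pmul2r (fact_gt0 k.+1)) -doubleS divnK // doubleS.
  rewrite !factS -[in X in _ == X](divnK (dv k)) mulnK ?fact_gt0 //.
  by apply/eqP; rewrite -[(k.*2`! %/ k`!)%N]/(_) -{1}(divnK (dv k)); lia.
by rewrite exprS !natrM; ring.
Qed.

Lemma hermiteE d x : hermite d x = (hermite_poly d).[x].
Proof.
rewrite hermite_polyE /hermite.
rewrite -(big_mkord xpredT (fun m => 'C(d, m)%:R * hermite_moment m * x ^+ (d - m))).
rewrite -(big_mkord xpredT (fun k => (-1) ^+ k * (d`! %/ (k`! * (d - k.*2)`!))%:R * x ^+ (d - k.*2))).
have half n : \sum_(0 <= m < n.*2) 'C(d, m)%:R * hermite_moment m * x ^+ (d - m) =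
    \sum_(0 <= k < n) 'C(d, k.*2)%:R * hermite_moment k.*2 * x ^+ (d - k.*2).
  elim: n => [|n IH]; first by rewrite !big_geq.
  rewrite doubleS 3?big_nat_recr //= IH.
  by rewrite (hermite_momentE n).2 mulr0 mul0r addr0.
(* The range is completed to an even number of terms so that odd moments drop out in pairs; for even
   [d] the added binomial is 0. *)
have -> : \sum_(0 <= m < d.+1) 'C(d, m)%:R * hermite_moment m * x ^+ (d - m) =
    \sum_(0 <= m < (d./2).+1.*2) 'C(d, m)%:R * hermite_moment m * x ^+ (d - m).
  have := odd_double_half d; case: (odd d) => /= e.
    by rewrite (_ : (d./2).+1.*2 = d.+1) //; lia.
  rewrite (_ : (d./2).+1.*2 = d.+2); last by lia.
  by rewrite [in RHS]big_nat_recr //= bin_small // !mul0r addr0.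
rewrite half; apply: eq_big_nat => k /andP[_ kd].
rewrite (hermite_momentE k).1.
suff -> : (d`! %/ (k`! * (d - k.*2)`!) = 'C(d, k.*2) * (k.*2`! %/ k`!))%N.
  by rewrite natrM; ring.
have kd2 : (k.*2 <= d)%N by have := odd_double_half d; lia.
have dv n : (n`! %| n.*2`!)%N.
  by rewrite -addnn -(bin_fact (leq_addr n n)) addnK dvdn_mull // dvdn_mull.
have g : (0 < k`! * (d - k.*2)`!)%N by rewrite muln_gt0 !fact_gt0.
rewrite -(bin_fact kd2) -{1}(divnK (dv k)).
rewrite (_ : 'C(d, k.*2) * (k.*2`! %/ k`! * k`! * (d - k.*2)`!) =
  'C(d, k.*2) * (k.*2`! %/ k`!) * (k`! * (d - k.*2)`!))%N; last by ring.
by rewrite mulnK.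
Qed.

(** Pascal's rule splits the sum: one half is [x H_(d+1)], the other reduces to [H_d] by the moment
    recurrence and [(j+1) C(d+1, j+1) = (d+1) C(d, j)]. *)
Lemma hermite_polySS d x : (hermite_poly d.+2).[x] =
  x * (hermite_poly d.+1).[x] - 2 * d.+1%:R * (hermite_poly d).[x].
Proof.
rewrite !hermite_polyE big_ord_recl /= subn0.
rewrite (eq_bigr (fun i : 'I_d.+2 =>
    'C(d.+1, i.+1)%:R * hermite_moment i.+1 * x ^+ (d.+1 - i) +
    'C(d.+1, i)%:R * hermite_moment i.+1 * x ^+ (d.+1 - i))); last first.
  by move=> i _; rewrite /bump /= add1n subSS binS natrD; ring.
rewrite big_split /= addrA; congr (_ + _).
  rewrite big_ord_recr /= (bin_small (ltnSn _)) !mul0r addr0.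
  rewrite [in RHS]big_ord_recl /= subn0 mulrDr !bin0 mulr_sumr; congr (_ + _).
    by rewrite exprS; ring.
  apply: eq_bigr => i _; have id : (i <= d)%N := ltn_ord i.
  by rewrite /bump /= add1n subSS subSn // exprS; ring.
rewrite big_ord_recl /= mulr0 mul0r add0r -mulrN1 mulr_sumr mulr_suml.
apply: eq_bigr => j _; rewrite /bump /= add1n subSS hermite_momentSS.
have := mul_bin_diag d.+1 j => /(congr1 (fun n : nat => n%:R : R)).
rewrite !natrM /= => h.
transitivity (- 2 * (j.+1%:R * 'C(d.+1, j.+1)%:R) * hermite_moment j * x ^+ (d - j)); first by ring.
by rewrite -h; ring.
Qed.

End Hermite.

(** * Real roots from alternating signs *)

Section Hyperbolicity.
Variable R : realType.
Implicit Types (x y c : R) (d i j k : nat) (p : {poly R}).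

(** The factor [c] absorbs a normalisation of unspecified sign, here the one relating a Jensen
    polynomial to its rescaling. *)
Definition alternates p d (x : nat -> R) c : Prop :=
  (forall i, (i < d)%N -> x i < x i.+1) /\
  (forall i, (i <= d)%N -> 0 < c * (-1) ^+ (d - i) * p.[x i]).

Lemma alternating_roots p d (x : nat -> R) c : alternates p d x c -> exists r : nat -> R,
  [/\ forall i, (i < d)%N -> x i < r i < x i.+1,
      forall i, (i < d)%N -> root p (r i) &
      forall i j, (i < j)%N -> (j < d)%N -> r i < r j].
Proof.
move=> [xlt xsgn].
have /choice[r hr] : forall i, exists y, (i < d)%N -> x i < y < x i.+1 /\ root p y.
  move=> i; have [id|] := ltnP i d; last by exists 0.
  have neg : p.[x i] * p.[x i.+1] < 0.
    have h1 := xsgn i (ltnW id); have h2 := xsgn i.+1 id.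
    have := mulr_gt0 h1 h2; rewrite -(subnSK id) exprS.
    set s := (-1) ^+ (d - i.+1).
    have -> : c * (-1 * s) * p.[x i] * (c * s * p.[x i.+1]) =
       (c * s) ^+ 2 * - (p.[x i] * p.[x i.+1]) by ring.
    have := sqr_ge0 (c * s); rewrite le_eqVlt => /predU1P[<-|cs]; first by rewrite mul0r ltxx.
    by rewrite pmulr_rgt0 // oppr_gt0.
  have [y yI ry] := poly_ivtoo (ltW (xlt i id)) neg.
  by exists y => _; rewrite in_itv /= in yI.
have xle i j : (i <= j)%N -> (j <= d)%N -> x i <= x j.
  elim: j => [|j IH]; first by rewrite leqn0 => /eqP ->.
  rewrite leq_eqVlt => /predU1P[->//|ij] jd.
  by apply: le_trans (IH ij (ltnW jd)) _; exact/ltW/xlt.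
exists r; split => [i id|i id|i j ij jd]; [by have [] := hr i id|by have [] := hr i id|].
have [/andP[_ h1] _] := hr i (ltn_trans ij jd); have [/andP[h2 _] _] := hr j jd.
by apply: lt_trans h1 (le_lt_trans _ h2); apply: xle => //; exact: ltnW.
Qed.

(** [d] sign changes give [d] distinct real roots, as many as the size bound permits. *)
Lemma alternates_factor p d (x : nat -> R) c : (size p <= d.+1)%N -> alternates p d x c ->
  exists r : nat -> R,
  [/\ forall i, (i < d)%N -> x i < r i < x i.+1,
      forall i j, (i < j)%N -> (j < d)%N -> r i < r j &
      p = lead_coef p *: \prod_(i < d) ('X - (r i)%:P)].
Proof.
move=> sp alt; have [r [h1 h2 h3]] := alternating_roots alt; exists r; split => //.
have p0 : p != 0.
  by apply: contraTneq isT => p0; have := alt.2 0%N isT; rewrite p0 horner0 mulr0 ltxx.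
pose rs := [seq r i | i <- iota 0 d].
have urs : uniq rs.
  rewrite map_inj_in_uniq ?iota_uniq // => i j; rewrite !mem_iota !add0n => /andP[_ id] /andP[_ jd] e.
  by have [ij|ij|//] := ltngtP i j; [have := h3 i j ij jd|have := h3 j i ij id]; rewrite e ltxx.
have rrs : all (root p) rs.
  by rewrite all_map; apply/allP => i; rewrite mem_iota add0n => /andP[_ id] /=; exact: h2.
have srs : size rs = d by rewrite size_map size_iota.
have szp : size p = (size rs).+1.
  by apply/eqP; rewrite eqn_leq srs sp /= -srs max_poly_roots.
have -> : \prod_(i < d) ('X - (r i)%:P) = \prod_(y <- rs) ('X - y%:P).
  by rewrite big_map -(big_mkord xpredT (fun i => 'X - (r i)%:P)) /index_iota subn0.
by apply: all_roots_prod_XsubC => //; rewrite uniq_rootsE.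
Qed.

Lemma alternates_hyperbolic p d (x : nat -> R) c : (size p <= d.+1)%N ->
  alternates p d x c -> hyperbolic p.
Proof.
move=> sp alt z; have [r [_ _ e]] := alternates_factor sp alt.
have lc0 : lead_coef p != 0.
  rewrite lead_coef_eq0.
  by apply: contraTneq isT => p0; have := alt.2 0%N isT; rewrite p0 horner0 mulr0 ltxx.
rewrite -[map_poly _ _]/(map_poly (real_complex R) _) e map_polyZ rmorph_prod /=.
rewrite rootZ ?fmorph_eq0 // rootE horner_prod => /prodf_eq0[i _].
by rewrite map_polyXsubC hornerXsubC subr_eq0 => /eqP ->.
Qed.

Lemma sign_prod_sub d (s : nat -> R) y k : (k <= d)%N ->
  (forall i, (i < k)%N -> s i < y) -> (forall i, (k <= i)%N -> (i < d)%N -> y < s i) ->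
  0 < (-1) ^+ (d - k) * \prod_(i < d) (y - s i).
Proof.
elim: d => [|d IH].
  by rewrite leqn0 => /eqP -> _ _; rewrite big_ord0 mulr1 expr0 ltr01.
rewrite leq_eqVlt => /predU1P[-> lo _|kd lo hi].
  by rewrite subnn expr0 mul1r; apply: prodr_gt0 => i _; rewrite subr_gt0 lo.
rewrite big_ord_recr /= subSn // exprS.
have : 0 < (-1) ^+ (d - k) * \prod_(i < d) (y - s i).
  by apply: IH => // i ki id; apply: hi => //; exact: ltnW.
have : 0 < s d - y by rewrite subr_gt0 hi.
by move=> h1 h2; have := mulr_gt0 h2 h1; congr (0 < _); ring.
Qed.

Lemma size_hermite_poly d : size (hermite_poly R d) = d.+1.
Proof. by rewrite size_poly_eq // binn subnn mul1r oner_neq0. Qed.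

Lemma lead_coef_hermite_poly d : lead_coef (hermite_poly R d) = 1.
Proof. by rewrite lead_coef_poly ?binn ?subnn ?mul1r // oner_neq0. Qed.

Lemma hermite_poly0 x : (hermite_poly R 0).[x] = 1.
Proof. by rewrite hermite_polyE big_ord1 bin0 expr0 !mulr1. Qed.

Lemma hermite_poly1 x : (hermite_poly R 1).[x] = x.
Proof.
by rewrite hermite_polyE !big_ord_recl big_ord0 /= bin0 subn0 expr1 /hermite_moment /=; ring.
Qed.

Lemma hermite_polyN d x : (hermite_poly R d).[- x] = (-1) ^+ d * (hermite_poly R d).[x].
Proof.
have [] : (hermite_poly R d).[- x] = (-1) ^+ d * (hermite_poly R d).[x] /\
  (hermite_poly R d.+1).[- x] = (-1) ^+ d.+1 * (hermite_poly R d.+1).[x]; last by [].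
elim: d => [|d [IH1 IH2]].
  by rewrite !hermite_poly0 !hermite_poly1 expr0 expr1 mulN1r mul1r.
by split => //; rewrite !hermite_polySS IH1 IH2 !exprS; ring.
Qed.

Let interlaced d (s : nat -> R) : Prop :=
  [/\ forall i j, (i < j)%N -> (j < d.+1)%N -> s i < s j,
      forall x, (hermite_poly R d.+1).[x] = \prod_(i < d.+1) (x - s i) &
      forall i, (i < d.+1)%N -> 0 < (-1) ^+ (d - i) * (hermite_poly R d).[s i]].

(* At a root of [H_(d+1)] the recurrence gives [H_(d+2) = -2(d+1) H_d], so the
   roots of consecutive Hermite polynomials interlace. *)
Let interlaced_alternates d s : interlaced d s ->
  exists2 x : nat -> R, alternates (hermite_poly R d.+2) d.+2 x 1 &
    forall i, (i < d.+1)%N -> x i.+1 = s i.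
Proof.
move=> [slt sE ssgn].
have [n hn] : exists n, forall x, x >= n -> (hermite_poly R d.+2).[x] >= 1.
  by have := @poly_pinfty_gt_lc _ (hermite_poly R d.+2); rewrite lead_coef_hermite_poly; apply.
(* Beyond all roots and large enough for a positive value at [b]; parity then gives the sign at
   [- b]. *)
pose b := Num.max n (Num.max (s d + 1) (1 - s 0)).
have nb : n <= b by rewrite le_max lexx.
have sb : s d < b by rewrite !lt_max; apply/or3P; apply: Or32; rewrite ltrDl.
have sa : - b < s 0.
  by rewrite ltrNl !lt_max; apply/or3P; apply: Or33; rewrite ltrDr.
pose x i := if i is i'.+1 then if (i' < d.+1)%N then s i' else b else - b.
exists x; last by move=> i id; rewrite /x id.
split.
  case=> [|i] id; first by [].
  rewrite /x; have i1 : (i < d.+1)%N by lia.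
  rewrite i1; case: ltnP => [i2|i2]; first exact: slt.
  by have -> : i = d by lia.
case=> [|i] id; rewrite mul1r.
  rewrite subn0 hermite_polyN mulrA -exprD addnn -mul2n exprM sqrrN expr1n expr1n mul1r.
  exact: lt_le_trans ltr01 (hn _ nb).
rewrite /x; case: ltnP => [i1|i1]; last first.
  have -> : i = d.+1 by lia.
  rewrite subnn expr0 mul1r; exact: lt_le_trans ltr01 (hn _ nb).
have z : (hermite_poly R d.+1).[s i] = 0.
  by rewrite sE (bigD1 (Ordinal i1)) //= subrr mul0r.
rewrite hermite_polySS z mulr0 sub0r.
have := ssgn i i1; rewrite subSS subSn; last by lia.
rewrite exprS => h.
have -> : -1 * (-1) ^+ (d - i) * - (2 * d.+1%:R * (hermite_poly R d).[s i]) =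
  2 * d.+1%:R * ((-1) ^+ (d - i) * (hermite_poly R d).[s i]) by ring.
by rewrite mulr_gt0 // mulr_gt0.
Qed.

(** The new roots lie one in each gap of the old ones, the two unbounded gaps included. This fixes
    the sign of the previous polynomial at each of them and restarts the induction. *)
Let hermite_interlaced d : exists s, interlaced d s.
Proof.
elim: d => [|d [s hs]].
  exists (fun=> 0); split => [i j ij j1|x|i _].
  - by move: ij j1; case: i; case: j => // -[].
  - by rewrite hermite_poly1 big_ord1 subr0.
  - by rewrite sub0n hermite_poly0 mulr1 ltr01.
have [x alt xs] := interlaced_alternates hs.
have sz : (size (hermite_poly R d.+2) <= d.+3)%N by rewrite size_hermite_poly.
have [r [h1 h2 h3]] := alternates_factor sz alt.
exists r; split => // [y|i id].
  by rewrite h3 lead_coef_hermite_poly scale1r horner_prod; apply: eq_bigr => i _; rewrite hornerXsubC.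
have [slt sE _] := hs; rewrite sE.
apply: sign_prod_sub; first by lia.
  case: i id => // i id k ki; apply: le_lt_trans (_ : s i < _).
    by have [->//|kn] := eqVneq k i; apply/ltW/slt; lia.
  by have /andP[+ _] := h1 i.+1 id; rewrite xs //; lia.
move=> k ik kd; apply: lt_le_trans (_ : _ < s i) _.
  by have /andP[_] := h1 i id; rewrite xs //; lia.
by have [->//|kn] := eqVneq k i; apply/ltW/slt; lia.
Qed.

Lemma hermite_alternates d : (0 < d)%N ->
  exists x : nat -> R, alternates (hermite_poly R d) d x 1.
Proof.
case: d => [//|[|d] _]; last first.
  by have [s /interlaced_alternates[x alt _]] := hermite_interlaced d; exists x.
exists (fun i => if i is 0 then -1 else 1); split; first by case=> // _; lra.
by case=> [|[|]] //= _; rewrite hermite_poly1 ?subn0 ?subnn ?expr0 ?expr1; lra.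
Qed.

End Hyperbolicity.

(** * Jensen polynomials as integrals *)

Section JensenLimit.
Variable R : realType.
Implicit Types (t theta u X : R) (L N m l k d n : nat) (z : R[i]).

Lemma cf_prodE t L z theta : 0 < t -> cf_prod t L z theta =
  (\prod_(1 <= k < L.+1) (1 - expR (- t) ^+ k) ^+ 2)%:C *
  ((euler z L * euler z^-1 L).[(expR (- t))%:C * cis theta])^-1.
Proof.
move=> t0; have hz y k : (1 - y *: 'X^k).[(expR (- t))%:C * cis theta] =
    1 - (expR (- t) ^+ k)%:C * (y * cis (k%:R * theta)).
  rewrite !hornerE exprMn cisX -(rmorphXn (real_complex R)) /=.
  by ring.
rewrite hornerM /euler !horner_prod invfM -!prodfV.
rewrite (rmorph_prod (real_complex R)) -big_split -big_split /cf_prod.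
rewrite big_nat_cond [RHS]big_nat_cond; apply: eq_bigr => k; rewrite andbT => /andP[k0 _].
rewrite /= !hz !(geom_cf_occ _ t0 k0).
have -> : ((1 - expR (- t) ^+ k) ^+ 2)%:C =
    (1 - expR (- t) ^+ k)%:C * (1 - expR (- t) ^+ k)%:C :> R[i] by rewrite -rmorphM expr2.
by rewrite mulrACA.
Qed.

Variables (alpha : nat -> R) (b c : nat) (wt : nat -> R[i]).
Hypothesis b0 : (0 < b)%N.
Hypothesis wt0 : wt 0 = 1.
Let z_ s : R[i] := unity_root R b ^+ s.
Hypothesis alphaE : forall n, (c <= n)%N -> exists2 C : nat -> R[i],
  (forall s, (s < b)%N -> is_bicoef (z_ s) (z_ s)^-1 (n - c) (C s)) &
  (b%:R * alpha n)%:C = \sum_(s < b) wt s * C s.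

Variable tf : nat -> R.
Hypothesis tf_ge : forall N, (0 < N)%N -> 2 / (N%:R + 2) <= tf N.
Hypothesis tf_sum : forall N, (0 < N)%N ->
  \sum_(1 <= k < (N.*2).+1) 2 * k%:R * occ (tf N) k = N%:R.
Let w N := width (tf N) N.*2.
Let F N z m l := saddle_integrand (tf N) N.*2 N z m l.

Definition saddle_sum N m l : R :=
  complex.Re (\sum_(s < b) wt s * cint (pi / w N) (F N (z_ s) m l)).

Let normc_z s : normc (z_ s) = 1.
Proof. by rewrite normcX normc_cis expr1n. Qed.

Let z_neq1 s : (0 < s)%N -> (s < b)%N -> z_ s != 1.
Proof.
move=> s0 sb; rewrite /z_ -(prim_order_dvd (unity_root_prim R b0)).
by rewrite gtnNdvd.
Qed.

Lemma saddle_sum_cvg m l :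
  saddle_sum ^~ m ^~ l @ \oo --> hermite_moment R m * gauss_moment R 0.
Proof.
have [b' eb] : exists b', b = b'.+1 by exists b.-1; rewrite prednK.
have e N : saddle_sum N m l = complex.Re (cint (pi / w N) (F N 1 m l)) +
    complex.Re (\sum_(s < b') wt s.+1 * cint (pi / w N) (F N (z_ s.+1) m l)).
  rewrite /saddle_sum; move: wt0 z_neq1 normc_z; rewrite /z_ eb => wt0' _ _.
  by rewrite big_ord_recl wt0' mul1r expr0 complex_ReD.
rewrite -hermite_moment_gauss -[X in _ --> X]addr0.
under eq_fun do rewrite e.
apply: cvgD; first exact: saddle_cint_eq1.
apply/norm_cvg0P; apply: (@cvg0_le _ _ (fun N => \sum_(s < b')
  normc (wt s.+1) * normc (cint (pi / w N) (F N (z_ s.+1) m l)))).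
  apply: nearW => N; rewrite normr_ge0 /=; apply: le_trans (ler_Re_normc _) _.
  apply: le_trans (ler_normc_sum _ _ _) _; apply: ler_sum => s _.
  by rewrite normcM.
rewrite -[X in _ --> X](_ : \sum_(s < b') normc (wt s.+1) * 0 = 0); last first.
  by rewrite big1 // => s _; rewrite mulr0.
apply: (@cvg_rsum _ _ _ (fun (s : 'I_b') N =>
  normc (wt s.+1) * normc (cint (pi / w N) (F N (z_ s.+1) m l)))) => s; apply: cvgM; first exact: cvg_cst.
apply: saddle_cint_neq1 => //; apply: z_neq1 => //.
by rewrite eb ltnS ltn_ord.
Qed.

(** Inverse of the truncated [G_0(e^(-t))] times the length of the interval. It is common to all
    coefficients and cancels in [jensen_hat_saddle]. *)
Let kappa N : R := (\prod_(1 <= k < (N.*2).+1) (1 - expR (- tf N) ^+ k) ^+ 2) *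
  (2 * (pi / w N)).

(** [k <= N] keeps the index [N + k] within the truncation [2N]; the shift by [k] appears as the
    extra phase [cis (- (w u)) ^+ k]. *)
Let saddle_cint_coef N k z C : 0 < tf N -> 0 < w N -> (k <= N)%N -> normc z = 1 ->
  is_bicoef z z^-1 (N + k) C ->
  cint (pi / w N) (fun u => cis (- (N%:R * (w N * u))) * cf_prod (tf N) N.*2 z (w N * u) *
    cis (- (w N * u)) ^+ k) = (kappa N * expR (- tf N) ^+ (N + k))%:C * C.
Proof.
move=> t0 w0 kN z1 hC; set r := expR (- tf N).
have r0 : 0 < r by exact: expR_gt0.
have r1 : r < 1 by rewrite -expR0 ltr_expR oppr_lt0.
have zV : normc z^-1 = 1 by rewrite normcV z1 invr1.
have := @bicoef_cint _ r (w N) r0 r1 w0 z z^-1 (N + k) C N.*2.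
rewrite z1 zV lexx => /(_ isT isT) h.
have kL : (N + k <= N.*2)%N by rewrite -addnn leq_add2l.
pose P := \prod_(1 <= k < (N.*2).+1) (1 - r ^+ k) ^+ 2.
transitivity (P%:C * ((2 * (pi / w N) * r ^+ (N + k))%:C * C)); last first.
  by rewrite mulrA -rmorphM /kappa -/r -/P mulrA mulrA mulrA.
rewrite -(h kL hC) -cintZ.
  apply: eq_cint => u; rewrite cf_prodE // -/r -/P cisX.
  have -> : cis (- ((N + k)%:R * w N) * u) =
      cis (- (N%:R * (w N * u))) * cis (k%:R * - (w N * u)).
    by rewrite -cisD natrD; congr cis; ring.
  by ring.
have e : (fun u => cis (- ((N + k)%:R * w N) * u) /
    (euler z N.*2 * euler z^-1 N.*2).[r%:C * cis (w N * u)]) =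
  (fun u => (P%:C)^-1 * (cis (- ((N + k)%:R * w N) * u) * cf_prod (tf N) N.*2 z (w N * u))).
  apply/funext => u; rewrite cf_prodE // -/r -/P.
  have P0 : P%:C != 0 :> R[i].
    rewrite -normc_eq0 normc_real normr_eq0 prodf_seq_neq0; apply/allP => i.
    rewrite mem_index_iota => /andP[i0 _]; rewrite /= expf_neq0 // subr_eq0 gt_eqF //.
    by rewrite exprn_ilt1 // ?ltW // -lt0n.
  by rewrite [RHS]mulrCA mulKf.
rewrite e; apply: ccontM; first exact: ccont_cst.
by apply: ccontM; [exact: ccont_cis|exact: ccont_cf_prod].
Qed.

Let kappa_gt0 N : 0 < tf N -> 0 < w N -> 0 < kappa N.
Proof.
move=> t0 w0; apply: mulr_gt0; last by rewrite mulr_gt0 // divr_gt0 // pi_gt0.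
rewrite big_nat_cond; apply: prodr_gt0 => k; rewrite andbT => /andP[k0 _].
have r1 : expR (- tf N) < 1 by rewrite -expR0 ltr_expR oppr_lt0.
by rewrite exprn_gt0 // subr_gt0 exprn_ilt1 ?expR_ge0 // -lt0n.
Qed.

(* The substitution [x = (w X - 1) / e^t] turns the binomial sum defining the Jensen
   polynomial into [(1 + (w X - 1) e^(-i w u))^d] under the integral sign, and
   [1 + (w X - 1) e^(-i w u) = (1 - e^(-i w u)) + w X e^(-i w u)]. *)
Let jensen_saddle N d X : 0 < tf N -> 0 < w N -> (d <= N)%N ->
  kappa N * expR (- tf N) ^+ N * b%:R *
    ((w N)^-1 ^+ d * (jensen alpha d (c + N)).[(w N * X - 1) / expR (tf N)]) =
  \sum_(m < d.+1) 'C(d, m)%:R * X ^+ (d - m) * saddle_sum N m (d - m).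
Proof.
move=> t0 w0 dN; set r := expR (- tf N).
pose W z u := cis (- (N%:R * (w N * u))) * cf_prod (tf N) N.*2 z (w N * u).
pose e u : R[i] := cis (- (w N * u)).
have cW z : normc z = 1 -> ccont (W z).
  by move=> z1; apply: ccontM; [exact: ccont_cisN|exact: ccont_cf_prod].
have ce : ccont e.
  rewrite [e](_ : _ = fun u => cis (- w N * u)); first exact: ccont_cis.
  by apply/funext => u; rewrite mulNr.
have coef k : (k <= d)%N -> kappa N * r ^+ N * b%:R * (alpha (c + N + k)%N * r ^+ k) =
    complex.Re (\sum_(s < b) wt s * cint (pi / w N) (fun u => W (z_ s) u * e u ^+ k)).
  move=> kd; have [|C hC aE] := @alphaE (c + N + k)%N; first by rewrite -addnA leq_addr.
  rewrite -addnA addKn in hC.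
  rewrite (eq_bigr (fun s : 'I_b => (kappa N * r ^+ (N + k))%:C * (wt s * C s))).
    rewrite -mulr_sumr -addnA in aE *.
    by rewrite -aE complex_ReMr /= exprD; ring.
  move=> s _; rewrite (saddle_cint_coef t0 w0 (leq_trans kd dN) (normc_z s) (hC s (ltn_ord s))).
  by rewrite mulrCA.
have binom u : \sum_(k < d.+1) ('C(d, k)%:R * (w N)^-1 ^+ d * (w N * X - 1) ^+ k)%:C * e u ^+ k =
    \sum_(m < d.+1) ('C(d, m)%:R * X ^+ (d - m))%:C *
      (((1 - e u) * (w N)^-1%:C) ^+ m * e u ^+ (d - m)).
  have wC : (w N)%:C != 0 :> R[i] by rewrite -normc_eq0 normc_real normr_eq0 gt_eqF.
  transitivity (((w N)^-1 ^+ d)%:C * (1 + (w N * X - 1)%:C * e u) ^+ d).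
    rewrite exprDn mulr_sumr; apply: eq_bigr => k _.
    by rewrite expr1n mul1r exprMn !rmorphM !rmorphXn rmorph_nat -mulr_natr; ring.
  transitivity ((X%:C * e u + (1 - e u) * (w N)^-1%:C) ^+ d); last first.
    rewrite exprDn; apply: eq_bigr => m _.
    by rewrite exprMn rmorphM rmorphXn rmorph_nat -mulr_natr; ring.
  rewrite rmorphXn -exprMn; congr (_ ^+ d).
  have -> : (w N * X - 1)%:C = (w N)%:C * X%:C - 1 :> R[i] by rewrite rmorphB rmorphM rmorph1.
  have -> : ((w N)^-1)%:C = ((w N)%:C)^-1 :> R[i] by exact: (fmorphV (real_complex R)).
  by field.
have cF s k : ccont (fun u => W (z_ s) u * e u ^+ k).
  by apply: ccontM; [exact: cW|exact: ccontX].
transitivity (complex.Re (\sum_(s < b) wt s * cint (pi / w N) (fun u => W (z_ s) u *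
    \sum_(k < d.+1) ('C(d, k)%:R * (w N)^-1 ^+ d * (w N * X - 1) ^+ k)%:C * e u ^+ k))).
  rewrite (eq_bigr (fun s : 'I_b => \sum_(k < d.+1)
    ('C(d, k)%:R * (w N)^-1 ^+ d * (w N * X - 1) ^+ k)%:C *
    (wt s * cint (pi / w N) (fun u => W (z_ s) u * e u ^+ k)))); last first.
    move=> s _; rewrite (eq_bigr (fun k : 'I_d.+1 => wt s * cint (pi / w N) (fun u =>
      ('C(d, k)%:R * (w N)^-1 ^+ d * (w N * X - 1) ^+ k)%:C * (W (z_ s) u * e u ^+ k)))).
      rewrite -mulr_sumr -cint_sum; last first.
        by move=> k; apply: ccontM; [exact: ccont_cst|exact: cF].
      congr (_ * _); apply: eq_cint => u; rewrite mulr_sumr; apply: eq_bigr => k _.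
      by rewrite mulrCA.
    by move=> k _; rewrite cintZ // mulrCA.
  rewrite exchange_big complex_Re_sum horner_poly !mulr_sumr; apply: eq_bigr => k _.
  rewrite -mulr_sumr complex_ReMr -coef; last by rewrite -ltnS.
  by rewrite exprMn -[(expR (tf N))^-1]expRN -/r; ring.
rewrite /saddle_sum.
rewrite (eq_bigr (fun s : 'I_b => \sum_(m < d.+1) ('C(d, m)%:R * X ^+ (d - m))%:C *
    (wt s * cint (pi / w N) (F N (z_ s) m (d - m))))).
  rewrite exchange_big complex_Re_sum; apply: eq_bigr => m _.
  by rewrite -mulr_sumr complex_ReMr.
move=> s _; have cS m l : ccont (F N (z_ s) m l) by apply: ccont_saddle.
rewrite (eq_bigr (fun m : 'I_d.+1 => wt s * cint (pi / w N) (fun u =>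
   ('C(d, m)%:R * X ^+ (d - m))%:C * F N (z_ s) m (d - m) u))); last first.
  by move=> m _; rewrite (cintZ _ _ (cS m (d - m)%N)) mulrCA.
rewrite -mulr_sumr -cint_sum; last first.
  by move=> m; apply: ccontM; [exact: ccont_cst|exact: cS].
congr (_ * _); apply: eq_cint => u; rewrite binom mulr_sumr; apply: eq_bigr => m _.
rewrite /F /saddle_integrand -/(w N) /W /e.
have -> : cis (- ((d - m)%:R * (w N * u))) = cis (- (w N * u)) ^+ (d - m).
  by rewrite cisX mulrN.
by ring.
Qed.

Lemma jensen_hat_saddle (A delta : nat -> R) N d X :
  A (c + N)%N = tf N -> delta (c + N)%N = w N -> 0 < tf N -> 0 < w N -> (d <= N)%N ->
  jensen_hat alpha A delta d (c + N) X =
  \sum_(m < d.+1) 'C(d, m)%:R * X ^+ (d - m) * (saddle_sum N m (d - m) / saddle_sum N 0 0).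
Proof.
move=> AN dN t0 w0 dd; rewrite /jensen_hat AN dN.
set q := kappa N * expR (- tf N) ^+ N * b%:R.
have q0 : q != 0.
  apply: lt0r_neq0; apply: mulr_gt0; last by rewrite ltr0n.
  by apply: mulr_gt0; [exact: kappa_gt0|apply: exprn_gt0; exact: expR_gt0].
(* The case [d = 0] of [jensen_saddle] expresses [alpha] itself with the same constant [q]. *)
have S0 : saddle_sum N 0 0 = q * alpha (c + N)%N.
  have := jensen_saddle X t0 w0 (leq0n N); rewrite big_ord1 bin0 subn0 expr0 !mul1r => <-.
  by rewrite horner_poly big_ord1 bin0 expr0 mul1r mulr1 addn0.
under eq_bigr do rewrite mulrA.
rewrite -mulr_suml -(jensen_saddle X t0 w0 dd) S0 -/q exprVn.
by rewrite -mulf_div divff // mul1r mulrAC.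
Qed.

End JensenLimit.

(** * From the saddle integrals to the theorem *)

Section Conclusion.
Variable R : realType.
Variables (alpha : nat -> R) (b c : nat) (wt : nat -> R[i]).
Hypothesis b0 : (0 < b)%N.
Hypothesis wt0 : wt 0 = 1.
Hypothesis alphaE : forall n, (c <= n)%N -> exists2 C : nat -> R[i],
  (forall s, (s < b)%N ->
    is_bicoef (unity_root R b ^+ s) (unity_root R b ^+ s)^-1 (n - c) (C s)) &
  (b%:R * alpha n)%:C = \sum_(s < b) wt s * C s.

Lemma jensen_hermite_limit : exists A delta : nat -> R,
  [/\ forall n, 0 < A n, forall n, 0 < delta n, delta @ \oo --> (0 : R) &
    forall d (B eps : R), 0 < B -> 0 < eps -> \forall n \near \oo, forall X, `|X| <= B ->
      `|jensen_hat alpha A delta d n X - hermite d X| < eps].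
Proof.
have /choice[tf tfP] : forall N, exists t : R, (0 < N)%N -> 2 / (N%:R + 2) <= t /\
    \sum_(1 <= k < (N.*2).+1) 2 * k%:R * occ t k = N%:R.
  case=> [|N]; first by exists 0.
  by have [t h1 h2] := @saddle_point R N.+1 isT; exists t.
have tf_ge N : (0 < N)%N -> 2 / (N%:R + 2) <= tf N by move=> /tfP[].
have tf_sum N : (0 < N)%N -> \sum_(1 <= k < (N.*2).+1) 2 * k%:R * occ (tf N) k = N%:R.
  by move=> /tfP[].
pose w N := width (tf N) N.*2.
have t8 : 0 < 1 / 8 :> R by lra.
have [n0 _ good] := tf_eventually tf_ge tf_sum t8.
have gt N : (n0 <= N)%N -> 0 < tf N /\ 0 < w N.
  by move=> /good [_ t0 t1 tL]; split => //; exact: width_gt0.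
(* The default value 1 keeps both sequences positive at the finitely many early indices. *)
exists (fun n => if (n0 <= n - c)%N then tf (n - c)%N else 1).
exists (fun n => if (n0 <= n - c)%N then w (n - c)%N else 1).
split.
- by move=> n; case: ifP => [/gt[]|].
- by move=> n; case: ifP => [/gt[]|].
- have : (fun n => w (n - c)%N) @ \oo --> (0 : R).
    by rewrite cvg_centern; exact: width_cvg0 tf_ge tf_sum.
  apply: cvg_trans; apply: near_eq_cvg.
  have := nbhs_infty_ge (n0 + c); apply: filterS => n nc.
  by rewrite ifT //; lia.
move=> d B eps B0 eps0.
pose S N m := saddle_sum b wt tf N m (d - m).
have g0 := gauss_moment0_gt0 R.
have cv m : (fun N => saddle_sum b wt tf N m (d - m) / saddle_sum b wt tf N 0 0) @ \oo -->
    hermite_moment R m.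
  have -> : hermite_moment R m = (hermite_moment R m * gauss_moment R 0) /
      (hermite_moment R 0 * gauss_moment R 0).
    by rewrite mul1r mulfK // gt_eqF.
  apply: cvgM; first exact: saddle_sum_cvg.
  apply: cvgV; first by rewrite mul1r gt_eqF.
  exact: saddle_sum_cvg.
(* A bound independent of [X] for [|X| <= B]: the convergence of finitely many coefficients is
   automatically uniform there. *)
pose err N := \sum_(m < d.+1) 'C(d, m)%:R * B ^+ (d - m) *
  `|saddle_sum b wt tf N m (d - m) / saddle_sum b wt tf N 0 0 - hermite_moment R m|.
have err0 : err @ \oo --> (0 : R).
  rewrite -[X in _ --> X](_ : \sum_(m < d.+1) 'C(d, m)%:R * B ^+ (d - m) * 0 = 0); last first.
    by rewrite big1 // => m _; rewrite mulr0.
  apply: (@cvg_rsum _ _ _ (fun (m : 'I_d.+1) N => 'C(d, m)%:R * B ^+ (d - m) *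
    `|saddle_sum b wt tf N m (d - m) / saddle_sum b wt tf N 0 0 - hermite_moment R m|)) => m.
  apply: cvgM; first exact: cvg_cst.
  apply/norm_cvg0P; rewrite -[X in _ --> X](subrr (hermite_moment R m)).
  by apply: cvgB; [exact: cv|exact: cvg_cst].
have /cvgrPdist_lt /(_ eps eps0)[n1 _ hn1] := err0.
(* [n0] gives positivity, [n1] the error bound, [d] the condition [d <= N], and [c] is the index
   shift. *)
exists (n0 + n1 + d + c)%N => // n /= hn X XB.
have cn : n = (c + (n - c))%N by lia.
set N := (n - c)%N in cn.
have nN : (n0 <= N)%N by rewrite /N; lia.
have [t0 w0] := gt N nN.
rewrite cn (@jensen_hat_saddle _ alpha b c wt b0 alphaE tf _ _ N d X) ?addKn ?nN //;
  last by rewrite /N; lia.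
rewrite hermiteE hermite_polyE.
have -> : \sum_(m < d.+1) 'C(d, m)%:R * hermite_moment R m * X ^+ (d - m) =
   \sum_(m < d.+1) 'C(d, m)%:R * X ^+ (d - m) * hermite_moment R m.
  by apply: eq_bigr => m _; rewrite mulrAC.
rewrite -sumrB; apply: le_lt_trans (_ : err N < eps); last first.
  have := hn1 N; rewrite /= sub0r normrN => h; apply: le_lt_trans (h _); first exact: ler_norm.
  by rewrite /N; lia.
apply: le_trans (ler_norm_sum _ _ _) _; apply: ler_sum => m _.
rewrite -mulrBr normrM ler_wpM2r // normrM normr_nat ler_wpM2l // normrX.
by rewrite lerXn2r ?nnegrE // ltW.
Qed.

End Conclusion.

(** At [d.+1] points where [H_d] alternates, an approximation with error below [|H_d|] has the same
    signs. The affine substitution is increasing as [delta n > 0], so the alternation passes to the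
    Jensen polynomial. *)
Lemma limit_hyperbolic (R : realType) (alpha A delta : nat -> R) (d : nat) :
  (0 < d)%N -> (forall n, 0 < delta n) ->
  (forall B eps : R, 0 < B -> 0 < eps -> \forall n \near \oo, forall X, `|X| <= B ->
      `|jensen_hat alpha A delta d n X - hermite d X| < eps) ->
  \forall n \near \oo, hyperbolic (jensen alpha d n).
Proof.
move=> d0 dp lim; have [x [xlt xsgn]] := @hermite_alternates R d d0.
have near_i i : (i <= d)%N -> \forall n \near \oo,
    `|jensen_hat alpha A delta d n (x i) - hermite d (x i)| < `|hermite d (x i)|.
  move=> id; have := xsgn i id; rewrite mul1r -hermiteE => h.
  have H0 : 0 < `|hermite d (x i)|.
    by rewrite normr_gt0; apply: contraTneq h => ->; rewrite mulr0 ltxx.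
  have B0 : 0 < `|x i| + 1 by rewrite ltr_wpDl.
  by have := lim _ _ B0 H0; apply: filterS => n; apply; rewrite lerDl.
have : \forall n \near \oo, forall i, (i < d.+1)%N ->
    `|jensen_hat alpha A delta d n (x i) - hermite d (x i)| < `|hermite d (x i)|.
  have : forall k, (k <= d.+1)%N -> \forall n \near \oo, forall i, (i < k)%N ->
      `|jensen_hat alpha A delta d n (x i) - hermite d (x i)| < `|hermite d (x i)|.
    elim=> [|k IH] kd; first by apply: nearW.
    have := near_i k kd; have := IH (ltnW kd); apply: filterS2 => n h1 h2 i.
    by rewrite ltnS leq_eqVlt => /predU1P[->//|]; exact: h1.
  exact.
apply: filterS => n hn; pose y i := (delta n * x i - 1) / expR (A n).
apply: (@alternates_hyperbolic _ _ d y ((delta n) ^- d / alpha n)); first exact: size_poly.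
split => i id.
  by rewrite ltr_pM2r ?invr_gt0 ?expR_gt0 // ltrD2r ltr_pM2l ?xlt.
have := hn i id; have := xsgn i id; rewrite mul1r -hermiteE /jensen_hat -/(y i).
set s := (-1) ^+ (d - i); set a := _ / _; set J := (jensen _ _ _).[_]; set H := hermite _ _.
have -> : a * s * J = s * (a * J) by ring.
move: (a * J) => u sH; have s1 : `|s| = 1 by rewrite normrX normrN1 expr1n.
have -> : `|H| = s * H by rewrite -[LHS]mul1r -s1 -normrM gtr0_norm.
rewrite -[X in X < _ -> _]mul1r -s1 -normrM ltr_norml => /andP[+ _].
by rewrite mulrBr; lra.
Qed.

Theorem theorem1p4 (R : realType) (j : int) (a b : nat) (alpha : nat -> R) :
  (2 %| j)%Z -> (1 < b)%N -> (a < b)%N ->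
  (alpha = (fun n => (pbar j n.*2)%:R) \/ alpha = (fun n => (pbar_ab j a b n.*2)%:R)) ->
  exists (A delta : nat -> R),
    (forall n, 0 < A n) /\ (forall n, 0 < delta n) /\ (delta @ \oo --> 0) /\
    (forall d : nat, (1 <= d)%N ->
       forall K : set R, compact K ->
       forall eps : R, 0 < eps ->
       exists N : nat, forall n : nat, (N <= n)%N ->
         forall X : R, K X ->
           `|jensen_hat alpha A delta d n X - hermite d X| < eps) /\
    (forall d : nat, (1 <= d)%N ->
       exists N : nat, forall n : nat, (N <= n)%N -> hyperbolic (jensen alpha d n)).
Proof.
move=> /dvdzP[j' jE] b1 ab alphaE.
(* Evenness of [j = 2j'] enters here: [(2j-1)j] is twice [(4j'-1)j'], which is nonnegative and at
   least [|j|]. *)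
have [c cE cj] : exists2 c : nat, (2 * j - 1) * j = (c.*2)%:Z & (`|j|%N <= c)%N.
  by exists (absz ((2 * j - 1) * j')); rewrite ?jE; nia.
have [A [delta [A0 d0 dlim lim]]] : exists A delta : nat -> R,
  [/\ forall n, 0 < A n, forall n, 0 < delta n, delta @ \oo --> (0 : R) &
    forall d (B eps : R), 0 < B -> 0 < eps -> \forall n \near \oo, forall X, `|X| <= B ->
      `|jensen_hat alpha A delta d n X - hermite d X| < eps].
  case: alphaE => ->.
    apply: (@jensen_hermite_limit R _ 1 c (fun=> 1)) => // n cn.
    exists (fun=> (pbar j n.*2)%:R).
      by case=> // _; rewrite expr0 invr1; exact: pbar_bicoef.
    by rewrite big_ord1 !mul1r rmorph_nat.
  apply: (@jensen_hermite_limit R _ b c (fun s => (unity_root R b ^+ s)^-1 ^+ a)) => //.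
  - exact: ltnW.
  - by rewrite expr0 invr1 expr1n.
  move=> n cn; have [C hC e] := @pbar_ab_bicoef R j a b n c (ltnW b1) cE cn.
  by exists C => //; rewrite -natrM rmorph_nat.
exists A, delta; split => //; split => //; split => //; split => d d1.
  move=> K /compact_bounded[M [_ KM]] eps eps0.
  have B0 : 0 < `|M| + 1 by rewrite ltr_wpDl.
  have [N _ hN] := lim d _ _ B0 eps0; exists N => n /hN h X KX; apply: h.
  by apply: KM => //; rewrite (le_lt_trans (ler_norm M)) // ltrDl.
have [N _ hN] := limit_hyperbolic d1 d0 (lim d).
by exists N => n /hN.
Qed.
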